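(* Let $\nu,\mu$ be normal weights on $\mathbb D$, let $\alpha>-1$ and let $\omega$ be a weight function such that $\{\nu,\omega\}$ is a normal pair with $\nu(r)\omega(r)=(1-r^2)^\alpha$ for $0\le r<1$. Let $g\in H(\mathbb D)$ and let $\phi$ be an analytic self-map of $\mathbb D$ such that $T_g^\phi:\mathcal H^\infty_\nu\to\mathcal B_\mu$ is bounded. Then the following statements are equivalent. (a) $T_g^\phi:\mathcal H^0_\nu\to\mathcal B_\mu$ is nuclear. (b) $T_g^\phi:\mathcal H^\infty_\nu\to\mathcal B_\mu$ is nuclear. (c) $$\int_{\mathbb D}\left[\sup_{z\in\mathbb D}\frac{\mu(z)|g'(z)|}{|1-\bar\zeta\phi(z)|^{\alpha+2}}\right]\frac{(1-|\zeta|^2)^\alpha}{\nu(\zeta)}\,dA(\zeta)<\infty.$$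
   Context: $\mathbb D$ is the open unit disk in $\mathbb C$, $H(\mathbb D)$ the space of analytic functions on $\mathbb D$, and $dA$ normalized Lebesgue measure on $\mathbb D$. For $g\in H(\mathbb D)$ and an analytic map $\phi:\mathbb D\to\mathbb D$, $(T_g^\phi f)(z)=\int_0^z f(\phi(\zeta))g'(\zeta)\,d\zeta$ for $f\in H(\mathbb D)$, $z\in\mathbb D$. A radial weight is a continuous positive function $\nu$ on $\mathbb D$ with $\nu(z)=\nu(|z|)$, non-increasing in $|z|$. It is normal if: (I) there is $\beta>0$ such that $r\mapsto\nu(r)/(1-r^2)^\beta$ is almost increasing on $[0,1)$; and (II) there is $\gamma>0$ such that $r\mapsto\nu(r)/(1-r^2)^\gamma$ is almost decreasing on $[0,1)$. (A function $h$ is almost increasing if there is $C>0$ with $h(r)\le C h(s)$ for all $r\le s$; almost decreasing if $h(s)\le C h(r)$ for all $r\le s$.) $\{\nu,\omega\}$ is a normal pair if $\nu$ is normal, $\omega$ is radial, positive and continuous with $\int_0^1\omega(r)\,dr<\infty$, and $\nu(r)\omega(r)=(1-r^2)^\alpha$, $0\le r<1$, for some $\alpha>\beta-1$, where $\beta>0$ is an exponent as in (I) for $\nu$. $\mathcal H^\infty_\nu=\{f\in H(\mathbb D):\|f\|_{\mathcal H^\infty_\nu}=\sup_{z\in\mathbb D}\nu(z)|f(z)|<\infty\}$ and $\mathcal H^0_\nu=\{f\in H(\mathbb D):\lim_{|z|\to1^-}\nu(z)|f(z)|=0\}$, with the norm of $\mathcal H^\infty_\nu$. The weighted Bloch space is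 $\mathcal B_\mu=\{f\in H(\mathbb D):\sup_{z\in\mathbb D}\mu(z)|f'(z)|<\infty\}$ with norm $|f(0)|+\sup_{z\in\mathbb D}\mu(z)|f'(z)|$. A linear operator $T:X\to Y$ between Banach spaces is nuclear if there are sequences $(x_k')\subset X'$ (the dual of $X$) and $(y_k)\subset Y$ with $\sum_k\|x_k'\|\|y_k\|<\infty$ and $Tx=\sum_k x_k'(x)y_k$ for all $x\in X$. *)

(* Defs.v *)
From HB Require Import structures.
From mathcomp Require Import all_boot all_order all_algebra.
From mathcomp Require Import complex.
From mathcomp Require Import all_classical all_reals all_analysis.

Set Implicit Arguments.
Unset Strict Implicit.
Unset Printing Implicit Defensive.

Import Order.TTheory GRing.Theory Num.Theory.
Import numFieldNormedType.Exports.

Local Open Scope classical_set_scope.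
Local Open Scope ring_scope.
Local Open Scope complex_scope.

(* [R[i]] as a normed space over itself, so that [derivable f z 1] and
   [derive1 f z] below are complex differentiability and the complex
   derivative. *)
HB.instance Definition _ (R : realType) := GRing.ComAlgebra.copy R[i] R[i]^o.
HB.instance Definition _ (R : realType) := Vector.copy R[i] R[i]^o.
HB.instance Definition _ (R : realType) := NormedModule.copy R[i] R[i]^o.

Import ComplexField.Normc.

Section disk.
Variable R : realType.
Local Notation C := R[i].
Local Notation Re := (@complex.Re R).
Local Notation Im := (@complex.Im R).

Definition disk : set C := [set z | normc z < 1].

Definition holomorphic (f : C -> C) := forall z, disk z -> derivable f z 1.

(* The canonical norm [`|z|] is valued in [R[i]]; [normc z] is the same modulus
   as an element of [R]. *)
Lemma normE (z : C) : `|z| = (normc z)%:C. Proof. by []. Qed.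

Lemma normc_ge0 (z : C) : 0 <= normc z.
Proof. by case: z => a b; rewrite sqrtr_ge0. Qed.

Lemma normcD (x y : C) : normc (x + y) <= normc x + normc y.
Proof. exact: le_normcD. Qed.

Lemma normcB (x y : C) : `|normc x - normc y| <= normc (x - y).
Proof.
rewrite ler_norml; apply/andP; split; last first.
  by rewrite lerBlDr -{1}(subrK y x) normcD.
rewrite lerNl opprB lerBlDr -(normcN (x - y)) opprB.
by rewrite -{1}(subrK x y) normcD.
Qed.

Lemma normcC (x : R) : normc x%:C = `|x|.
Proof. by rewrite /= expr0n /= addr0 sqrtr_sqr. Qed.

Lemma normc_Re (z : C) : `|Re z| <= normc z.
Proof. by have := normc_ge_Re z; rewrite normE lecR. Qed.

Lemma normc_Im (z : C) : `|Im z| <= normc z.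
Proof.
case: z => a b /=; rewrite -[leLHS]sqrtr_sqr ler_sqrt ?lerDr ?sqr_ge0 //.
by rewrite addr_ge0 ?sqr_ge0.
Qed.

Lemma normc_continuous : continuous (@normc R : C -> R).
Proof.
move=> z; apply/(@cvgrPdist_lt _ _ _ (nbhs z)) => e e0.
have eC0 : 0 < e%:C by rewrite ltcR.
near=> w; apply: (le_lt_trans (normcB _ _)).
rewrite -ltcR -normE; near: w.
by apply: (@cvgr_dist_lt _ _ _ (nbhs z) _ idfun z); [exact: cvg_id|].
Unshelve. all: by end_near. Qed.

Lemma mkC_continuous : continuous (fun p : R * R => (p.1 +i* p.2) : C).
Proof.
move=> p; apply/(@cvgrPdist_lt _ _ _ (nbhs p)) => -[e e'] he.
have [/eqP e'0 e0] : e' == 0 /\ 0 < e by move: he => /andP[].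
rewrite {}e'0 {e' he}.
near=> q.
have -> : (p.1 +i* p.2 : C) - (q.1 +i* q.2) =
   (p.1 - q.1)%:C + (p.2 - q.2)%:C * 'i.
  by apply/eqP; rewrite eq_complex; simpc; rewrite /= ?eqxx.
rewrite (le_lt_trans (ler_normD _ _)) // normrM.
have -> : `|'i : C| = 1 by rewrite normE /= expr0n expr1n add0r sqrtr1.
rewrite mulr1 !normE !normcC -rmorphD ltcR [ltRHS](splitr e) ltrD //.
- near: q; have h : (q.1 : R) @[q --> p] --> p.1 by exact: cvg_fst.
  by apply: (@cvgr_dist_lt _ _ _ _ _ _ _ h); rewrite divr_gt0.
- near: q; have h : (q.2 : R) @[q --> p] --> p.2 by exact: cvg_snd.
  by apply: (@cvgr_dist_lt _ _ _ _ _ _ _ h); rewrite divr_gt0.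
Unshelve. all: by end_near. Qed.

Lemma cball_compact (r : R) : compact [set z : C | normc z <= r].
Proof.
pose sq : set (R * R) := `[- r, r] `*` `[- r, r].
have sqc : compact sq by apply: compact_setX; exact: segment_compact.
pose j (p : R * R) : C := p.1 +i* p.2.
have jc : compact (j @` sq).
  apply: continuous_compact => //; apply: continuous_subspaceT.
  exact: mkC_continuous.
have -> : [set z : C | normc z <= r] = j @` sq `&` [set z | normc z <= r].
  apply/seteqP; split => [z /= zr|z [] //]; split=> //.
  exists (Re z, Im z) => /=; last by case: z {zr}.
  by split=> /=; rewrite in_itv /= -ler_norml;
    [apply: le_trans (normc_Re _) zr|apply: le_trans (normc_Im _) zr].
apply: compact_closedI => //.
rewrite (_ : [set z | _] = (@normc R : C -> R) @^-1` [set x | x <= r]) //.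
apply: closed_comp; last exact: closed_le.
by move=> z _; exact: normc_continuous.
Qed.

Lemma holomorphic_continuous (f : C -> C) z :
  holomorphic f -> disk z -> {for z, continuous f}.
Proof.
by move=> hf dz; apply: differentiable_continuous; apply/derivable1_diffP; exact: hf.
Qed.

Lemma derive10_small (K : numFieldType) (f : K -> K) w :
  derivable f w 1 -> derive1 f w = 0 ->
  forall e : K, 0 < e -> exists2 d : K, 0 < d &
    forall k, `|k| < d -> `|f (k + w) - f w| <= e * `|k|.
Proof.
move=> df f0 e e0.
have cf : h^-1 *: (f (h + w) - f w) @[h --> (0 : K)^'] --> derive1 f w.
  rewrite derive1E.
  suff -> : (fun h : K => h^-1 *: (f (h + w) - f w)) =
            (fun h => h^-1 *: ((f \o shift w) (h *: 1) - f w)) by exact: df.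
  by apply/funext => h /=; rewrite [h *: 1]mulr1.
rewrite f0 in cf; move/(@cvgrPdist_le _ _ _ (0 : K)^')/(_ _ e0) : cf.
move=> [d /= d0] H.
exists d => // k kd; have [->|k0] := eqVneq k 0.
  by rewrite add0r subrr normr0 mulr0.
have := H k; rewrite /= sub0r normrN => /(_ kd k0).
by rewrite sub0r normrN normrM normfV ler_pdivrMl ?normr_gt0// mulrC.
Qed.

Lemma derive0_small (f : C -> C) w : derivable f w 1 -> derive1 f w = 0 ->
  forall e : R, 0 < e -> exists2 d : R, 0 < d &
    forall k, normc k < d -> normc (f (k + w) - f w) <= e * normc k.
Proof.
move=> df f0 e e0; have eC0 : 0 < e%:C by rewrite ltcR.
have [[d d']] := derive10_small df f0 eC0.
move=> /andP[/eqP /= d'0 d0]; rewrite {}d'0 {d'} => H.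
exists d => // k kd; rewrite -lecR rmorphM; apply: (H k).
by rewrite normE ltcR.
Qed.

Lemma holomorphic0_real (f : C -> C) (L : {additive C -> R}) z :
  (forall x, `|L x| <= normc x) -> holomorphic f ->
  (forall z, disk z -> derive1 f z = 0) -> disk z -> L (f z) = L (f 0).
Proof.
move=> Ln hf f0 dz; pose u (t : R) := L (f (t%:C * z)).
have dt (t : R) : t \in `[0, 1] -> disk (t%:C * z).
  rewrite in_itv /= => /andP[t0 t1]; rewrite /disk /= normcM normcC ger0_norm//.
  by rewrite (le_lt_trans _ dz) // ler_piMl ?normc_ge0.
have du (t : R) : t \in `[0, 1] -> is_derive t 1 u 0.
  move=> t01.
  have cu : h^-1 *: (u (h *: 1 + t) - u t) @[h --> (0 : R)^'] --> (0 : R).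
    apply/(@cvgrPdist_le _ _ _ (0 : R)^') => e e0.
    have [d d0 H] := derive0_small (hf _ (dt _ t01)) (f0 _ (dt _ t01)) e0.
    near=> h.
    have h0 : h != 0 by near: h; exact: nbhs_dnbhs_neq.
    rewrite sub0r normrN normrM normfV ler_pdivrMl ?normr_gt0 // mulrC.
    rewrite /u -raddfB [h *: 1]mulr1 rmorphD mulrDl.
    apply: le_trans (Ln _) _.
    have hz : normc (h%:C * z) <= `|h|.
      by rewrite normcM normcC ler_piMr // ltW.
    apply: le_trans (H _ _) _; last by rewrite ler_pM2l.
    apply: le_lt_trans hz _.
    near: h; exists d => //= h /=; by rewrite sub0r normrN.
  by split; [exact: cvgP cu | exact: cvg_lim cu].
have hd (t : R) : t \in `]0, 1[%R -> is_derive t 1 u ((fun=> 0 : R) t).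
  by move=> t01; apply: du; exact: subset_itv_oo_cc t01.
have hc : {within `[0, 1], continuous u}.
  by apply: derivable_within_continuous => t t01; have [] := du t t01.
have [t _] := MVT_segment (@ler01 R) hd hc.
by rewrite mul0r => /eqP; rewrite subr_eq0 /u mul1r mul0r => /eqP.
Unshelve. all: by end_near. Qed.

Lemma holomorphic0_cst (f : C -> C) : holomorphic f ->
  (forall z, disk z -> derive1 f z = 0) -> forall z, disk z -> f z = f 0.
Proof.
move=> hf f0 z dz; apply/eqP; rewrite eq_complex; apply/andP; split; apply/eqP.
- exact: (@holomorphic0_real f (@complex.Re R : Rcomplex R -> R) z
    (fun x => normc_Re x) hf f0 dz).
- exact: (@holomorphic0_real f (@complex.Im R : Rcomplex R -> R) z
    (fun x => normc_Im x) hf f0 dz).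
Qed.

End disk.

Section weights.
Variable R : realType.
Local Notation C := R[i].

Definition almost_increasing (h : R -> R) := exists2 c : R, 0 < c &
  forall r s, 0 <= r -> r <= s -> s < 1 -> h r <= c * h s.

Definition almost_decreasing (h : R -> R) := exists2 c : R, 0 < c &
  forall r s, 0 <= r -> r <= s -> s < 1 -> h s <= c * h r.

Record radial_weight := RadialWeight {
  weight :> C -> R ;
  weight_gt0 : forall z, disk z -> 0 < weight z ;
  weight_continuous : {in @disk R, continuous weight} ;
  weight_radial : forall z, disk z -> weight z = weight (normc z)%:C ;
  weight_nincr : forall z w, disk w -> normc z <= normc w ->
    weight w <= weight z }.

Definition normal_exponent (nu : C -> R) (beta : R) := 0 < beta /\
  almost_increasing (fun r => nu r%:C / (1 - r ^+ 2) `^ beta).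

Definition normal (nu : radial_weight) :=
  (exists beta, normal_exponent nu beta) /\
  (exists2 gamma : R, 0 < gamma &
    almost_decreasing (fun r => nu r%:C / (1 - r ^+ 2) `^ gamma)).

(* [omega] is not required to be monotone, hence is not a [radial_weight]. *)
Definition normal_pair (nu : radial_weight) (omega : C -> R) :=
  [/\ normal nu,
      [/\ forall z, disk z -> 0 < omega z,
          {in @disk R, continuous omega} &
          forall z, disk z -> omega z = omega (normc z)%:C],
      (\int[lebesgue_measure]_(r in `[0%R, 1%R[) (omega r%:C)%:E < +oo)%E &
      exists alpha beta : R, [/\ normal_exponent nu beta, beta - 1 < alpha &
        forall r, 0 <= r < 1 -> nu r%:C * omega r%:C = (1 - r ^+ 2) `^ alpha]].

End weights.

Section weighted_sup.
Variable R : realType.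
Local Notation C := R[i].
Implicit Types (w : C -> R) (f g : C -> C) (z c : C).

Definition weighted_bounded w f :=
  has_ubound [set w z * normc (f z) | z in @disk R].

Definition weighted_sup w f : R := sup [set w z * normc (f z) | z in @disk R].

Lemma disk0 : disk (0 : C). Proof. by change (normc (0 : C) < 1); rewrite normc0. Qed.

Lemma disk_open : open (@disk R).
Proof.
rewrite (_ : @disk R = (@normc R : C -> R) @^-1` [set x | x < 1]) //.
by apply: open_comp; [move=> z _; exact: normc_continuous|exact: open_lt].
Qed.

Lemma weighted_bounded_le w f (M : R) :
  (forall z, disk z -> w z * normc (f z) <= M) -> weighted_bounded w f.
Proof. by move=> H; exists M => _ [z dz <-]; exact: H. Qed.

Lemma weighted_sup_ub w f z : weighted_bounded w f -> disk z ->
  w z * normc (f z) <= weighted_sup w f.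
Proof. by move=> bf dz; apply: ub_le_sup => //; exists z. Qed.

Lemma weighted_sup_le w f (M : R) :
  (forall z, disk z -> w z * normc (f z) <= M) -> weighted_sup w f <= M.
Proof.
move=> H; apply: ge_sup; last by move=> _ [z dz <-]; exact: H.
by exists (w 0 * normc (f 0)); exists 0 => //; exact: disk0.
Qed.

Section positive.
Variables (w : C -> R) (w_gt0 : forall z, disk z -> 0 < w z).

Lemma weighted_sup_eq0 f : weighted_bounded w f -> weighted_sup w f = 0 ->
  forall z, disk z -> f z = 0.
Proof.
move=> bf f0 z dz; apply: eq0_normc; apply/eqP.
rewrite -(mulrI_eq0 _ (mulfI (lt0r_neq0 (w_gt0 dz)))) eq_le.
rewrite mulr_ge0 ?normc_ge0 ?(ltW (w_gt0 dz)) // andbT.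
by rewrite -f0 weighted_sup_ub.
Qed.

Lemma weighted_bounded0 : weighted_bounded w (fun=> 0).
Proof. by apply: (@weighted_bounded_le _ _ 0) => z _; rewrite normc0 mulr0. Qed.

Lemma weighted_le_lin c f g h : weighted_bounded w f -> weighted_bounded w g ->
  (forall z, disk z -> h z = c * f z + g z) ->
  forall z, disk z ->
    w z * normc (h z) <= normc c * weighted_sup w f + weighted_sup w g.
Proof.
move=> bf bg H z dz; rewrite H //.
apply: (@le_trans _ _ (normc c * (w z * normc (f z)) + w z * normc (g z))).
  by rewrite mulrCA -mulrDr -normcM ler_pM2l ?w_gt0 // normcD.
by rewrite lerD ?weighted_sup_ub // ler_wpM2l ?normc_ge0 ?weighted_sup_ub.
Qed.

Lemma weighted_bounded_lin c f g h :
  weighted_bounded w f -> weighted_bounded w g ->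
  (forall z, disk z -> h z = c * f z + g z) -> weighted_bounded w h.
Proof.
by move=> bf bg H; apply: weighted_bounded_le; exact: weighted_le_lin H.
Qed.

Lemma weighted_supD f g h : weighted_bounded w f -> weighted_bounded w g ->
  (forall z, disk z -> h z = f z + g z) ->
  weighted_sup w h <= weighted_sup w f + weighted_sup w g.
Proof.
move=> bf bg H; apply: weighted_sup_le => z dz.
rewrite -[weighted_sup w f]mul1r -(normc1 R).
by apply: weighted_le_lin dz => // y dy; rewrite mul1r H.
Qed.

Lemma weighted_supZ c f h : weighted_bounded w f ->
  (forall z, disk z -> h z = c * f z) ->
  weighted_sup w h = normc c * weighted_sup w f.
Proof.
have le c' f' h' : weighted_bounded w f' ->
    (forall z, disk z -> h' z = c' * f' z) ->
    weighted_sup w h' <= normc c' * weighted_sup w f'.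
  move=> bf H; apply: weighted_sup_le => z dz.
  rewrite H // normcM mulrCA ler_wpM2l ?normc_ge0 //.
  exact: weighted_sup_ub.
move=> bf H; apply/eqP; rewrite eq_le le //=.
have [c0|c0] := eqVneq c 0.
  rewrite c0 normc0 mul0r; apply: le_trans (weighted_sup_ub _ disk0); last first.
    apply: weighted_bounded_lin bf weighted_bounded0 _ => z dz.
    by rewrite addr0 H.
  by rewrite mulr_ge0 ?normc_ge0 // ltW // w_gt0 //; exact: disk0.
have nc0 : 0 < normc c.
  by rewrite lt_neqAle normc_ge0 eq_sym andbT; apply: contra_neq c0 => /eq0_normc.
rewrite -ler_pdivlMl // -normcV; apply: le => [|z dz].
  by apply: weighted_bounded_lin bf weighted_bounded0 _ => z dz; rewrite addr0 H.
by rewrite H // mulKf.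
Qed.

End positive.
End weighted_sup.

Section holomorphic_on_disk.
Variable R : realType.
Local Notation C := R[i].

(* The elements of the function spaces are functions on the open disk; they
   are represented by their extension by 0 to the whole plane, so that Leibniz
   equality is equality on the disk. *)
Definition holomorphic_on_disk : set (C -> C) :=
  [set f | holomorphic f /\ forall z, ~ disk z -> f z = 0].

Lemma derive1_lin (f g : C -> C) (c z : C) : derivable f z 1 -> derivable g z 1 ->
  derivable (c *: f + g) z 1 /\
  derive1 (c *: f + g) z = c * derive1 f z + derive1 g z.
Proof.
move=> df dg; have dcf : derivable (c *: f) z 1 by exact: derivableZ.
split; first exact: derivableD.
by rewrite derive1E (deriveD dcf dg) (deriveZ c df) (derive1E f) (derive1E g).
Qed.

Lemma holomorphic_on_disk0 : holomorphic_on_disk 0.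
Proof. by split=> // z _; exact: derivable_cst. Qed.

Lemma holomorphic_on_disk_lin (c : C) (f g : C -> C) :
  holomorphic_on_disk f -> holomorphic_on_disk g ->
  holomorphic_on_disk (c *: f + g).
Proof.
move=> [hf f0] [hg g0]; split=> [z dz|z dz].
  by have [] := derive1_lin c (hf z dz) (hg z dz).
have -> : (c *: f + g) z = c * f z + g z by [].
by rewrite f0 // g0 // mulr0 addr0.
Qed.

Lemma holomorphic_on_disk_eq0 (f : C -> C) :
  holomorphic_on_disk f -> (forall z, disk z -> f z = 0) -> f = 0.
Proof.
by move=> [_ f0] f1; apply/funext => z; have [/f1|/f0] := pselect (disk z).
Qed.

End holomorphic_on_disk.

Section growth_space.
Variables (R : realType) (nu : radial_weight R).
Local Notation C := R[i].

Definition Hinf_pred : {pred C -> C} := mem [set f : C -> C |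
  holomorphic_on_disk f /\ weighted_bounded nu f].

Lemma Hinf_submod_closed : submod_closed Hinf_pred.
Proof.
split=> [|c f g /set_mem[hf bf] /set_mem[hg bg]]; apply/mem_set; split.
- exact: holomorphic_on_disk0.
- exact: weighted_bounded0.
- exact: holomorphic_on_disk_lin.
- exact: (weighted_bounded_lin (@weight_gt0 _ nu) bf bg (c := c)).
Qed.

Record Hinf := MkHinf { Hinf_fun :> C -> C ; _ : Hinf_fun \in Hinf_pred }.

HB.instance Definition _ := [isSub for Hinf_fun].
HB.instance Definition _ := [Choice of Hinf by <:].
HB.instance Definition _ := GRing.isSubmodClosed.Build C (C -> C) Hinf_pred
  Hinf_submod_closed.
HB.instance Definition _ := [SubChoice_isSubLmodule of Hinf by <:].

Lemma HinfP (f : Hinf) : holomorphic_on_disk f /\ weighted_bounded nu f.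
Proof. by case: f => f hf; exact: (set_mem hf). Qed.

Definition Hinf_norm (f : Hinf) : C := (weighted_sup nu f)%:C.

Lemma Hinf_normD f g : Hinf_norm (f + g) <= Hinf_norm f + Hinf_norm g.
Proof.
rewrite /Hinf_norm -rmorphD lecR.
by apply: (weighted_supD (@weight_gt0 _ nu)) => //; exact: (HinfP _).2.
Qed.

Lemma Hinf_normZ (c : C) f : Hinf_norm (c *: f) = `|c| * Hinf_norm f.
Proof.
rewrite normE -rmorphM /Hinf_norm; congr (_ %:C).
by apply: (weighted_supZ (@weight_gt0 _ nu)) => //; exact: (HinfP _).2.
Qed.

Lemma Hinf_norm_eq0 f : Hinf_norm f = 0 -> f = 0.
Proof.
move=> [f0]; apply: val_inj; apply: holomorphic_on_disk_eq0 (HinfP f).1 _.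
exact: (weighted_sup_eq0 (@weight_gt0 _ nu)) (HinfP f).2 f0.
Qed.

HB.instance Definition _ :=
  Lmodule_isNormed.Build C Hinf Hinf_normD Hinf_normZ Hinf_norm_eq0.

End growth_space.

Section little_growth_space.
Variables (R : realType) (nu : radial_weight R).
Local Notation C := R[i].

Definition vanishes_at_boundary (F : C -> R) := forall e : R, 0 < e ->
  exists2 r : R, r < 1 & forall z, r < normc z < 1 -> `|F z| < e.

Lemma vanishing_bounded (f : C -> C) : holomorphic f ->
  vanishes_at_boundary (fun z => nu z * normc (f z)) -> weighted_bounded nu f.
Proof.
move=> hf /(_ _ ltr01) [r r1 H].
pose F z : R := nu z * normc (f z).
have cF : {within [set z : C | normc z <= r], continuous F}.
  apply: continuous_in_subspaceT => z /set_mem /= zr.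
  have dz : disk z by exact: le_lt_trans r1.
  have cw := @weight_continuous R nu z (mem_set dz).
  have cn : {for z, continuous (fun z => normc (f z))}.
    apply: (@continuous_comp C C R f (@normc R) z).
      exact: holomorphic_continuous.
    exact: normc_continuous.
  exact: (cvgM cw cn).
have /compact_bounded/pinfty_ex_gt0[M M0 HM] :=
  continuous_compact cF (@cball_compact R r).
apply: (@weighted_bounded_le _ _ _ (Num.max M 1)) => z dz.
rewrite le_max; have [zr|rz] := leP (normc z) r.
  by rewrite (le_trans (ler_norm _)) //; apply: HM; exists z.
by rewrite orbC (le_trans (ler_norm _)) // ltW // H // rz.
Qed.

Definition H0_pred : {pred C -> C} := mem [set f : C -> C |
  holomorphic_on_disk f /\
  vanishes_at_boundary (fun z => nu z * normc (f z))].

Lemma H0_submod_closed : submod_closed H0_pred.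
Proof.
split=> [|c f g /set_mem[hf vf] /set_mem[hg vg]]; apply/mem_set; split.
- exact: holomorphic_on_disk0.
- move=> e e0; exists 0 => // z _.
  by rewrite [normc _](normc0 R) mulr0 normr0.
- exact: holomorphic_on_disk_lin.
- move=> e e0; have c1 : 0 < normc c + 1 by rewrite ltr_wpDl ?normc_ge0.
  have [|r r1 Hr] := vf (e / (normc c + 1)); first by rewrite divr_gt0.
  have [|s s1 Hs] := vg (e / (normc c + 1)); first by rewrite divr_gt0.
  exists (Num.max r s); first by rewrite gt_max r1 s1.
  move=> z; rewrite gt_max -andbA => /and3P[rz sz z1].
  have w0 : 0 < nu z by exact: weight_gt0.
  have pos h : 0 <= nu z * normc (h z) by rewrite mulr_ge0 ?normc_ge0 // ltW.
  rewrite (ger0_norm (pos (c *: f + g))).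
  have := Hr z; rewrite rz z1 => /(_ isT); rewrite (ger0_norm (pos f)) => fe.
  have := Hs z; rewrite sz z1 => /(_ isT); rewrite (ger0_norm (pos g)) => ge.
  apply: (@le_lt_trans _ _
      (normc c * (nu z * normc (f z)) + nu z * normc (g z))).
    by rewrite mulrCA -mulrDr -normcM ler_pM2l // normcD.
  rewrite [ltRHS](_ : _ = normc c * (e / (normc c + 1)) + e / (normc c + 1)).
    by rewrite ler_ltD // ler_wpM2l ?normc_ge0 // ltW.
  by rewrite -[X in _ + X]mul1r -mulrDl mulrCA divff ?mulr1 // lt0r_neq0.
Qed.

Record H0 := MkH0 { H0_fun :> C -> C ; _ : H0_fun \in H0_pred }.

HB.instance Definition _ := [isSub for H0_fun].
HB.instance Definition _ := [Choice of H0 by <:].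
HB.instance Definition _ := GRing.isSubmodClosed.Build C (C -> C) H0_pred
  H0_submod_closed.
HB.instance Definition _ := [SubChoice_isSubLmodule of H0 by <:].

Lemma H0P (f : H0) : holomorphic_on_disk f /\ weighted_bounded nu f.
Proof.
case: f => f hf; have [hol van] := set_mem hf; split=> //.
by apply: vanishing_bounded van; exact: hol.1.
Qed.

Definition H0_norm (f : H0) : C := (weighted_sup nu f)%:C.

Lemma H0_normD f g : H0_norm (f + g) <= H0_norm f + H0_norm g.
Proof.
rewrite /H0_norm -rmorphD lecR.
by apply: (weighted_supD (@weight_gt0 _ nu)) => //; exact: (H0P _).2.
Qed.

Lemma H0_normZ (c : C) f : H0_norm (c *: f) = `|c| * H0_norm f.
Proof.
rewrite normE -rmorphM /H0_norm; congr (_ %:C).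
by apply: (weighted_supZ (@weight_gt0 _ nu)) => //; exact: (H0P _).2.
Qed.

Lemma H0_norm_eq0 f : H0_norm f = 0 -> f = 0.
Proof.
move=> [f0]; apply: val_inj; apply: holomorphic_on_disk_eq0 (H0P f).1 _.
exact: (weighted_sup_eq0 (@weight_gt0 _ nu)) (H0P f).2 f0.
Qed.

HB.instance Definition _ :=
  Lmodule_isNormed.Build C H0 H0_normD H0_normZ H0_norm_eq0.

End little_growth_space.

Section bloch_space.
Variables (R : realType) (mu : radial_weight R).
Local Notation C := R[i].

Definition bloch_pred : {pred C -> C} := mem [set f : C -> C |
  holomorphic_on_disk f /\ weighted_bounded mu (derive1 f)].

Lemma bloch_submod_closed : submod_closed bloch_pred.
Proof.
split=> [|c f g /set_mem[hf bf] /set_mem[hg bg]]; apply/mem_set; split.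
- exact: holomorphic_on_disk0.
- rewrite (_ : derive1 _ = fun=> 0); first exact: weighted_bounded0.
  by apply/funext => z; exact: derive1_cst.
- exact: holomorphic_on_disk_lin.
- apply: (weighted_bounded_lin (@weight_gt0 _ mu) bf bg (c := c)) => z dz.
  by have [] := derive1_lin c (hf.1 z dz) (hg.1 z dz).
Qed.

Record bloch := MkBloch { bloch_fun :> C -> C ; _ : bloch_fun \in bloch_pred }.

HB.instance Definition _ := [isSub for bloch_fun].
HB.instance Definition _ := [Choice of bloch by <:].
HB.instance Definition _ := GRing.isSubmodClosed.Build C (C -> C) bloch_pred
  bloch_submod_closed.
HB.instance Definition _ := [SubChoice_isSubLmodule of bloch by <:].

Lemma blochP (f : bloch) :
  holomorphic_on_disk f /\ weighted_bounded mu (derive1 f).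
Proof. by case: f => f hf; exact: (set_mem hf). Qed.

Definition bloch_norm (f : bloch) : C :=
  (normc (f 0) + weighted_sup mu (derive1 f))%:C.

Lemma bloch_normD f g : bloch_norm (f + g) <= bloch_norm f + bloch_norm g.
Proof.
rewrite /bloch_norm -rmorphD lecR addrACA lerD ?normcD //.
apply: (weighted_supD (@weight_gt0 _ mu)); [exact: (blochP _).2..|] => z dz.
have [_] := derive1_lin 1 ((blochP f).1.1 z dz) ((blochP g).1.1 z dz).
by rewrite scale1r mul1r.
Qed.

Lemma bloch_normZ (c : C) f : bloch_norm (c *: f) = `|c| * bloch_norm f.
Proof.
rewrite normE -rmorphM /bloch_norm mulrDr -normcM; congr ((_ + _)%:C).
apply: (weighted_supZ (@weight_gt0 _ mu)); first exact: (blochP _).2.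
move=> z dz.
have [_] := derive1_lin c ((blochP f).1.1 z dz) ((@holomorphic_on_disk0 R).1 z dz).
by rewrite addr0 (derive1_cst (0 : C)) addr0.
Qed.

Lemma bloch_norm_eq0 f : bloch_norm f = 0 -> f = 0.
Proof.
move=> [/eqP]; have [[hf f_out] bf] := blochP f.
have sup_ge0 : 0 <= weighted_sup mu (derive1 f).
  apply: le_trans (weighted_sup_ub bf (@disk0 R)).
  by rewrite mulr_ge0 ?normc_ge0 // ltW // weight_gt0 //; exact: disk0.
rewrite paddr_eq0 ?normc_ge0 // => /andP[/eqP/eq0_normc f0 /eqP df0].
apply: val_inj; apply: holomorphic_on_disk_eq0 => // z dz.
have fz : f z = f 0.
  apply: (holomorphic0_cst hf) dz.
  exact: (weighted_sup_eq0 (@weight_gt0 _ mu)) bf df0.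
exact: etrans fz f0.
Qed.

HB.instance Definition _ :=
  Lmodule_isNormed.Build C bloch bloch_normD bloch_normZ bloch_norm_eq0.

End bloch_space.


Section operators.
Variable R : realType.
Local Notation C := R[i].

(* Norms of modules over [R[i]] take their values in the nonnegative reals
   of [R[i]]. *)
Definition real_norm (V : normedModType C) (x : V) : R := complex.Re `|x|.

Definition dual_norm (X : normedModType C) (x' : X -> C) : R :=
  sup [set normc (x' x) | x in [set x : X | real_norm x <= 1]].

Definition nuclear (X Y : normedModType C) (T : X -> Y) :=
  exists (x' : nat -> {linear X -> C}) (y : nat -> Y),
    [/\ forall k, continuous (x' k),
        (\sum_(0 <= k <oo) (dual_norm (x' k) * real_norm (y k))%:E < +oo)%E &
        forall x, [series x' k x *: y k]_k @ \oo --> T x].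

Record function_space := FunctionSpace {
  space :> normedModType C ;
  eval : space -> C -> C }.

Definition H_infty (nu : radial_weight R) := FunctionSpace (@Hinf_fun R nu).
Definition H_zero (nu : radial_weight R) := FunctionSpace (@H0_fun R nu).
Definition Bloch (mu : radial_weight R) := FunctionSpace (@bloch_fun R mu).

(* [L : X -> Y] is the restriction of [T] to [X]; in particular [T] maps [X]
   into [Y]. *)
Definition induced_by (T : (C -> C) -> C -> C) (X Y : function_space)
    (L : X -> Y) :=
  forall (f : X) z, disk z -> eval (L f) z = T (eval f) z.

Definition bounded_from_to (T : (C -> C) -> C -> C) (X Y : function_space) :=
  exists2 L : {linear X -> Y}, induced_by T L & bounded_near L (nbhs (0 : X)).

Definition nuclear_from_to (T : (C -> C) -> C -> C) (X Y : function_space) :=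
  exists2 L : {linear X -> Y}, induced_by T L & nuclear L.

Definition integral01 (h : R -> C) : C :=
  (\int[lebesgue_measure]_(t in `[0%R, 1%R]) complex.Re (h t)) +i*
  (\int[lebesgue_measure]_(t in `[0%R, 1%R]) complex.Im (h t)).

(* The integral from 0 to z is taken along the segment t |-> t z. *)
Definition T_op (g phi f : C -> C) (z : C) : C :=
  integral01 (fun t => f (phi (t%:C * z)) * derive1 g (t%:C * z) * z).

Definition self_map (phi : C -> C) :=
  holomorphic phi /\ forall z, disk z -> disk (phi z).

(* Integral against the area measure normalized to give the disk mass 1. *)
Definition area_integral (F : C -> \bar R) : \bar R :=
  ((pi^-1)%:E * \int[lebesgue_measure \x lebesgue_measure]_(p in
     [set p : R * R | disk (p.1 +i* p.2)]) F (p.1 +i* p.2))%E.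

End operators.

(* Main.v *)
(** With [p >= alpha, beta] an integer and [K_z w = (1 - conj z * w) ^ -(p + 2)], every [f] in
    the growth space satisfies [c f w = int f z (1 - |z|^2)^p K_z w dA z], so that
    formally [T f = c^-1 int (1 - |z|^2)^p f z T K_z dA z]; the reproducing formula comes
    from a Goursat-type Green formula on squares, and it also shows that
    [(T f)' = (f o phi) g'].

    For (c) => (b), this Bochner integral is turned into a sum over the dyadic
    squares contained in the disk away from the circle: [K_z] telescopes along
    the squares containing [z] as a sum of differences of kernels at
    representative points, and the difference at a square of side [h] has size
    [h / (1 - |z|)] times [|K_z|], which is summable over the generations.

    For (a) => (c), a nuclear representation [T = sum_k x'_k (.) y_k] is tested on
    the kernels at the representatives of the Whitney squares: the Forelli-Rudin
    estimate bounds every finite combination of these kernels with unimodular coefficients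
    and weights [(1 - |q|^2)^p h^2 / nu q], whence
    [sum_q (1 - |q|^2)^p h^2 / nu q * ||T K_q|| <= C sum_k ||x'_k|| ||y_k||].
    When [phi w] lies in the square of [q], the integrand of (c) is at most a multiple
    of [||T K_q|| (1 - |q|^2)^p h^2] times a Forelli-Rudin kernel at [q]. *)

(* An integer exponent makes [K_z] a power of a rational function, with no branch to choose; a
   positive one makes the weight kill the boundary term in Green's formula on a square around the
   disk. In (c) => (b) the real exponent [alpha] returns only through
   [1 - |z|^2 <= 2 |1 - conj z * w|], which absorbs the surplus power [p - alpha].

   The obstacle in (c) => (b) is that nuclearity asks for an exact series, whereas a kernel frozen
   at one point of each Whitney square reproduces functions only approximately. Hence the refinement
   through all generations: infinitely many squares contain a given point, but their ratios
   [h / (1 - |z|)] are dominated by a geometric series, so the integral in (c) pays for all of them.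

   The obstacle in (a) => (c) is the supremum under the integral. Attaching to each [w] the square
   of [phi w] replaces it by a sum over squares in which [w] no longer occurs, and Forelli-Rudin
   integrates that sum term by term. The coefficients of modulus at most 1 are chosen anew for each
   functional [x'_k], so that a norm bound on finite combinations of kernels becomes a bound by
   [||x'_k||]. *)
Require Import Defs.
From HB Require Import structures.
From mathcomp Require Import all_boot all_order all_algebra.
From mathcomp Require Import complex.
From mathcomp Require Import all_classical all_reals all_analysis.
From mathcomp Require Import measurable_realfun.
From mathcomp Require Import ring lra zify.
Set Implicit Arguments.
Unset Strict Implicit.
Unset Printing Implicit Defensive.
Import Order.TTheory GRing.Theory Num.Theory.
Import numFieldNormedType.Exports.
Import ComplexField.Normc.
Local Open Scope classical_set_scope.
Local Open Scope ring_scope.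
Local Open Scope complex_scope.

Local Notation eval := (@Defs.eval _ _).

(** * Wirtinger expansions *)

Section wirtinger.
Variable R : realType.
Local Notation C := R[i].
Implicit Types (f g : C -> C) (z w k a b : C).

Lemma normc_conj z : normc (conjc z) = normc z.
Proof. by case: z => x y /=; rewrite sqrrN. Qed.

Lemma normcX z n : normc (z ^+ n) = normc z ^+ n.
Proof. by elim: n => [|n IH]; rewrite ?expr0 ?normc1 // !exprS normcM IH. Qed.

Lemma normc_sub z w : normc (z - w) = normc (w - z).
Proof. by rewrite -normcN opprB. Qed.

Lemma normc_gt0 z : (0 < normc z) = (z != 0).
Proof.
rewrite lt_neqAle normc_ge0 andbT eq_sym; congr (~~ _).
by apply/eqP/eqP => [/eq0_normc|->]; rewrite ?normc0.
Qed.

Lemma normc_nat n : normc (n%:R : C) = n%:R.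
Proof. by rewrite -(rmorph_nat (real_complex R)) normcC ger0_norm. Qed.

(* [f (z + k) = f z + a k + b conj k + o(k)]: [a] and [b] are the Wirtinger
   derivatives of [f] at [z]. *)
Definition wd f z a b := forall e : R, 0 < e -> exists2 d : R, 0 < d &
  forall k, normc k < d ->
    normc (f (z + k) - f z - a * k - b * conjc k) <= e * normc k.

Lemma wd_local f g z a b (d : R) : 0 < d ->
  (forall k, normc k < d -> f (z + k) = g (z + k)) -> wd f z a b -> wd g z a b.
Proof.
move=> d0 fg H e /H[r r0 Hr]; exists (Num.min d r); first by rewrite lt_min d0.
move=> k; rewrite lt_min => /andP[kd kr].
have g0 : g z = f z by have := fg 0; rewrite addr0 normc0 => ->.
by rewrite g0 -fg //; exact: Hr.
Qed.

Lemma wd_cst c z : wd (fun=> c) z 0 0.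
Proof.
by move=> e e0; exists 1 => // k _; rewrite subrr !mul0r !subr0 normc0 mulr_ge0 ?normc_ge0 // ltW.
Qed.

Lemma wd_id z : wd id z 1 0.
Proof.
move=> e e0; exists 1 => // k _; rewrite (_ : _ - _ = 0) ?normc0 ?mulr_ge0 ?normc_ge0 ?ltW //.
by ring.
Qed.

Lemma wd_conj z : wd (@conjc R) z 0 1.
Proof.
move=> e e0; exists 1 => // k _; rewrite (_ : _ - _ = 0) ?normc0 ?mulr_ge0 ?normc_ge0 ?ltW //.
by rewrite rmorphD /=; ring.
Qed.

Lemma wd_lip f z a b : wd f z a b -> exists M d : R, [/\ 0 < M, 0 < d &
  forall k, normc k < d -> normc (f (z + k) - f z) <= M * normc k].
Proof.
move=> /(_ 1 ltr01)[d d0 H]; exists (1 + normc a + normc b), d; split => //.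
  by rewrite -addrA ltr_pwDl // addr_ge0 ?normc_ge0.
move=> k /H {}H; rewrite mul1r in H.
rewrite (_ : f (z + k) - f z = (f (z + k) - f z - a * k - b * conjc k) + a * k + b * conjc k); last by ring.
apply: le_trans (normcD _ _) _; apply: le_trans (lerD (normcD _ _) (lexx _)) _.
by rewrite !normcM normc_conj !mulrDl mul1r !lerD.
Qed.

Lemma wdD f g z a b a' b' : wd f z a b -> wd g z a' b' ->
  wd (fun x => f x + g x) z (a + a') (b + b').
Proof.
move=> hf hg e e0; have e2 : 0 < e / 2 by rewrite divr_gt0.
have [d d0 Hf] := hf _ e2; have [r r0 Hg] := hg _ e2.
exists (Num.min d r); first by rewrite lt_min d0.
move=> k; rewrite lt_min => /andP[/Hf {}Hf /Hg {}Hg].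
rewrite (_ : _ - _ = (f (z + k) - f z - a * k - b * conjc k) +
  (g (z + k) - g z - a' * k - b' * conjc k)); last by ring.
by apply: le_trans (normcD _ _) _; rewrite [e]splitr mulrDl lerD.
Qed.

(** The remainder consists of the two linear remainders and the product of the increments of [f] and
    [g]; [wd_lip] makes that product quadratic in [k]. The 1 in [K] only keeps it positive. *)
Lemma wdM f g z a b a' b' : wd f z a b -> wd g z a' b' ->
  wd (fun x => f x * g x) z (a * g z + f z * a') (b * g z + f z * b').
Proof.
move=> hf hg e e0.
have [M [d1 [M0 d10 H1]]] := wd_lip hf; have [M' [d2 [M'0 d20 H2]]] := wd_lip hg.
pose K := 1 + normc (f z) + normc (g z).
have K0 : 0 < K by rewrite /K -addrA ltr_pwDl // addr_ge0 ?normc_ge0.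
have e2 : 0 < e / (2 * K) by rewrite divr_gt0 // mulr_gt0.
have [d3 d30 Hf] := hf _ e2; have [d4 d40 Hg] := hg _ e2.
have d50 : 0 < e / (2 * (M * M')) by rewrite divr_gt0 // !mulr_gt0.
exists (Num.min (Num.min d1 d2) (Num.min (Num.min d3 d4) (e / (2 * (M * M'))))).
  by rewrite !lt_min d10 d20 d30 d40.
move=> k; rewrite !lt_min => /andP[/andP[/H1 {}H1 /H2 {}H2]].
move=> /andP[/andP[/Hf {}Hf /Hg {}Hg] kd].
rewrite (_ : _ - _ = (f (z + k) - f z - a * k - b * conjc k) * g z +
  (f z * (g (z + k) - g z - a' * k - b' * conjc k)
   + (f (z + k) - f z) * (g (z + k) - g z))); last by ring.
apply: le_trans (normcD _ _) _.
apply: (@le_trans _ _ (e / (2 * K) * normc k * normc (g z) +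
  (normc (f z) * (e / (2 * K) * normc k) + (M * normc k) * (M' * normc k)))).
  apply: lerD; first by rewrite normcM ler_wpM2r ?normc_ge0.
  apply: le_trans (normcD _ _) _; apply: lerD.
    by rewrite normcM ler_wpM2l ?normc_ge0.
  by rewrite normcM ler_pM ?normc_ge0.
have k0 : 0 <= normc k := normc_ge0 k.
have : normc k * (M * M') <= e / 2.
  apply: ltW; rewrite -ltr_pdivlMr ?mulr_gt0 // (lt_le_trans kd) //.
  by rewrite invfM mulrA.
have : e / (2 * K) * (normc (g z) + normc (f z)) <= e / 2.
  rewrite invfM mulrA -[leRHS]mulr1 -mulrA ler_pM2l ?divr_gt0 //.
  by rewrite mulrC ler_pdivrMr // mul1r /K -addrA [normc _ + _]addrC lerDr.
move=> A B; rewrite (_ : _ + _ = (e / (2 * K) * (normc (g z) + normc (f z)) + normc k * (M * M')) * normc k); last by ring.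
by rewrite ler_wpM2r // [leRHS]splitr lerD.
Qed.

Lemma wd_cont f z a b : wd f z a b -> forall e : R, 0 < e ->
  exists2 d : R, 0 < d & forall k, normc k < d -> normc (f (z + k) - f z) <= e.
Proof.
move=> /wd_lip[M [d [M0 d0 H]]] e e0; exists (Num.min d (e / M)).
  by rewrite lt_min d0 divr_gt0.
move=> k; rewrite lt_min => /andP[/H {}H]; rewrite ltr_pdivlMr // mulrC => /ltW.
exact: le_trans H.
Qed.

Lemma wdV f z a b : f z != 0 -> wd f z a b ->
  wd (fun x => (f x)^-1) z (- a / f z ^+ 2) (- b / f z ^+ 2).
Proof.
move=> fz0 hf e e0; pose c := normc (f z).
have c0 : 0 < c by rewrite normc_gt0.
have [M [d1 [M0 d10 H1]]] := wd_lip hf.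
have [|d2 d20 H2] := wd_cont hf (e := c / 2); first by rewrite divr_gt0.
have [|d3 d30 Hf] := hf (e * c ^+ 2 / 2).
  by rewrite divr_gt0 // mulr_gt0 // exprn_gt0.
have d40 : 0 < e * c ^+ 3 / (4 * M ^+ 2).
  by rewrite divr_gt0 // ?mulr_gt0 // exprn_gt0.
exists (Num.min (Num.min d1 d2) (Num.min d3 (e * c ^+ 3 / (4 * M ^+ 2)))).
  by rewrite !lt_min d10 d20 d30 d40.
move=> k; rewrite !lt_min => /andP[/andP[/H1 {}H1 /H2 {}H2] /andP[/Hf {}Hf kd]].
have k0 : 0 <= normc k := normc_ge0 k.
have fk : c / 2 <= normc (f (z + k)).
  have := normcD (f (z + k)) (f z - f (z + k)).
  rewrite addrC subrK normc_sub -/c => h.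
  have : c <= normc (f (z + k)) + c / 2 by rewrite (le_trans h) // lerD2l.
  by rewrite {1}[c]splitr lerD2r.
have c20 : 0 < c / 2 by rewrite divr_gt0.
have fzk0 : f (z + k) != 0 by rewrite -normc_gt0 (lt_le_trans _ fk).
(* The first summand is the linear remainder of [f], the second is quadratic in its increment. As
   [|f (z + k)|] stays above [c / 2], the last radius is exactly what makes the second one small. *)
rewrite (_ : _ - _ = - (f (z + k) - f z - a * k - b * conjc k) / (f z ^+ 2) +
  (f (z + k) - f z) ^+ 2 / (f z ^+ 2 * f (z + k))); last by field; rewrite fz0 fzk0.
have nX2 (x : C) : normc (x ^+ 2) = normc x ^+ 2 by rewrite normcX.
apply: le_trans (normcD _ _) _.
rewrite (normcM (- _)) normcN normcV nX2 (normcM (_ ^+ 2)) normcV nX2.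
rewrite (normcM (_ ^+ 2)) nX2 -/c.
apply: (@le_trans _ _ (e / 2 * normc k + e / 2 * normc k)); last by rewrite -mulrDl -splitr.
apply: lerD.
  rewrite ler_pdivrMr ?exprn_gt0 // (le_trans Hf) //.
  by rewrite le_eqVlt; apply/orP; left; apply/eqP; field.
rewrite ler_pdivrMr; last by rewrite mulr_gt0 ?exprn_gt0 ?normc_gt0.
apply: (@le_trans _ _ ((M * normc k) ^+ 2)).
  by rewrite lerXn2r ?nnegrE ?normc_ge0 ?mulr_ge0 ?(ltW M0).
apply: (@le_trans _ _ (e / 2 * normc k * (c ^+ 2 * (c / 2)))); last first.
  by rewrite !ler_wpM2l ?mulr_ge0 ?divr_ge0 ?(ltW e0) ?exprn_ge0 ?(ltW c0).
move: kd; rewrite ltr_pdivlMr ?mulr_gt0 ?exprn_gt0 // => /ltW kd.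
rewrite (_ : (M * normc k) ^+ 2 = normc k * (4 * M ^+ 2) * (normc k / 4)); last by field.
apply: (le_trans (ler_wpM2r _ kd)); first by rewrite divr_ge0.
by rewrite le_eqVlt; apply/orP; left; apply/eqP; field.
Qed.

Lemma wdX f z a b n : wd f z a b ->
  wd (fun x => f x ^+ n.+1) z (n.+1%:R * f z ^+ n * a) (n.+1%:R * f z ^+ n * b).
Proof.
move=> hf; elim: n => [|n IH]; first by rewrite expr0 !mul1r.
have := wdM hf IH.
rewrite (_ : a * _ + _ = n.+2%:R * f z ^+ n.+1 * a); last first.
  by rewrite -!natr1 !exprS; ring.
rewrite (_ : b * _ + _ = n.+2%:R * f z ^+ n.+1 * b); last first.
  by rewrite -!natr1 !exprS; ring.
by apply: (wd_local ltr01) => k _ /=; rewrite -exprS.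
Qed.


Lemma derivable_wd f z : derivable f z 1 -> wd f z (derive1 f z) 0.
Proof.
move=> df e e0; have eC0 : 0 < e%:C by rewrite ltcR.
have cf : h^-1 *: (f (h + z) - f z) @[h --> (0 : C)^'] --> derive1 f z.
  rewrite derive1E.
  suff -> : (fun h : C => h^-1 *: (f (h + z) - f z)) =
            (fun h => h^-1 *: ((f \o shift z) (h *: 1) - f z)) by exact: df.
  by apply/funext => h /=; rewrite [h *: 1]mulr1.
move/(@cvgrPdist_le _ _ _ (0 : C)^')/(_ _ eC0) : cf => [[d d'] /= /andP[/eqP /= d'0 d0]].
rewrite {}d'0 {d'} => H; exists d => // k kd.
rewrite mul0r subr0; have [->|k0] := eqVneq k 0.
  by rewrite addr0 subrr mulr0 subr0 normc0 mulr0.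
have := H k; rewrite /= sub0r normrN normE ltcR => /(_ kd k0).
rewrite normE lecR normc_sub -[_ *: _]/(k^-1 * _) => h.
rewrite (_ : _ - _ = (k^-1 * (f (k + z) - f z) - derive1 f z) * k).
  by rewrite normcM ler_wpM2r ?normc_ge0.
by rewrite (addrC z); field.
Qed.

Lemma wd_derivable f z a : wd f z a 0 -> is_derive z 1 f a.
Proof.
move=> H.
suff cf : h^-1 *: ((f \o shift z) (h *: 1) - f z) @[h --> (0 : C)^'] --> a.
  by split; [exact: cvgP cf | exact: cvg_lim cf].
apply/(@cvgrPdist_le _ _ _ (0 : C)^') => -[e e'] /andP[/eqP /= e'0 e0].
rewrite {}e'0 {e'}; have [d d0 Hd] := H _ e0.
exists d%:C => /=; first by rewrite ltcR.
move=> k /=; rewrite sub0r normrN normE ltcR => kd k0.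
rewrite [k *: 1]mulr1 normE lecR normc_sub -[_ *: _]/(k^-1 * _).
have := Hd _ kd; rewrite mul0r subr0 => h.
rewrite -(ler_pM2r (x := normc k)) ?normc_gt0 // -normcM; apply: le_trans h.
by rewrite le_eqVlt; apply/orP; left; apply/eqP; congr normc; rewrite (addrC z); field.
Qed.

Lemma wd_derive1 f z a : wd f z a 0 -> derive1 f z = a.
Proof. by move=> /wd_derivable h; rewrite derive1E derive_val. Qed.

(** Radii in the topology of [R[i]] are themselves elements of [R[i]], whose imaginary part has to
    be cleared each time; this form has real radii. *)
Lemma continuousCP f z : {for z, continuous f} <-> forall e : R, 0 < e ->
  exists2 d : R, 0 < d & forall k, normc k < d -> normc (f (z + k) - f z) <= e.
Proof.
split=> [cf e e0|H].
  have eC0 : 0 < e%:C by rewrite ltcR.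
  move/(@cvgrPdist_le _ _ _ (nbhs z))/(_ _ eC0) : cf => [[d d'] /= /andP[/eqP /= d'0 d0]].
  rewrite {}d'0 {d'} => H; exists d => // k kd.
  have := H (z + k); rewrite /= opprD addNKr normrN normE ltcR => /(_ kd).
  by rewrite normE lecR normc_sub.
apply/(@cvgrPdist_le _ _ _ (nbhs z)) => -[e e'] /andP[/eqP /= e'0 e0].
rewrite {}e'0 {e'}; have [d d0 Hd] := H _ e0.
exists d%:C => /=; first by rewrite ltcR.
move=> w /=; rewrite normE ltcR => zw; rewrite normE lecR normc_sub.
by have := Hd (w - z); rewrite (addrC z) subrK [normc (w - z)]normc_sub; exact.
Qed.

End wirtinger.

(** * Integration over plane sets *)

(** Chosen so that integrals against [area] are convertible with the integral inside
    [area_integral]. *)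
Definition plane (R : realType) : measurableType _ :=
  (measurableTypeR R * measurableTypeR R)%type.

Definition plane_pt (R : realType) (p : plane R) : R[i] := p.1 +i* p.2.

Definition area (R : realType) : {measure set (plane R) -> \bar R} :=
  (@lebesgue_measure R \x @lebesgue_measure R)%E.

Section plane_measurability.
Variable R : realType.
Local Notation C := R[i].
Local Notation pt := (@plane_pt R).
Implicit Types (z w k : C) (D U : set C) (F : C -> R).

Lemma normc_ReIm z : normc z <= `|complex.Re z| + `|complex.Im z|.
Proof.
case: z => x y /=; rewrite -[leRHS]ger0_norm ?addr_ge0 // -sqrtr_sqr ler_wsqrtr //.
by rewrite sqrrD !real_normK ?num_real // lerD2r lerDl mulrn_wge0 // mulr_ge0.
Qed.

Definition nopen U := forall z, U z ->
  exists2 d : R, 0 < d & forall k, normc k < d -> U (z + k).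

(** An open set is the union of the rational boxes that it contains, and these are countably
    many. *)
Lemma nopen_measurable U : nopen U -> measurable (pt @^-1` U).
Proof.
move=> oU.
pose B (q : rat * rat * rat) : set (plane R) :=
  `](ratr q.1.1 - ratr q.2), (ratr q.1.1 + ratr q.2)[ `*`
  `](ratr q.1.2 - ratr q.2), (ratr q.1.2 + ratr q.2)[.
rewrite (_ : _ @^-1` _ = \bigcup_q (if pselect (B q `<=` pt @^-1` U) then B q else set0)).
  apply: countable_bigcupT_measurable => // q; case: pselect => [h|h] //=.
  by apply: measurableX; exact: measurable_itv.
apply/seteqP; split => [[x y] /= Uxy|p [q qT]]; last first.
  by case: (pselect (B q `<=` pt @^-1` U)) => [sB|sB] /= Bq //; exact: sB.
have [d d0 H] := oU _ Uxy.
(* With [r < d / 4] and a centre within [r] of [(x, y)] in each coordinate, all points of the box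
   are within [2 r < d / 2] of [(x, y)] in each coordinate. *)
have [r] : exists r : rat, ratr r \in `](0:R), d / 4[.
  by apply/rat_in_itvoo; rewrite divr_gt0.
rewrite in_itv /= => /andP[r0 rd].
have [a] : exists a : rat, ratr a \in `](x - ratr r), (x + ratr r)[.
  by apply/rat_in_itvoo; rewrite ltrD2l gtrN.
rewrite in_itv /= => /andP[a1 a2].
have [b] : exists a : rat, ratr a \in `](y - ratr r), (y + ratr r)[.
  by apply/rat_in_itvoo; rewrite ltrD2l gtrN.
rewrite in_itv /= => /andP[b1 b2].
exists (a, b, r) => //; case: pselect => [sB|[]] /=.
  by split => /=; rewrite in_itv /=; apply/andP; split; lra.
move=> [u v] [] /=; rewrite !in_itv /= => /andP[u1 u2] /andP[v1 v2].
have := H ((u - x) +i* (v - y)).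
rewrite (_ : plane_pt (x, y) + _ = plane_pt (u, v)); last first.
  by rewrite /plane_pt /=; simpc; congr (_ +i* _); rewrite subrKC.
apply; apply: le_lt_trans (normc_ReIm _) _ => /=.
suff : `|u - x| < d / 2 /\ `|v - y| < d / 2 by move=> []; lra.
by rewrite !ltr_norml; split; apply/andP; split; lra.
Qed.

Definition rcont F z := forall e : R, 0 < e ->
  exists2 d : R, 0 < d & forall k, normc k < d -> `|F (z + k) - F z| <= e.

Lemma nopen_rcont_measurable D F : nopen D -> (forall z, D z -> rcont F z) ->
  measurable_fun (pt @^-1` D) (F \o pt).
Proof.
move=> oD cF; apply: (measurability _ (RGenOInfty.measurableE R)) => _ [_ [a ->] <-].
rewrite (_ : _ `&` _ = pt @^-1` [set z | D z /\ a < F z]); last first.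
  by apply/seteqP; split => p /=; rewrite in_itv /= andbT.
apply: nopen_measurable => z [Dz az].
have [d d0 H] := oD _ Dz; have [|r r0 Hr] := cF _ Dz ((F z - a) / 2).
  by rewrite divr_gt0 // subr_gt0.
exists (Num.min d r); first by rewrite lt_min d0.
move=> k; rewrite lt_min => /andP[kd /Hr]; rewrite ler_norml => /andP[h _].
by split; [exact: H | lra].
Qed.

Lemma nopenT : nopen setT.
Proof. by move=> z _; exists 1. Qed.

Lemma nopen_disk : nopen (@disk R).
Proof.
move=> z /= dz; exists (1 - normc z); first by rewrite subr_gt0.
by move=> k kd; apply: le_lt_trans (normcD _ _) _; lra.
Qed.

Lemma measurable_disk : measurable (pt @^-1` (@disk R)).
Proof. by apply: nopen_measurable; exact: nopen_disk. Qed.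

Lemma rcont_ReP (f : C -> C) z : {for z, continuous f} ->
  rcont (fun w => complex.Re (f w)) z.
Proof.
move=> /continuousCP cf e /cf[d d0 H]; exists d => // k /H; apply: le_trans.
by rewrite -raddfB; exact: normc_Re.
Qed.

Lemma rcont_ImP (f : C -> C) z : {for z, continuous f} ->
  rcont (fun w => complex.Im (f w)) z.
Proof.
move=> /continuousCP cf e /cf[d d0 H]; exists d => // k /H; apply: le_trans.
by rewrite -raddfB; exact: normc_Im.
Qed.

Lemma continuous_rcont F z : {for z, continuous F} -> rcont F z.
Proof.
move=> cf e e0.
move/(@cvgrPdist_le _ _ _ (nbhs z))/(_ _ e0) : cf => [[d d'] /= /andP[/eqP /= d'0 d0]].
rewrite {}d'0 {d'} => H; exists d => // k kd.
have := H (z + k); rewrite /= opprD addNKr normrN normE ltcR => /(_ kd).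
by rewrite distrC.
Qed.

End plane_measurability.

(** * Integrals of complex-valued functions *)

Section complex_integral.
Context d (T : measurableType d) (R : realType) (mu : {measure set T -> \bar R}).
Local Notation C := R[i].
Implicit Types (D : set T) (F G : T -> C) (c : C).

Lemma integrable_cst_lty D (r : R) : measurable D -> (mu D < +oo)%E ->
  mu.-integrable D (fun=> r%:E).
Proof.
move=> mD muD; apply: (@measurable_bounded_integrable _ _ _ mu (fun=> r)) => //.
by exists `|r|; split; rewrite ?num_real // => x rx t Dt; exact: ltW.
Qed.

Definition cintegrable D F := mu.-integrable D (fun t => (complex.Re (F t))%:E) /\
  mu.-integrable D (fun t => (complex.Im (F t))%:E).

Definition cint D F : C :=
  (\int[mu]_(t in D) complex.Re (F t)) +i* (\int[mu]_(t in D) complex.Im (F t)).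

Lemma eq_cint D F G : (forall t, D t -> F t = G t) -> cint D F = cint D G.
Proof.
by move=> FG; congr (_ +i* _); apply: eq_Rintegral => t /set_mem Dt; rewrite FG.
Qed.

Lemma eq_cintegrable D F G : measurable D -> (forall t, D t -> F t = G t) ->
  cintegrable D F -> cintegrable D G.
Proof.
by move=> mD FG [h1 h2]; split; [move: h1|move: h2]; apply: eq_integrable => // t /set_mem Dt;
  rewrite FG.
Qed.

Lemma cintegrableD D F G : measurable D -> cintegrable D F -> cintegrable D G ->
  cintegrable D (fun t => F t + G t).
Proof.
move=> mD [F1 F2] [G1 G2]; split.
  by under eq_fun do rewrite raddfD EFinD; exact: integrableD.
by under eq_fun do rewrite raddfD EFinD; exact: integrableD.
Qed.

Lemma cintD D F G : measurable D -> cintegrable D F -> cintegrable D G ->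
  cint D (fun t => F t + G t) = cint D F + cint D G.
Proof.
move=> mD [F1 F2] [G1 G2]; rewrite /cint; simpc; congr (_ +i* _);
  by under eq_Rintegral do rewrite raddfD; rewrite RintegralD.
Qed.

Lemma ReM c z : complex.Re (c * z) = complex.Re c * complex.Re z - complex.Im c * complex.Im z :> R.
Proof. by case: c => a b; case: z => x y. Qed.

Lemma ImM c z : complex.Im (c * z) = complex.Re c * complex.Im z + complex.Im c * complex.Re z :> R.
Proof. by case: c => a b; case: z => x y. Qed.

Lemma cintegrableZ D c F : measurable D -> cintegrable D F ->
  cintegrable D (fun t => c * F t).
Proof.
move=> mD [F1 F2]; split.
  under eq_fun do rewrite ReM EFinB !EFinM.
  by apply: integrableB => //; exact: integrableZl.
under eq_fun do rewrite ImM EFinD !EFinM.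
by apply: integrableD => //; exact: integrableZl.
Qed.

Lemma cintZ D c F : measurable D -> cintegrable D F ->
  cint D (fun t => c * F t) = c * cint D F.
Proof.
move=> mD [F1 F2].
have iM (a : R) f : mu.-integrable D (EFin \o f) -> mu.-integrable D (EFin \o (fun t => a * f t)).
  by move=> h; exact: (integrableZl mD a h).
rewrite (complexE (cint D _)) [RHS]complexE ReM ImM /=; congr (_%:C + 'i * _%:C).
  under eq_Rintegral do rewrite ReM.
  by rewrite RintegralB ?RintegralZl //; exact: iM.
under eq_Rintegral do rewrite ImM.
by rewrite RintegralD ?RintegralZl //; exact: iM.
Qed.

Lemma cintegrableB D F G : measurable D -> cintegrable D F -> cintegrable D G ->
  cintegrable D (fun t => F t - G t).
Proof.
move=> mD iF iG; apply: cintegrableD => //.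
apply: (@eq_cintegrable _ (fun t => -1 * G t)) => //; first by move=> t _; rewrite mulN1r.
exact: cintegrableZ.
Qed.

Lemma cintB D F G : measurable D -> cintegrable D F -> cintegrable D G ->
  cint D (fun t => F t - G t) = cint D F - cint D G.
Proof.
move=> mD iF iG; rewrite cintD //.
  by under [in X in _ + X]eq_fun do rewrite -mulN1r; rewrite cintZ // mulN1r.
apply: (@eq_cintegrable _ (fun t => -1 * G t)) => //; first by move=> t _; rewrite mulN1r.
exact: cintegrableZ.
Qed.

Lemma cint_setU D E F : measurable D -> measurable E -> cintegrable (D `|` E) F ->
  [disjoint D & E] -> cint (D `|` E) F = cint D F + cint E F.
Proof.
by move=> mD mE [F1 F2] DE; rewrite /cint; simpc; rewrite !Rintegral_setU.
Qed.

Lemma cintegrableS D E F : measurable D -> measurable E -> D `<=` E ->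
  cintegrable E F -> cintegrable D F.
Proof. by move=> mD mE DE [F1 F2]; split; exact: integrableS F1 || exact: integrableS F2. Qed.

Lemma cintegrable_le D F (G : T -> R) : measurable D ->
  measurable_fun D (fun t => complex.Re (F t)) ->
  measurable_fun D (fun t => complex.Im (F t)) ->
  mu.-integrable D (EFin \o G) -> (forall t, D t -> normc (F t) <= G t) ->
  cintegrable D F.
Proof.
move=> mD /measurable_EFinP M1 /measurable_EFinP M2 iG FG.
split; apply: le_integrable iG => // t Dt; rewrite /= lee_fin.
  rewrite (le_trans (normc_Re _)) // (le_trans (FG _ Dt)) //; exact: ler_norm.
rewrite (le_trans (normc_Im _)) // (le_trans (FG _ Dt)) //; exact: ler_norm.
Qed.

(** The factor 2 is the price of bounding the real and the imaginary part separately. *)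
Lemma normc_cint_le D F (G : T -> R) : measurable D -> cintegrable D F ->
  mu.-integrable D (EFin \o G) -> (forall t, D t -> normc (F t) <= G t) ->
  normc (cint D F) <= 2 * \int[mu]_(t in D) G t.
Proof.
move=> mD [F1 F2] iG FG; apply: le_trans (normc_ReIm _) _.
rewrite mulr_natl mulr2n; apply: lerD.
  apply: le_trans (le_normr_Rintegral mD F1) _; apply: le_Rintegral => //.
    exact: integrable_norm.
  by move=> t Dt; exact: le_trans (normc_Re _) (FG _ Dt).
apply: le_trans (le_normr_Rintegral mD F2) _; apply: le_Rintegral => //.
  exact: integrable_norm.
by move=> t Dt; exact: le_trans (normc_Im _) (FG _ Dt).
Qed.

Lemma normc_cint_cst D F (M : R) : measurable D -> (mu D < +oo)%E -> cintegrable D F ->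
  (forall t, D t -> normc (F t) <= M) ->
  normc (cint D F) <= 2 * (M * fine (mu D)).
Proof.
move=> mD muD iF FM; rewrite -Rintegral_cst //; apply: normc_cint_le => //.
exact: integrable_cst_lty.
Qed.

Lemma cint_cst D c : measurable D -> (mu D < +oo)%E ->
  cint D (fun=> c) = c * (fine (mu D))%:C.
Proof.
by move=> mD muD; rewrite /cint !Rintegral_cst //; case: c => a b; simpc.
Qed.

Lemma cintegrable_cst D c : measurable D -> (mu D < +oo)%E -> cintegrable D (fun=> c).
Proof.
by move=> mD muD; split; exact: integrable_cst_lty.
Qed.

Lemma cintegrable_bounded D F (M : R) : measurable D -> (mu D < +oo)%E ->
  measurable_fun D (fun t => complex.Re (F t)) ->
  measurable_fun D (fun t => complex.Im (F t)) ->
  (forall t, D t -> normc (F t) <= M) -> cintegrable D F.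
Proof.
move=> mD muD m1 m2 FM; apply: (cintegrable_le mD m1 m2 (G := fun=> M)) => //.
exact: integrable_cst_lty.
Qed.

End complex_integral.

(** * Goursat's bisection and Green's formula *)

Section bisection.
Variable R : realType.
Local Notation C := R[i].

Definition square_additive (V : zmodType) (P : R -> R -> R -> V) :=
  forall a c s : R, 0 < s -> P a c s = P a c (s / 2) + P (a + s / 2) c (s / 2) +
    P a (c + s / 2) (s / 2) + P (a + s / 2) (c + s / 2) (s / 2).

Lemma lt_expr2 (x : R) : exists n : nat, x < 2 ^+ n.
Proof.
exists (Num.truncn x).+1; apply: lt_le_trans (truncnS_gt x) _.
by rewrite -natrX ler_nat ltnW // ltn_expl.
Qed.

(** Goursat's argument: if [|Phi|] exceeds [e * Lam] on a square, additivity makes it do so on one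
    of the quarters, and the nested squares shrink to a point where the local bound fails. A general
    [Lam] in place of the area leaves room for an exceptional point. *)
Lemma bisection (Phi : R -> R -> R -> C) (Lam : R -> R -> R -> R) :
  square_additive Phi -> square_additive Lam ->
  (forall a c s : R, 0 < s -> 0 <= Lam a c s) ->
  (forall (x y e : R), 0 < e -> exists2 d : R, 0 < d & forall a c s : R, 0 < s -> s < d ->
    a <= x <= a + s -> c <= y <= c + s -> normc (Phi a c s) <= e * Lam a c s) ->
  forall a c s : R, 0 < s -> Phi a c s = 0.
Proof.
move=> addP addL L0 loc a c s s0; apply/eqP/negPn/negP; rewrite -normc_gt0 => P0.
(* Half the ratio of [|Phi|] to [Lam + 1], so that the starting square is bad; the added 1 covers
   [Lam = 0]. *)
pose e := normc (Phi a c s) / (2 * (Lam a c s + 1)).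
have L1 : 0 < Lam a c s + 1 by rewrite ltr_wpDl ?L0.
have e0 : 0 < e by rewrite divr_gt0 // mulr_gt0.
pose bad (q : R * R * R) := 0 < q.2 /\ e * Lam q.1.1 q.1.2 q.2 < normc (Phi q.1.1 q.1.2 q.2).
have bad0 : bad (a, c, s).
  split => //=; rewrite /e mulrAC ltr_pdivrMr ?mulr_gt0 // ltr_pM2l //.
  by have := L0 a c s s0; lra.
(* An implication, vacuous on squares that are not bad, so that the choice function below is
   total. *)
pose sub (q q' : R * R * R) := bad q -> [/\ bad q', q'.2 = q.2 / 2,
  q.1.1 <= q'.1.1 /\ q'.1.1 + q'.2 <= q.1.1 + q.2 &
  q.1.2 <= q'.1.2 /\ q'.1.2 + q'.2 <= q.1.2 + q.2].
have /choice[f Hf] : forall q, exists q', sub q q'.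
  move=> [[x y] t]; have [b|nb] := pselect (bad (x, y, t)); last by exists (x, y, t) => /nb.
  have [/= t0] := b; rewrite (addP _ _ _ t0) (addL _ _ _ t0) => lt.
  have t20 : 0 < t / 2 by rewrite divr_gt0.
  pose g (p q : R) : R * R * R := (p, q, t / 2).
  have [b1|b1] := pselect (bad (g x y)).
    by exists (g x y) => _; split => //=; split => //; lra.
  have [b2|b2] := pselect (bad (g (x + t / 2) y)).
    by exists (g (x + t / 2) y) => _; split => //=; split => //; lra.
  have [b3|b3] := pselect (bad (g x (y + t / 2))).
    by exists (g x (y + t / 2)) => _; split => //=; split => //; lra.
  have [b4|b4] := pselect (bad (g (x + t / 2) (y + t / 2))).
    by exists (g (x + t / 2) (y + t / 2)) => _; split => //=; split => //; lra.
  have nbad u v : ~ bad (g u v) -> normc (Phi u v (t / 2)) <= e * Lam u v (t / 2).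
    by move=> h; rewrite leNgt; apply/negP => h'; apply: h.
  move: lt; rewrite ltNge => /negP[].
  apply: le_trans (normcD _ _) _; rewrite !mulrDr; apply: lerD; last exact: nbad.
  apply: le_trans (normcD _ _) _; apply: lerD; last exact: nbad.
  by apply: le_trans (normcD _ _) _; apply: lerD; exact: nbad.
pose u n := iter n f (a, c, s).
have badu n : bad (u n) by elim: n => [//|n IH]; have [] := Hf _ IH.
have u2 n : (u n).2 = s / 2 ^+ n.
  elim: n => [|n IH]; first by rewrite expr0 divr1.
  by have [_ -> _ _] := Hf _ (badu n); rewrite IH exprSr invfM mulrA.
(* Nested intervals, once for each coordinate: the supremum of the left ends lies in all of them. *)
have mono (k : R * R -> R) : (forall n, k (u n).1 <= k (u n.+1).1 /\
    k (u n.+1).1 + (u n.+1).2 <= k (u n).1 + (u n).2) ->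
    exists x, forall n, k (u n).1 <= x <= k (u n).1 + (u n).2.
  move=> H.
  have nd n m : k (u n).1 <= k (u (n + m)%N).1.
    elim: m => [|m IH]; first by rewrite addn0.
    by rewrite addnS (le_trans IH) //; have [] := H (n + m)%N.
  have ni n m : k (u (n + m)%N).1 + (u (n + m)%N).2 <= k (u n).1 + (u n).2.
    elim: m => [|m IH]; first by rewrite addn0.
    by rewrite addnS (le_trans _ IH) //; have [] := H (n + m)%N.
  have le n m : k (u n).1 <= k (u m).1 + (u m).2.
    apply: le_trans (nd n m) _; rewrite addnC; apply: le_trans (ni m n).
    by rewrite lerDl; apply/ltW; have [] := badu (m + n)%N.
  have ub n : ubound (range (fun n => k (u n).1)) (k (u n).1 + (u n).2).
    by move=> _ [m _ <-]; exact: le.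
  exists (sup (range (fun n => k (u n).1))) => n; apply/andP; split.
    by apply: ub_le_sup; [exists (k (u 0%N).1 + (u 0%N).2) | exists n].
  by apply: ge_sup => //; exists (k (u 0%N).1); exists 0%N.
have [x Hx] : exists x, forall n, (u n).1.1 <= x <= (u n).1.1 + (u n).2.
  by apply: (mono fst) => n; have [_ _ ? _] := Hf _ (badu n).
have [y Hy] : exists x, forall n, (u n).1.2 <= x <= (u n).1.2 + (u n).2.
  by apply: (mono snd) => n; have [_ _ _ ?] := Hf _ (badu n).
have [d d0 Hd] := loc x y e e0.
have [n nd] := lt_expr2 (s / d).
have [un0] := badu n; rewrite ltNge => /negP; apply.
apply: Hd => //; rewrite u2 ltr_pdivrMr ?exprn_gt0 //.
by move: nd; rewrite ltr_pdivrMr // mulrC.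
Qed.

End bisection.

(** * Boxes and segments under bisection *)

Section green.
Variable R : realType.
Local Notation C := R[i].
Local Notation lam := (@lebesgue_measure R).
Implicit Types (h b F : C -> C) (z w : C) (a c s x y : R).

(** Half-open sides, so that the four quarters partition the box. *)
Definition box a c s : set (plane R) := `[a, a + s[ `*` `[c, c + s[.

Lemma measurable_box a c s : measurable (box a c s).
Proof. by apply: measurableX; exact: measurable_itv. Qed.

Lemma area_box a c s : 0 <= s -> area R (box a c s) = (s ^+ 2)%:E.
Proof.
move=> s0; have -> : area R (box a c s) = (lam `[a, (a + s)%R[ * lam `[c, (c + s)%R[)%E.
  by apply: product_measure1E; exact: measurable_itv.
rewrite !lebesgue_measure_itv /= !lte_fin !ltrDl.
case: ltP => s1; last by rewrite (le_anti (introT andP (conj s1 s0))) mul0e expr0n.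
by rewrite -!EFinB -EFinM expr2 ![_ + s - _]addrAC !subrr !add0r.
Qed.

Lemma real_continuous (f : R -> R) x : (forall e : R, 0 < e ->
  exists2 d : R, 0 < d & forall k, `|k| < d -> `|f (x + k) - f x| <= e) ->
  {for x, continuous f}.
Proof.
move=> H; apply/(@cvgrPdist_le _ _ _ (nbhs x)) => e /H[d d0 {}H].
exists d => //= y; rewrite /= distrC => xy.
by have := H (y - x); rewrite subrKC (distrC (f y)); exact.
Qed.

Lemma cint_itv_split (G : R -> C) (a b c : R) : a <= b -> b <= c -> cintegrable lam `[a, c] G ->
  cint lam `[a, c] G = cint lam `[a, b] G + cint lam `[b, c] G.
Proof.
move=> ab bc iG.
have E : (`[a, c] = `[a, b] `|` `]b, c])%classic by rewrite -itv_bndbnd_setU // bnd_simp.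
have bc_sub : `]b, c]%classic `<=` `[a, c]%classic.
  by move=> x /=; rewrite !in_itv /= => /andP[h ->]; rewrite andbT ltW // (le_lt_trans ab).
have dj : [disjoint `[a, b]%classic & `]b, c]%classic].
  apply: lt_disjoint => x y; rewrite !in_itv /= => /andP[_ h1] /andP[h2 _].
  exact: le_lt_trans h2.
have iU : cintegrable lam (`[a, b] `|` `]b, c]) G by rewrite -E.
have bcE : cint lam `]b, c] G = cint lam `[b, c] G.
  have [i1 i2] : cintegrable lam `]b, c] G by apply: cintegrableS iG; first exact: measurable_itv.
  by rewrite /cint; congr (_ +i* _); apply: Rintegral_itv_obnd_cbnd.
rewrite E -bcE; apply: cint_setU iU dj; exact: measurable_itv.
Qed.

Section segments.
Variables (F : C -> C) (cF : continuous F) (l : R -> C).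
Hypothesis l_lip : forall x k, normc (l (x + k) - l x) <= `|k|.

Lemma segment_integrable a s : cintegrable lam `[a, a + s] (F \o l).
Proof.
have cl x (e : R) : 0 < e -> exists2 d : R, 0 < d & forall k, `|k| < d -> normc (F (l (x + k)) - F (l x)) <= e.
  move=> e0; have /continuousCP/(_ _ e0)[d d0 H] := @cF (l x).
  exists d => // k kd; have := H (l (x + k) - l x).
  by rewrite subrKC; apply; exact: le_lt_trans kd.
split; apply: continuous_compact_integrable (@segment_compact _ _ _) _;
  apply: continuous_subspaceT => x; apply: real_continuous => e /(cl x)[d d0 H];
  exists d => // k /H /=; rewrite -raddfB; apply: le_trans.
  exact: normc_Re.
exact: normc_Im.
Qed.

Lemma segment_split a s : 0 < s -> cint lam `[a, a + s] (F \o l) =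
  cint lam `[a, a + s / 2] (F \o l) + cint lam `[a + s / 2, a + s / 2 + s / 2] (F \o l).
Proof.
move=> s0; have iF := segment_integrable a s.
rewrite -[a + s / 2 + s / 2]addrA -splitr.
by apply: cint_itv_split => //; lra.
Qed.

End segments.

Lemma lebesgue_segment a s : 0 <= s -> lam (`[a, a + s]%classic : set R) = s%:E.
Proof.
move=> s0; rewrite lebesgue_measure_itv /= lte_fin ltrDl; case: ltP => s1.
  by rewrite -EFinB addrAC subrr add0r.
by rewrite (le_anti (introT andP (conj s1 s0))).
Qed.

Lemma segment_le (G : R -> C) a s (M : R) : 0 <= s -> cintegrable lam `[a, a + s] G ->
  (forall x, a <= x <= a + s -> normc (G x) <= M) ->
  normc (cint lam `[a, a + s] G) <= 2 * (M * s).
Proof.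
move=> s0 iG GM; have m := lebesgue_segment a s0.
apply: le_trans (normc_cint_cst (M := M) _ _ iG _) _ => //.
- by apply: (le_lt_trans _ (ltry s)); rewrite -m.
- by rewrite (_ : fine _ = s) //; exact: (congr1 fine m).
Qed.

Lemma segment_cst z a s : 0 <= s -> cint lam `[a, a + s] (fun=> z) = z * s%:C.
Proof.
move=> s0; have m := lebesgue_segment a s0.
rewrite cint_cst //; first by rewrite (_ : fine _ = s) //; exact: (congr1 fine m).
by apply: (le_lt_trans _ (ltry s)); rewrite -m.
Qed.

Lemma segment_cst_integrable z a s : 0 <= s -> cintegrable lam `[a, a + s] (fun=> z).
Proof.
move=> s0; apply: cintegrable_cst => //; apply: (le_lt_trans _ (ltry s)).
by rewrite -(lebesgue_segment a s0).
Qed.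

Lemma box_continuous_bounded F a c s : continuous F -> exists2 M : R, 0 < M &
  forall p, box a c s p -> normc (F (plane_pt p)) <= M.
Proof.
move=> cF.
pose K : set C := [set z | normc z <= `|a| + `|c| + 2 * `|s|].
have cn : {within K, continuous (fun z => normc (F z))}.
  apply: continuous_subspaceT => z.
  by apply: (@continuous_comp C C R F (@normc R) z); [exact: cF | exact: normc_continuous].
have /compact_bounded/pinfty_ex_gt0[M M0 HM] := continuous_compact cn (@cball_compact R _).
exists M => // -[x y] [] /=; rewrite !in_itv /= => /andP[x1 x2] /andP[y1 y2].
rewrite -[leLHS]ger0_norm ?normc_ge0 //; apply: HM.
exists (plane_pt (x, y)) => //; apply: le_trans (normc_ReIm _) _ => /=.
have bd (r : R) : - `|r| <= r <= `|r| by rewrite -ler_norml.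
have /andP[a1 a2] := bd a; have /andP[c1 c2] := bd c; have /andP[s1 s2] := bd s.
have : `|x| <= `|a| + `|s| by rewrite ler_norml; apply/andP; split; lra.
have : `|y| <= `|c| + `|s| by rewrite ler_norml; apply/andP; split; lra.
lra.
Qed.

Lemma plane_measurable_Re F : continuous F ->
  measurable_fun setT (fun p : plane R => complex.Re (F (plane_pt p))).
Proof.
move=> cF; apply: (@nopen_rcont_measurable R setT (fun z => complex.Re (F z))).
  exact: nopenT.
by move=> z _; apply: rcont_ReP; exact: cF.
Qed.

Lemma plane_measurable_Im F : continuous F ->
  measurable_fun setT (fun p : plane R => complex.Im (F (plane_pt p))).
Proof.
move=> cF; apply: (@nopen_rcont_measurable R setT (fun z => complex.Im (F z))).
  exact: nopenT.
by move=> z _; apply: rcont_ImP; exact: cF.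
Qed.

Lemma box_integrable F a c s : 0 <= s -> continuous F ->
  cintegrable (area R) (box a c s) (fun p => F (plane_pt p)).
Proof.
move=> s0 cF; have [M _ HM] := @box_continuous_bounded F a c s cF.
apply: cintegrable_bounded HM; first exact: measurable_box.
- by rewrite area_box ?ltry.
- by apply: measurable_funS (plane_measurable_Re cF).
- by apply: measurable_funS (plane_measurable_Im cF).
Qed.

Lemma box_split F a c s : 0 < s -> continuous F ->
  let I a c s := cint (area R) (box a c s) (fun p => F (plane_pt p)) in
  I a c s = I a c (s / 2) + I (a + s / 2) c (s / 2) +
    I a (c + s / 2) (s / 2) + I (a + s / 2) (c + s / 2) (s / 2).
Proof.
move=> s0 cF I; have iF := @box_integrable F a c s (ltW s0) cF.
have mb := measurable_box; pose t := s / 2; have ts : s = t + t by rewrite -splitr.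
have t0 : 0 < t by rewrite divr_gt0.
have split : box a c s = (box a c t `|` box (a + t) c t) `|`
    (box a (c + t) t `|` box (a + t) (c + t) t).
  apply/seteqP; split => -[x y]; rewrite /box /= !in_itv /= ts.
    case: (ltP x (a + t)) => hx; case: (ltP y (c + t)) => hy [/andP[h1 h2] /andP[h3 h4]].
    - by left; left; split; apply/andP; split => //; lra.
    - by right; left; split; apply/andP; split => //; lra.
    - by left; right; split; apply/andP; split => //; lra.
    - by right; right; split; apply/andP; split => //; lra.
  by move=> [[|]|[|]] [/andP[h1 h2] /andP[h3 h4]]; split; apply/andP; split => //; lra.
have sub E : measurable E -> E `<=` box a c s -> cintegrable (area R) E (fun p => F (plane_pt p)).
  by move=> mE Es; apply: cintegrableS Es iF => //; exact: mb.
have b1 : measurable (box a c t `|` box (a + t) c t) by apply: measurableU; exact: mb.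
have b2 : measurable (box a (c + t) t `|` box (a + t) (c + t) t) by apply: measurableU; exact: mb.
rewrite /I -/t split cint_setU //; last 2 first.
- by rewrite -split.
- apply/disj_setPS => -[x y] [] [|] [] /=; rewrite !in_itv /= => _ h [|] [] /=; rewrite !in_itv /=; move: h => /andP[h1 h2] _ /andP[h3 h4]; exfalso; lra.
rewrite cint_setU; [|exact: mb|exact: mb|by apply: sub => //; rewrite split; exact: subsetUl|].
  rewrite cint_setU; [by rewrite addrA|exact: mb|exact: mb|by apply: sub => //; rewrite split; exact: subsetUr|].
  by apply/disj_setPS => -[x y]; rewrite /box /setI /= !in_itv /= => -[[/andP[h1 h2] _] [/andP[h3 h4] _]]; exfalso; lra.
by apply/disj_setPS => -[x y]; rewrite /box /setI /= !in_itv /= => -[[/andP[h1 h2] _] [/andP[h3 h4] _]]; exfalso; lra.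
Qed.

End green.

Section goursat_green.
Variable R : realType.
Local Notation C := R[i].
Local Notation lam := (@lebesgue_measure R).
Implicit Types (h b F : C -> C) (z w : C) (a c s x y : R).

Definition horiz c : R -> C := fun x => x +i* c.
Definition vert a : R -> C := fun y => a +i* y.

Lemma horiz_lip c x k : normc (horiz c (x + k) - horiz c x) <= `|k|.
Proof.
apply: le_trans (normc_ReIm _) _; rewrite /horiz /=.
by rewrite addrAC subrr [0 + k]add0r subrr normr0 addr0.
Qed.

Lemma vert_lip a y k : normc (vert a (y + k) - vert a y) <= `|k|.
Proof.
apply: le_trans (normc_ReIm _) _; rewrite /vert /=.
by rewrite subrr normr0 add0r addrAC subrr add0r.
Qed.

(** The integral of [h dz] along the boundary of the square, counterclockwise. *)
Definition contour h a c s : C :=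
  cint lam `[a, a + s] (h \o horiz c) - cint lam `[a, a + s] (h \o horiz (c + s)) +
  'i * (cint lam `[c, c + s] (h \o vert (a + s)) - cint lam `[c, c + s] (h \o vert a)).

(** Green's formula, with [b] the derivative of [h] in [conjc z], is the vanishing of this
    quantity. *)
Definition defect h b a c s : C :=
  contour h a c s - 2 * 'i * cint (area R) (box a c s) (fun p => b (plane_pt p)).

Lemma defect_additive h b : continuous h -> continuous b -> square_additive (defect h b).
Proof.
move=> ch cb a c s s0; rewrite /defect /contour (box_split a c s0 cb).
rewrite !(segment_split ch (horiz_lip _) _ s0) !(segment_split ch (vert_lip _) _ s0).
have e x : x + s / 2 + s / 2 = x + s by lra.
by rewrite !e; ring.
Qed.

Lemma hsegment_diff h a c s : continuous h ->
  cint lam `[a, a + s] (h \o horiz c) - cint lam `[a, a + s] (h \o horiz (c + s)) =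
  cint lam `[a, a + s] (fun x => h (horiz c x) - h (horiz (c + s) x)).
Proof.
by move=> ch; rewrite cintB //; apply: (@segment_integrable R h ch); exact: horiz_lip.
Qed.

Lemma vsegment_diff h a c s : continuous h ->
  cint lam `[c, c + s] (h \o vert (a + s)) - cint lam `[c, c + s] (h \o vert a) =
  cint lam `[c, c + s] (fun y => h (vert (a + s) y) - h (vert a y)).
Proof.
by move=> ch; rewrite cintB //; apply: (@segment_integrable R h ch); exact: vert_lip.
Qed.

Lemma hdiff_integrable h a c s : continuous h ->
  cintegrable lam `[a, a + s] (fun x => h (horiz c x) - h (horiz (c + s) x)).
Proof.
by move=> ch; apply: cintegrableB => //; apply: (@segment_integrable R h ch); exact: horiz_lip.
Qed.

Lemma vdiff_integrable h a c s : continuous h ->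
  cintegrable lam `[c, c + s] (fun y => h (vert (a + s) y) - h (vert a y)).
Proof.
by move=> ch; apply: cintegrableB => //; apply: (@segment_integrable R h ch); exact: vert_lip.
Qed.

Lemma square_dist a c s u v x y : a <= u <= a + s -> c <= v <= c + s ->
  a <= x <= a + s -> c <= y <= c + s -> normc (x +i* y - (u +i* v)) <= 2 * s.
Proof.
move=> /andP[? ?] /andP[? ?] /andP[? ?] /andP[? ?].
apply: le_trans (normc_ReIm _) _ => /=.
have : `|x - u| <= s by rewrite ler_norml; apply/andP; split; lra.
have : `|y - v| <= s by rewrite ler_norml; apply/andP; split; lra.
lra.
Qed.

Lemma box_mean_le b a c s z (e : R) : 0 < s -> continuous b ->
  (forall x y, a <= x <= a + s -> c <= y <= c + s -> normc (b (x +i* y) - z) <= e) ->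
  normc (cint (area R) (box a c s) (fun p => b (plane_pt p)) - z * (s ^+ 2)%:C) <= 2 * (e * s ^+ 2).
Proof.
move=> s0 cb be; have mb := @measurable_box R a c s; have ab := area_box a c (ltW s0).
have alty : (area R (box a c s) < +oo)%E by rewrite ab ltry.
have ib := box_integrable a c (ltW s0) cb; have iz := cintegrable_cst z mb alty.
have -> : z * (s ^+ 2)%:C = cint (area R) (box a c s) (fun=> z) by rewrite cint_cst // ab.
rewrite -cintB //.
have := @normc_cint_cst _ _ _ (area R) (box a c s) _ e mb alty (cintegrableB mb ib iz).
rewrite ab /=; apply => -[x y] [] /=; rewrite !in_itv /= => /andP[x1 x2] /andP[y1 y2].
by apply: be; apply/andP; split => //; exact: ltW.
Qed.

(** The affine part of the expansion at [z] contributes exactly [2 * 'i * b z * s ^ 2] to the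
    contour integral; what is left is the remainder on the sides and the oscillation of [b]. The
    fraction [e / 20] makes the three errors [2 e / 5], [2 e / 5] and [e / 5] times [s ^ 2]. *)
Lemma defect_small h b (z A : C) : continuous h -> continuous b -> wd h z A (b z) ->
  forall e : R, 0 < e -> exists2 d : R, 0 < d & forall a c s, 0 < s -> s < d ->
    a <= complex.Re z <= a + s -> c <= complex.Im z <= c + s ->
    normc (defect h b a c s) <= e * s ^+ 2.
Proof.
move=> ch cb hz e e0; have e20 : 0 < e / 20 by rewrite divr_gt0.
have [d1 d10 H1] := hz _ e20.
have /continuousCP/(_ _ e20)[d2 d20 H2] := @cb z.
exists (Num.min d1 d2 / 3) => [|a c s s0 sd az cz].
  by rewrite divr_gt0 // lt_min d10.
have /andP[sd1 sd2] : (2 * s < d1) && (2 * s < d2).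
  by rewrite -lt_min; move: sd; rewrite ltr_pdivlMr //; lra.
pose E k := h (z + k) - h z - A * k - b z * conjc k.
have hE x y : h (x +i* y) = h z + A * (x +i* y - z) + b z * conjc (x +i* y - z) + E (x +i* y - z).
  by rewrite /E subrKC; ring.
have zE : z = complex.Re z +i* complex.Im z by case: (z).
have dist x y : a <= x <= a + s -> c <= y <= c + s -> normc (x +i* y - z) <= 2 * s.
  by move=> hx hy; rewrite {1}zE; exact: (square_dist az cz).
have Ele x y : a <= x <= a + s -> c <= y <= c + s -> normc (E (x +i* y - z)) <= e / 10 * s.
  move=> hx hy; have D := dist _ _ hx hy; apply: le_trans (H1 _ (le_lt_trans D sd1)) _.
  by apply: (le_trans (ler_wpM2l (ltW e20) D)); lra.
have ca : c <= c <= c + s by apply/andP; split; lra.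
have cs : c <= c + s <= c + s by apply/andP; split; lra.
have aa : a <= a <= a + s by apply/andP; split; lra.
have aas : a <= a + s <= a + s by apply/andP; split; lra.
(* Passing from the upper to the lower side is a shift by [- 'i * s], which changes the affine part
   by [(A * - 'i + b z * 'i) * s]. *)
have B1 : normc (cint lam `[a, a + s] (fun x => h (horiz c x) - h (horiz (c + s) x)) -
    (A * - 'i + b z * 'i) * s%:C * s%:C) <= 2 * (e / 5 * s * s).
  rewrite -(segment_cst _ a (ltW s0)) -cintB //; [|exact: hdiff_integrable|exact: segment_cst_integrable (ltW s0)].
  apply: segment_le (ltW s0) _ _.
    by apply: cintegrableB => //; [exact: hdiff_integrable|exact: segment_cst_integrable (ltW s0)].
  move=> x hx; rewrite (_ : _ - _ = E (x +i* c - z) - E (x +i* (c + s) - z)).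
    apply: le_trans (normcD _ _) _; rewrite normcN.
    by have := Ele _ _ hx ca; have := Ele _ _ hx cs; lra.
  rewrite /horiz !hE (_ : x +i* (c + s) - z = x +i* c - z + 'i * s%:C); last first.
    by rewrite addrAC; congr (_ - z); simpc.
  rewrite !rmorphD rmorphM /= (_ : (0 -i* 1) = - 'i :> C); last by simpc.
  by rewrite oppr0 -/(real_complex R s); ring.
have B2 : normc (cint lam `[c, c + s] (fun y => h (vert (a + s) y) - h (vert a y)) -
    (A + b z) * s%:C * s%:C) <= 2 * (e / 5 * s * s).
  rewrite -(segment_cst _ c (ltW s0)) -cintB //; [|exact: vdiff_integrable|exact: segment_cst_integrable (ltW s0)].
  apply: segment_le (ltW s0) _ _.
    by apply: cintegrableB => //; [exact: vdiff_integrable|exact: segment_cst_integrable (ltW s0)].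
  move=> y hy; rewrite (_ : _ - _ = E ((a + s) +i* y - z) - E (a +i* y - z)).
    apply: le_trans (normcD _ _) _; rewrite normcN.
    by have := Ele _ _ aa hy; have := Ele _ _ aas hy; lra.
  rewrite /vert !hE (_ : (a + s) +i* y - z = a +i* y - z + s%:C); last first.
    by rewrite addrAC; congr (_ - z); simpc.
  rewrite rmorphD /= oppr0 -/(real_complex R s); ring.
have B3 : normc (cint (area R) (box a c s) (fun p => b (plane_pt p)) - b z * (s ^+ 2)%:C) <=
    2 * (e / 20 * s ^+ 2).
  apply: box_mean_le => // x y hx hy; have := H2 (x +i* y - z); rewrite subrKC; apply.
  exact: le_lt_trans (dist _ _ hx hy) sd2.
rewrite /defect /contour hsegment_diff // vsegment_diff //.
set I1 := cint _ _ _ in B1 *; set I2 := cint _ _ _ in B2 *; set I3 := cint _ _ _ in B3 *.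
have ii : 'i * 'i = -1 :> C by rewrite -expr2 sqr_i.
rewrite (_ : _ - _ = (I1 - (A * - 'i + b z * 'i) * s%:C * s%:C) +
   'i * (I2 - (A + b z) * s%:C * s%:C) - 2 * 'i * (I3 - b z * (s ^+ 2)%:C)); last first.
  by rewrite rmorphXn /=; ring.
have ni : normc ('i : C) = 1 by rewrite /= expr0n expr1n add0r sqrtr1.
apply: le_trans (normcD _ _) _; apply: le_trans (lerD (normcD _ _) (lexx _)) _.
rewrite normcN (normcM 'i) (normcM (2 * 'i)) (normcM 2) ni normc_nat mul1r mulr1.
by lra.
Qed.

(** Where no expansion is available, continuity alone makes the difference of opposite sides a small
    multiple of [s]; the area term is of order [s ^ 2]. *)
Lemma defect_small_exceptional h b (w : C) : continuous h -> continuous b ->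
  forall e : R, 0 < e -> exists2 d : R, 0 < d & forall a c s, 0 < s -> s < d ->
    a <= complex.Re w <= a + s -> c <= complex.Im w <= c + s ->
    normc (defect h b a c s) <= e * s.
Proof.
move=> ch cb e e0; have e16 : 0 < e / 16 by rewrite divr_gt0.
have /continuousCP/(_ _ e16)[d1 d10 H1] := @ch w.
have /continuousCP/(_ 1 ltr01)[d2 d20 H2] := @cb w.
pose M := normc (b w) + 1; have M0 : 0 < M by rewrite ltr_wpDl ?normc_ge0.
exists (Num.min (Num.min d1 d2 / 3) (e / (8 * M))) => [|a c s s0].
  by rewrite lt_min !divr_gt0 ?mulr_gt0 // lt_min d10.
rewrite lt_min => /andP[sd sM] az cz.
have /andP[sd1 sd2] : (2 * s < d1) && (2 * s < d2).
  by rewrite -lt_min; move: sd; rewrite ltr_pdivlMr //; lra.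
have zE : w = complex.Re w +i* complex.Im w by case: (w).
have dist x y : a <= x <= a + s -> c <= y <= c + s -> normc (x +i* y - w) <= 2 * s.
  by move=> hx hy; rewrite {1}zE; exact: (square_dist az cz).
have hE x y : a <= x <= a + s -> c <= y <= c + s -> normc (h (x +i* y) - h w) <= e / 16.
  by move=> hx hy; have := H1 (x +i* y - w); rewrite subrKC; apply; exact: le_lt_trans (dist _ _ hx hy) sd1.
have dE u v : normc (u - h w) <= e / 16 -> normc (v - h w) <= e / 16 -> normc (u - v) <= e / 8.
  move=> h1 h2; rewrite (_ : u - v = (u - h w) - (v - h w)); last by ring.
  by apply: le_trans (normcD _ _) _; rewrite normcN; lra.
have ca : c <= c <= c + s by apply/andP; split; lra.
have cs : c <= c + s <= c + s by apply/andP; split; lra.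
have aa : a <= a <= a + s by apply/andP; split; lra.
have aas : a <= a + s <= a + s by apply/andP; split; lra.
have B1 := @segment_le R _ a s (e / 8) (ltW s0) (@hdiff_integrable h a c s ch).
have B2 := @segment_le R _ c s (e / 8) (ltW s0) (@vdiff_integrable h a c s ch).
have B3 : normc (cint (area R) (box a c s) (fun p => b (plane_pt p)) - 0 * (s ^+ 2)%:C) <=
    2 * (M * s ^+ 2).
  apply: box_mean_le => // x y hx hy; rewrite subr0.
  rewrite (_ : b _ = b w + (b (w + (x +i* y - w)) - b w)); last by rewrite subrKC addrC subrK.
  apply: le_trans (normcD _ _) _; rewrite lerD2l; apply: H2.
  exact: le_lt_trans (dist _ _ hx hy) sd2.
rewrite /defect /contour hsegment_diff // vsegment_diff //.
apply: le_trans (normcD _ _) _; apply: le_trans (lerD (normcD _ _) (lexx _)) _.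
have ni : normc ('i : C) = 1 by rewrite /= expr0n expr1n add0r sqrtr1.
rewrite normcN (normcM 'i) (normcM (2 * 'i)) (normcM 2) ni normc_nat mul1r mulr1.
rewrite mul0r subr0 in B3.
have {}B1 := B1 (fun x hx => dE _ _ (hE _ _ hx ca) (hE _ _ hx cs)).
have {}B2 := B2 (fun y hy => dE _ _ (hE _ _ aas hy) (hE _ _ aa hy)).
have : M * s ^+ 2 <= e / 8 * s.
  rewrite expr2 mulrA ler_wpM2r ?(ltW s0) // mulrC.
  by move: sM; rewrite ltr_pdivlMr ?mulr_gt0 //; lra.
by lra.
Qed.

(** The odd square root centred at [x0]. Its increments are additive and nonnegative, and over an
    interval of length [s] containing [x0] they are at least [sqrt s], because
    [sqrt u + sqrt v >= sqrt (u + v)]. *)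
Definition ssqrt (x0 x : R) := Num.sqrt (x - x0) - Num.sqrt (x0 - x).

Lemma ssqrt_mono x0 x y : x <= y -> ssqrt x0 x <= ssqrt x0 y.
Proof. by move=> xy; apply: lerB; apply: ler_wsqrtr; lra. Qed.

Lemma ssqrt_ge x0 a s : 0 < s -> a <= x0 <= a + s ->
  Num.sqrt s <= ssqrt x0 (a + s) - ssqrt x0 a.
Proof.
move=> s0 /andP[h1 h2].
rewrite /ssqrt (_ : Num.sqrt (x0 - (a + s)) = 0); last by apply: ler0_sqrtr; lra.
rewrite (_ : Num.sqrt (a - x0) = 0); last by apply: ler0_sqrtr; lra.
rewrite subr0 sub0r opprK.
set u := a + s - x0.
rewrite -[leRHS]ger0_norm ?addr_ge0 ?sqrtr_ge0 // -sqrtr_sqr ler_wsqrtr //.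
rewrite sqrrD !sqr_sqrtr; [|rewrite /u; lra..].
have : 0 <= Num.sqrt u * Num.sqrt (x0 - a) by rewrite mulr_ge0 ?sqrtr_ge0.
rewrite /u; lra.
Qed.

(** The exceptional point is there for the difference quotient of a holomorphic function at [w]: it
    extends continuously to [w], but no expansion of it is known there. *)
Theorem goursat_green h b w : continuous h -> continuous b ->
  (forall z, z != w -> exists A, wd h z A (b z)) ->
  forall a c s, 0 < s ->
    contour h a c s = 2 * 'i * cint (area R) (box a c s) (fun p => b (plane_pt p)).
Proof.
move=> ch cb hz a c s s0; apply/eqP; rewrite -subr_eq0; apply/eqP.
(* The second summand is additive as well, and at least [s] on the squares
   around the exceptional point [w]. *)
pose Lam a c s := s ^+ 2 + (ssqrt (complex.Re w) (a + s) - ssqrt (complex.Re w) a) *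
  (ssqrt (complex.Im w) (c + s) - ssqrt (complex.Im w) c).
have L0 a' c' s' : 0 < s' -> 0 <= (ssqrt (complex.Re w) (a' + s') - ssqrt (complex.Re w) a') *
  (ssqrt (complex.Im w) (c' + s') - ssqrt (complex.Im w) c').
  by move=> s'0; rewrite mulr_ge0 // subr_ge0 ssqrt_mono //; lra.
apply: (@bisection R (defect h b) Lam (defect_additive ch cb)) => //.
- move=> a' c' s' _; have e x : x + s' / 2 + s' / 2 = x + s' by lra.
  by rewrite /Lam !e; field.
- by move=> a' c' s' s'0; rewrite addr_ge0 ?sqr_ge0 ?L0.
move=> x y e e0; have [xyw|xyw] := eqVneq (x +i* y) w.
  have [d d0 H] := defect_small_exceptional w ch cb e0.
  exists d => // a' c' s' s'0 s'd hx hy; move: L0; rewrite /Lam -{1 2 3 4}xyw /= => L0.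
  move: H; rewrite -{1 2 3 4}xyw /= => H.
  apply: (le_trans (H _ _ _ s'0 s'd hx hy)); rewrite ler_pM2l // -xyw /=.
  apply: ler_wpDl; first exact: sqr_ge0.
  rewrite -[leLHS](sqr_sqrtr (ltW s'0)) expr2.
  by apply: ler_pM; rewrite ?sqrtr_ge0 // ssqrt_ge.
have [A hA] := hz _ xyw; have [d d0 H] := defect_small ch cb hA e0.
exists d => // a' c' s' s'0 s'd hx hy; apply: (le_trans (H _ _ _ s'0 s'd hx hy)).
by rewrite ler_pM2l // lerDl L0.
Qed.

End goursat_green.

(** * The reproducing formula *)

Section area_identity.
Variable R : realType.
Local Notation C := R[i].
Implicit Types (f g : C -> C) (z w k : C).

Definition tw z : R := 1 - normc z ^+ 2.

(** For [n = p + 2] this is, up to a constant, the Bergman kernel of the weight [tw ^ p],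
    holomorphic in [w] and antiholomorphic in [z]. *)
Definition ker n z w : C := (1 - conjc z * w)^-1 ^+ n.

Definition diskp : set (plane R) := @plane_pt R @^-1` @disk R.

Lemma mulcJ z : z * conjc z = (normc z ^+ 2)%:C.
Proof. by have := sqr_normc z; rewrite normE -rmorphXn. Qed.

Lemma tw_ge z : normc z < 1 -> 1 - normc z <= tw z.
Proof. by move=> z1; rewrite /tw lerB // expr2 ler_piMl ?normc_ge0 // ltW. Qed.

Lemma tw_gt0 z : normc z < 1 -> 0 < tw z.
Proof. by move=> z1; rewrite (lt_le_trans _ (tw_ge z1)) // subr_gt0. Qed.

Lemma tw_le z : normc z <= 1 -> tw z <= 2 * (1 - normc z).
Proof.
move=> z1; rewrite (_ : tw z = (1 + normc z) * (1 - normc z)); last by rewrite /tw; ring.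
by rewrite ler_wpM2r ?subr_ge0 // -[leRHS]/(1 + 1) lerD2l.
Qed.

Lemma tw_le1 z : tw z <= 1.
Proof. by rewrite /tw gerBl sqr_ge0. Qed.

Lemma ker_denom_ge z w : 1 - normc z * normc w <= normc (1 - conjc z * w).
Proof.
have := normcD (1 - conjc z * w) (conjc z * w); rewrite subrK normc1.
by rewrite (normcM (conjc z)) normc_conj; lra.
Qed.

Lemma ker_denom_ge1 z w : normc z <= 1 -> 1 - normc w <= normc (1 - conjc z * w).
Proof.
move=> z1; apply: le_trans (ker_denom_ge z w); rewrite lerB //.
by rewrite ler_piMl ?normc_ge0.
Qed.

Lemma ker_denom_gt0 z w : normc z <= 1 -> normc w < 1 -> 0 < normc (1 - conjc z * w).
Proof. by move=> z1 w1; apply: lt_le_trans (ker_denom_ge1 w z1); rewrite subr_gt0. Qed.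

Lemma ker_denom_neq0 z w : normc z <= 1 -> normc w < 1 -> 1 - conjc z * w != 0.
Proof. by move=> z1 w1; rewrite -normc_gt0 ker_denom_gt0. Qed.

Lemma normc_ker n z w : normc (ker n z w) = (normc (1 - conjc z * w))^-1 ^+ n.
Proof. by rewrite normcX normcV. Qed.

Lemma normc_ker_le n z w : normc z <= 1 -> normc w < 1 ->
  normc (ker n z w) <= (1 - normc w)^-1 ^+ n.
Proof.
move=> z1 w1; rewrite normc_ker lerXn2r ?nnegrE ?invr_ge0 ?normc_ge0 ?subr_ge0 ?(ltW w1) //.
by rewrite lef_pV2 ?posrE ?ker_denom_gt0 ?subr_gt0 // ker_denom_ge1.
Qed.

Lemma wd_eq f g z a b a' b' : wd f z a b -> (forall z, f z = g z) -> a = a' -> b = b' ->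
  wd g z a' b'.
Proof. by move=> h fg <- <-; apply: (wd_local ltr01) h => k _. Qed.

Lemma wd_continuous f z a b : wd f z a b -> {for z, continuous f}.
Proof. by move=> h; apply/continuousCP => e e0; exact: (wd_cont h e0). Qed.

Lemma wd_ker_denom_inv z w : normc z <= 1 -> normc w < 1 ->
  wd (fun z => (1 - conjc z * w)^-1) z 0 (w / (1 - conjc z * w) ^+ 2).
Proof.
move=> z1 w1; have h : wd (fun z => 1 - conjc z * w) z 0 (- w).
  by apply: (wd_eq (wdD (wd_cst 1 z) (wdM (wdM (wd_cst (-1) z) (wd_conj z)) (wd_cst w z)))) => [?||]; ring.
by apply: (wd_eq (wdV (f := fun z => 1 - conjc z * w) (ker_denom_neq0 z1 w1) h)) => [?||]; rewrite ?oppr0 ?mul0r ?opprK.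
Qed.

Lemma wd_ker n z w : normc z <= 1 -> normc w < 1 ->
  wd (fun z => ker n z w) z 0 (n%:R * w * ker n.+1 z w).
Proof.
move=> z1 w1; case: n => [|n].
  by rewrite !mul0r; apply: (wd_local ltr01 _ (wd_cst 1 z)) => k _; rewrite /ker expr0.
have := wdX n (wd_ker_denom_inv z1 w1); rewrite mulr0.
rewrite (_ : n.+1%:R * _ * _ = n.+1%:R * w * ker n.+2 z w) //.
by rewrite /ker !exprS; field; exact: ker_denom_neq0.
Qed.

Lemma wd_tw z : wd (fun z => (tw z)%:C) z (- conjc z) (- z).
Proof.
apply: (wd_eq (wdD (wd_cst 1 z) (wdM (wd_cst (-1) z) (wdM (wd_id z) (wd_conj z))))) => [x||].
- by rewrite mulcJ /tw rmorphB mulN1r.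
- by ring.
- by ring.
Qed.

Lemma wd_twX n z : wd (fun z => (tw z)%:C ^+ n.+1) z
  (- (n.+1%:R * (tw z)%:C ^+ n * conjc z)) (- (n.+1%:R * (tw z)%:C ^+ n * z)).
Proof. by have := wdX n (wd_tw z); rewrite !mulrN. Qed.

(** A bound by [tw] forces the value 0 on the circle, so the extension by 0 is continuous on the
    plane and Green's formula can be used on a square around the disk. *)
Lemma continuous_if_disk (F : C -> C) :
  (forall z, normc z < 1 -> {for z, continuous F}) ->
  (exists2 M : R, 0 < M & forall z, normc z < 1 -> normc (F z) <= M * tw z) ->
  continuous (fun z => if normc z < 1 then F z else 0).
Proof.
move=> cF [M M0 FM] z; apply/continuousCP => e e0; case: ltP => z1.
  have /continuousCP/(_ _ e0)[d d0 H] := cF _ z1.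
  exists (Num.min d (1 - normc z)) => [|k]; first by rewrite lt_min d0 subr_gt0.
  rewrite lt_min => /andP[kd kz]; rewrite ifT; first exact: H.
  by apply: le_lt_trans (normcD _ _) _; lra.
exists (e / (2 * M)) => [|k]; first by rewrite divr_gt0 // mulr_gt0.
rewrite ltr_pdivlMr ?mulr_gt0 // => ke; rewrite subr0; case: ltP => zk; last by rewrite normc0 ltW.
apply: (le_trans (FM _ zk)); have := tw_le (ltW zk).
have : 1 - normc (z + k) <= normc k.
  by have := normcD (z + k) (- k); rewrite addrK normcN; lra.
by move=> h1 h2; have : M * tw (z + k) <= M * (2 * normc k); [rewrite ler_pM2l //; lra | lra].
Qed.

Lemma diskp_box p : diskp p -> box (-1) (-1) 2 p.
Proof.
case: p => x y h1; rewrite /box /= !in_itv /=.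
have : `|x| < 1 by exact: le_lt_trans (normc_Re (plane_pt (x, y))) h1.
have : `|y| < 1 by exact: le_lt_trans (normc_Im (plane_pt (x, y))) h1.
by rewrite !ltr_norml => /andP[? ?] /andP[? ?]; split; apply/andP; split; lra.
Qed.

Lemma cint_box_disk (G : C -> C) :
  cint (area R) (box (-1) (-1) 2) (fun p => if normc (plane_pt p) < 1 then G (plane_pt p) else 0) =
  cint (area R) diskp (fun p => G (plane_pt p)).
Proof.
rewrite /cint; congr (_ +i* _); rewrite Rintegral_mkcond [RHS]Rintegral_mkcond;
  apply: eq_Rintegral => p _; rewrite /patch; case: (ltP (normc (plane_pt p)) 1) => h1.
- by rewrite !mem_set //; exact: diskp_box.
- by rewrite if_same [p \in diskp]memNset // => h2; move: h1; rewrite leNgt h2.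
- by rewrite !mem_set //; exact: diskp_box.
- by rewrite if_same [p \in diskp]memNset // => h2; move: h1; rewrite leNgt h2.
Qed.

Lemma area_disk_lty : (area R diskp < +oo)%E.
Proof.
apply: (@le_lt_trans _ _ (area R (box (-1) (-1) 2))); last by rewrite area_box ?ltry.
by apply: le_measure; rewrite ?inE; [exact: measurable_disk|exact: measurable_box|exact: diskp_box].
Qed.

Lemma disk_measurable_Re (F : C -> C) : (forall z, normc z < 1 -> {for z, continuous F}) ->
  measurable_fun diskp (fun p => complex.Re (F (plane_pt p))).
Proof.
move=> cF; apply: (@nopen_rcont_measurable R (@disk R) (fun z => complex.Re (F z))).
  exact: nopen_disk.
by move=> z z1; apply: rcont_ReP; exact: cF.
Qed.

Lemma disk_measurable_Im (F : C -> C) : (forall z, normc z < 1 -> {for z, continuous F}) ->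
  measurable_fun diskp (fun p => complex.Im (F (plane_pt p))).
Proof.
move=> cF; apply: (@nopen_rcont_measurable R (@disk R) (fun z => complex.Im (F z))).
  exact: nopen_disk.
by move=> z z1; apply: rcont_ImP; exact: cF.
Qed.

Lemma disk_integrable (F : C -> C) (M : R) :
  (forall z, normc z < 1 -> {for z, continuous F}) ->
  (forall z, normc z < 1 -> normc (F z) <= M) ->
  cintegrable (area R) diskp (fun p => F (plane_pt p)).
Proof.
move=> cF FM; apply: (@cintegrable_bounded _ _ _ _ _ _ M).
- exact: measurable_disk.
- exact: area_disk_lty.
- exact: disk_measurable_Re.
- exact: disk_measurable_Im.
- by move=> p; exact: FM.
Qed.

Section identity.
Variables (f : C -> C) (N : nat) (w : C).
Hypothesis w1 : normc w < 1.
Hypothesis df : forall z, normc z <= 1 -> exists A, wd f z A 0.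

Let Aw := xget 0 [set A | wd f w A 0].

Let wdfw : wd f w Aw 0.
Proof. by apply: (@xgetPex _ 0 [set A | wd f w A 0]); apply: df; exact: ltW. Qed.

(** Minus the difference quotient of [f] at [w], completed by its limit. *)
Let F z := if z == w then - Aw else (f z - f w) / (w - z).

Let wd_F z : normc z <= 1 -> z != w -> exists A, wd F z A 0.
Proof.
move=> z1 zw; have [A hA] := df z1.
have wz0 : w - z != 0 by rewrite subr_eq0 eq_sym.
have h1 : wd (fun z => w - z) z (-1) 0.
  by apply: (wd_eq (wdD (wd_cst w z) (wdM (wd_cst (-1) z) (wd_id z)))) => [?||]; ring.
have hB := wdM (wdD hA (wd_cst (- f w) z)) (wdV (f := fun z => w - z) wz0 h1).
eexists; apply: (wd_local (d := normc (w - z))); last first.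
- by apply: (wd_eq hB) => [x||]; [by []|by []|ring].
- move=> k kd; rewrite /F ifF //; apply/eqP => zkw; move: kd.
  by rewrite -zkw addrAC subrr add0r ltxx.
- by rewrite normc_gt0.
Qed.

Let continuous_F z : normc z <= 1 -> {for z, continuous F}.
Proof.
move=> z1; have [->|zw] := eqVneq z w; last first.
  by have [A hA] := wd_F z1 zw; exact: wd_continuous hA.
apply/continuousCP => e e0; have [d d0 H] := wdfw e0; exists d => // k kd.
rewrite /F eqxx opprK; have [k0|k0] := eqVneq k 0.
  by rewrite k0 addr0 eqxx addNr normc0; apply: ltW; exact: e0.
rewrite ifF; last by apply/eqP => h; case/eqP: k0; apply: (addrI w); rewrite h addr0.
have := H _ kd; rewrite mul0r subr0 => h.
rewrite -(ler_pM2r (x := normc k)) ?normc_gt0 // -normcM; apply: le_trans h.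
rewrite le_eqVlt; apply/orP; left; apply/eqP; rewrite -normcN; congr normc.
by rewrite opprD addNKr; field.
Qed.

Let F_bounded : exists2 M : R, 0 < M & forall z, normc z <= 1 -> normc (F z) <= M.
Proof.
have cn : {within [set z : C | normc z <= 1], continuous (fun z => normc (F z))}.
  apply: continuous_in_subspaceT => z /set_mem /= z1.
  by apply: (@continuous_comp C C R F (@normc R) z); [exact: continuous_F | exact: normc_continuous].
have /compact_bounded/pinfty_ex_gt0[M M0 HM] := continuous_compact cn (@cball_compact R 1).
exists M => // z z1; rewrite -[leLHS]ger0_norm ?normc_ge0 //; apply: HM.
by exists z.
Qed.

(** The power of [tw] is one more than the one left in [b], the [conjc z]-derivative of [h]. Being
    at least 2, it makes [h] vanish to second order at the circle. *)
Let h z := if normc z < 1 then F z * ((tw z)%:C ^+ N.+2 * ker N.+2 z w) else 0.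

Let b z := if normc z < 1 then
  N.+2%:R * ((f z - f w) * ((tw z)%:C ^+ N.+1 * ker N.+3 z w)) else 0.

Let wd_kernel n z : normc z < 1 -> wd (fun z => (tw z)%:C ^+ n.+1 * ker n.+1 z w) z
  (- (n.+1%:R * (tw z)%:C ^+ n * conjc z * ker n.+1 z w))
  (n.+1%:R * (w - z) * (tw z)%:C ^+ n * ker n.+2 z w).
Proof.
move=> z1; apply: (wd_eq (wdM (wd_twX n z) (wd_ker n.+1 (ltW z1) w1))) => [//||].
  by rewrite mulr0 addr0 mulNr.
have n0 := ker_denom_neq0 (ltW z1) w1.
have twE : (tw z)%:C = 1 - z * conjc z by rewrite mulcJ /tw rmorphB.
by rewrite /ker !exprS {2}twE; field.
Qed.

Let kernel_bound n : exists2 M : R, 0 < M & forall z, normc z < 1 ->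
  normc ((tw z)%:C ^+ n.+1 * ker n.+2 z w) <= M * tw z ^+ n.+1.
Proof.
exists ((1 - normc w)^-1 ^+ n.+2); first by rewrite exprn_gt0 // invr_gt0 subr_gt0.
move=> z z1; rewrite (normcM (_ ^+ _)) normcX normcC ger0_norm ?(ltW (tw_gt0 z1)) // mulrC.
by rewrite ler_wpM2r ?exprn_ge0 ?(ltW (tw_gt0 z1)) // normc_ker_le // ltW.
Qed.

Let h_bound : exists2 M : R, 0 < M & forall z, normc z < 1 ->
  normc (F z * ((tw z)%:C ^+ N.+2 * ker N.+2 z w)) <= M * tw z ^+ 2.
Proof.
have [M M0 HM] := F_bounded.
have L0 : 0 < (1 - normc w)^-1 ^+ N.+2 by rewrite exprn_gt0 // invr_gt0 subr_gt0.
exists (M * (1 - normc w)^-1 ^+ N.+2); first by rewrite mulr_gt0.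
move=> z z1; have t0 := ltW (tw_gt0 z1).
rewrite (normcM (F z)) (normcM (_ ^+ _)) (normcX _%:C) normcC ger0_norm // -mulrA.
apply: ler_pM; rewrite ?normc_ge0 ?HM ?(ltW z1) //.
  by rewrite mulr_ge0 ?normc_ge0 ?exprn_ge0.
rewrite mulrC; apply: ler_pM; rewrite ?normc_ge0 ?exprn_ge0 //.
  by rewrite normc_ker_le // ltW.
by rewrite -[in leLHS]addn2 exprD ler_piMl ?exprn_ge0 // exprn_ile1 // tw_le1.
Qed.

Let continuous_h : continuous h.
Proof.
apply: continuous_if_disk => [z z1|].
  have c2 := wd_continuous (wd_kernel N.+1 z1).
  exact: (cvgM (continuous_F (ltW z1)) c2).
have [M M0 HM] := h_bound; exists M => // z z1; apply: le_trans (HM _ z1) _.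
by rewrite ler_pM2l // expr2 ler_piMl ?tw_le1 // ltW // tw_gt0.
Qed.

Let continuous_b : continuous b.
Proof.
apply: continuous_if_disk => [z z1|].
  have [A hA] := df (ltW z1).
  exact: wd_continuous (wdM (wd_cst N.+2%:R z) (wdM (wdD hA (wd_cst (- f w) z))
    (wdM (wd_twX N z) (wd_ker N.+3 (ltW z1) w1)))).
have [M M0 HM] := F_bounded; have [L L0 HL] := kernel_bound N.
have K0 : 0 < (1 - normc w)^-1 ^+ N.+3 by rewrite exprn_gt0 // invr_gt0 subr_gt0.
exists (N.+2%:R * (2 * M * (1 - normc w)^-1 ^+ N.+3)).
  by rewrite mulr_gt0 ?ltr0n // mulr_gt0 // mulr_gt0.
move=> z z1; have t0 := ltW (tw_gt0 z1).
have fF : f z - f w = F z * (w - z).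
  rewrite /F; case: eqP => [->|/eqP zw]; first by rewrite !subrr mulr0.
  by rewrite divfK // subr_eq0 eq_sym.
rewrite (normcM N.+2%:R) normc_nat -mulrA ler_pM2l ?ltr0n //.
rewrite (normcM (f z - f w)) fF -mulrA; apply: ler_pM; rewrite ?normc_ge0 //.
  rewrite (normcM (F z)) mulrC; apply: ler_pM; rewrite ?normc_ge0 //; last exact: HM (ltW z1).
  by apply: le_trans (normcD _ _) _; rewrite normcN -[leRHS]/(1 + 1) lerD // ltW.
rewrite (normcM (_ ^+ _)) (normcX _%:C) normcC ger0_norm // mulrC.
apply: ler_pM; rewrite ?normc_ge0 ?exprn_ge0 //.
  by rewrite normc_ker_le // ltW.
by rewrite exprS ler_piMr // exprn_ile1 // tw_le1.
Qed.

Let wd_h z : z != w -> exists A, wd h z A (b z).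
Proof.
move=> zw; have [z1|z1] := ltP (normc z) 1.
  have [A hA] := wd_F (ltW z1) zw; have hk := wdM hA (wd_kernel N.+1 z1).
  eexists; apply: (wd_local (d := 1 - normc z)); last first.
  - apply: (wd_eq hk) => [//||]; first reflexivity.
    rewrite /b z1 mul0r add0r /F (negbTE zw).
    have : w - z != 0 by rewrite subr_eq0 eq_sym.
    move: (N.+2%:R : C) ((tw z)%:C ^+ N.+1) (ker N.+3 z w) => n t u wz0.
    by field.
  - move=> k kd; rewrite /h ifT //.
    by apply: le_lt_trans (normcD _ _) _; lra.
  - by rewrite subr_gt0.
(* On the circle and outside both derivatives are 0: [|h|] is at most [M * tw ^ 2], which is of the
   order of [|k| ^ 2]. *)
exists 0; rewrite /b ltNge z1 /= => e e0.
have [M M0 HM] := h_bound; exists (e / (4 * M)) => [|k]; first by rewrite divr_gt0 // mulr_gt0.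
rewrite ltr_pdivlMr ?mulr_gt0 // => ke.
rewrite /h [normc z < 1]ltNge z1 /= !mul0r !subr0; case: ltP => zk; last first.
  by rewrite normc0 mulr_ge0 ?normc_ge0 // ltW.
apply: (le_trans (HM _ zk)).
have t1 := tw_le (ltW zk); have t0 := ltW (tw_gt0 zk).
have t2 : tw (z + k) <= 2 * normc k.
  by have := normcD (z + k) (- k); rewrite addrK normcN; lra.
have : tw (z + k) ^+ 2 <= (2 * normc k) ^+ 2 by rewrite lerXn2r ?nnegrE // (le_trans t0).
rewrite -(ler_pM2l M0) => t3; apply: (le_trans t3).
rewrite (_ : M * _ = normc k * (4 * M) * normc k); last by ring.
by rewrite ler_wpM2r ?normc_ge0 // ltW.
Qed.

Lemma area_identity_box :
  cint (area R) (box (-1) (-1) 2) (fun p => b (plane_pt p)) = 0.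
Proof.
have := goursat_green continuous_h continuous_b wd_h (-1) (-1) (ltr0Sn _ 1).
(* The sides of the square have [|x| = 1] or [|y| = 1], hence miss the open disk, and every term of
   the contour integral is 0. *)
have out x y : 1 <= `|x| \/ 1 <= `|y| -> h (x +i* y) = 0.
  move=> xy; rewrite /h ifF //; apply/negbTE; rewrite -leNgt.
  case: xy => /le_trans; apply; first exact: (normc_Re (x +i* y)).
  exact: (normc_Im (x +i* y)).
have n1 : 1 <= `|-1 : R| by rewrite normrN1.
have n2 : 1 <= `|-1 + 2 : R| by rewrite (_ : -1 + 2 = 1) ?normr1 //; lra.
have z0 D (l : R -> C) : (forall x, h (l x) = 0) -> cint (@lebesgue_measure R) D (h \o l) = 0.
  move=> hl; rewrite (@eq_cint _ _ _ _ _ _ (fun=> 0)) => [|t _]; last by rewrite /= hl.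
  by rewrite /cint /= /Rintegral integral0.
rewrite /contour.
rewrite (z0 `[-1, -1 + 2]%classic (horiz (-1))); last by move=> x; apply: out; right.
rewrite (z0 `[-1, -1 + 2]%classic (horiz (-1 + 2))); last by move=> x; apply: out; right.
rewrite (z0 `[-1, -1 + 2]%classic (vert (-1))); last by move=> x; apply: out; left.
rewrite (z0 `[-1, -1 + 2]%classic (vert (-1 + 2))); last by move=> x; apply: out; left.
rewrite !subrr mulr0 addr0 => /esym/eqP; rewrite !mulf_eq0 pnatr_eq0 /= => /orP[|/eqP //].
by rewrite eq_complex /= oner_eq0 andbF.
Qed.

Lemma area_identity :
  cint (area R) diskp (fun p => (f (plane_pt p) - f w) *
    ((tw (plane_pt p))%:C ^+ N.+1 * ker N.+3 (plane_pt p) w)) = 0.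
Proof.
pose G z := (f z - f w) * ((tw z)%:C ^+ N.+1 * ker N.+3 z w).
have mD : measurable diskp by exact: measurable_disk.
have ib : cintegrable (area R) diskp (fun p => b (plane_pt p)).
  apply: cintegrableS (@box_integrable R b (-1) (-1) 2 _ continuous_b) => //.
  - exact: measurable_box.
  - by move=> p; exact: diskp_box.
have bG p : diskp p -> G (plane_pt p) = N.+2%:R^-1 * b (plane_pt p).
  by rewrite /diskp /disk /= /b => ->; rewrite mulKf // pnatr_eq0.
rewrite (eq_cint _ bG) cintZ // (_ : cint _ _ _ = 0) ?mulr0 //.
rewrite -cint_box_disk -[RHS]area_identity_box; apply: eq_cint => p _.
by rewrite /b; case: ltP.
Qed.

End identity.
End area_identity.

(** * The reproducing formula for functions holomorphic on the closed disk *)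

Section reproducing.
Variable R : realType.
Local Notation C := R[i].
Implicit Types (f g m : C -> C) (z w k : C).

Lemma cint_conj d (T : measurableType d) (mu : {measure set T -> \bar R}) D (F : T -> C) :
  measurable D -> cintegrable mu D F -> cint mu D (fun t => conjc (F t)) = conjc (cint mu D F).
Proof.
move=> mD [F1 F2]; rewrite /cint /=; congr (_ +i* _).
  by apply: eq_Rintegral => t _; case: (F t).
rewrite -mulN1r -RintegralZl //; apply: eq_Rintegral => t _.
by case: (F t) => x y /=; rewrite mulN1r.
Qed.

Definition tw_mass n : R := \int[area R]_(p in @diskp R) tw (plane_pt p) ^+ n.

Lemma continuous_twX n z : {for z, continuous (fun z => (tw z)%:C ^+ n)}.
Proof.
case: n => [|n]; last exact: wd_continuous (wd_twX n z).
exact: wd_continuous (wd_cst 1 z).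
Qed.

Lemma twX_le1 n z : normc z < 1 -> 0 <= tw z ^+ n <= 1.
Proof.
move=> z1; have t0 := ltW (tw_gt0 z1).
by rewrite exprn_ge0 // exprn_ile1 // tw_le1.
Qed.

Lemma normc_twX n z : normc z < 1 -> normc ((tw z)%:C ^+ n) = tw z ^+ n.
Proof. by move=> z1; rewrite normcX normcC ger0_norm // ltW // tw_gt0. Qed.

Lemma twX_integrable n : cintegrable (area R) (@diskp R) (fun p => (tw (plane_pt p))%:C ^+ n).
Proof.
apply: (@disk_integrable R (fun z => (tw z)%:C ^+ n) 1) => z z1.
  exact: continuous_twX.
by rewrite normc_twX //; have /andP[] := twX_le1 n z1.
Qed.

Lemma cint_tw n : cint (area R) (@diskp R) (fun p => (tw (plane_pt p))%:C ^+ n) = (tw_mass n)%:C.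
Proof.
rewrite /cint /tw_mass; congr (_ +i* _).
  by apply: eq_Rintegral => p _; rewrite -rmorphXn.
rewrite (@eq_Rintegral _ _ _ _ _ (fun=> 0)) ?Rintegral_cst ?mul0r //; first exact: measurable_disk.
by move=> p _; rewrite -rmorphXn.
Qed.

(** On the square of side 1/2 at the origin, [tw] is at least 1/2. *)
Lemma tw_mass_gt0 n : 0 < tw_mass n.
Proof.
have mD : measurable (@diskp R) by exact: measurable_disk.
have mb : measurable (@box R 0 0 (1 / 2)) by exact: measurable_box.
have sub p : box 0 0 (1 / 2) p -> normc (@plane_pt R p) ^+ 2 <= 1 / 2.
  case: p => x y; rewrite /box /= !in_itv /= => -[/andP[x1 x2] /andP[y1 y2]].
  by rewrite sqr_sqrtr ?addr_ge0 ?sqr_ge0 //; nra.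
have subD : box 0 0 (1 / 2) `<=` @diskp R.
  move=> p /sub h; have : normc (@plane_pt R p) ^+ 2 < 1 ^+ 2 by rewrite expr1n; lra.
  by rewrite ltr_pXn2r // ?nnegrE ?normc_ge0.
have iT : (area R).-integrable (@diskp R) (fun p => (tw (plane_pt p) ^+ n)%:E).
  have [h _] := twX_integrable n; apply: eq_integrable h => // p _.
  by rewrite -rmorphXn.
have iB : (area R).-integrable (@box R 0 0 (1 / 2)) (fun p => (tw (plane_pt p) ^+ n)%:E).
  exact: integrableS iT.
have ab : area R (box 0 0 (1 / 2)) = ((1 / 2) ^+ 2)%:E by apply: area_box; rewrite divr_ge0.
apply: (@lt_le_trans _ _ ((1 / 2) ^+ n * fine (area R (box 0 0 (1 / 2))))).
  by rewrite ab /= mulr_gt0 ?exprn_gt0 ?divr_gt0.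
apply: (@le_trans _ _ (\int[area R]_(p in box 0 0 (1 / 2)) tw (plane_pt p) ^+ n)).
  rewrite -Rintegral_cst //; apply: le_Rintegral => //.
    by apply: integrable_cst_lty => //; rewrite ab ltry.
  by move=> p /sub h; rewrite lerXn2r ?nnegrE //; rewrite /tw; lra.
rewrite /tw_mass /Rintegral fine_le //.
- exact: integrable_fin_num.
- exact: integrable_fin_num.
apply: ge0_subset_integral => //; first exact: measurable_int iT.
by move=> p dp; rewrite lee_fin exprn_ge0 // ltW // tw_gt0.
Qed.

Lemma continuous_ker n z w : normc z < 1 -> normc w < 1 ->
  {for z, continuous (fun z => (ker n z w))}.
Proof. by move=> z1 w1; exact: wd_continuous (wd_ker n (ltW z1) w1). Qed.

Lemma continuousCM (F G : C -> C) z : {for z, continuous F} -> {for z, continuous G} ->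
  {for z, continuous (fun z => F z * G z)}.
Proof. by move=> h1 h2; exact: (cvgM h1 h2). Qed.

Lemma ker_integrable m (M : R) n j w : normc w < 1 ->
  (forall z, normc z < 1 -> {for z, continuous m}) ->
  (forall z, normc z < 1 -> normc (m z) <= M) ->
  cintegrable (area R) (@diskp R)
    (fun p => m (plane_pt p) * ((tw (plane_pt p))%:C ^+ n * ker j (plane_pt p) w)).
Proof.
move=> w1 cm mM.
apply: (@disk_integrable R (fun z => m z * ((tw z)%:C ^+ n * ker j z w))
  (M * (1 - normc w)^-1 ^+ j)) => z z1.
  apply: continuousCM; first exact: cm.
  by apply: continuousCM; [exact: continuous_twX|exact: continuous_ker].
rewrite (normcM (m z)) (normcM (_ ^+ _)) normc_twX //.
apply: ler_pM; rewrite ?normc_ge0 ?mulr_ge0 ?normc_ge0 ?mM //.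
  by have /andP[] := twX_le1 n z1.
rewrite -[leRHS]mul1r; apply: ler_pM; rewrite ?normc_ge0 //; have /andP[] // := twX_le1 n z1.
by move=> *; exact: normc_ker_le (ltW z1) w1.
Qed.

Section closed_disk.
Variables (f : C -> C).
Hypothesis df : forall z, normc z <= 1 -> exists A, wd f z A 0.

Let cf z : normc z <= 1 -> {for z, continuous f}.
Proof. by move=> /df[A hA]; exact: wd_continuous hA. Qed.

Lemma closed_disk_bounded : exists2 M : R, 0 < M & forall z, normc z <= 1 -> normc (f z) <= M.
Proof.
have cn : {within [set z : C | normc z <= 1], continuous (fun z => normc (f z))}.
  apply: continuous_in_subspaceT => z /set_mem /= z1.
  by apply: (@continuous_comp C C R f (@normc R) z); [exact: cf | exact: normc_continuous].
have /compact_bounded/pinfty_ex_gt0[M M0 HM] := continuous_compact cn (@cball_compact R 1).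
exists M => // z z1; rewrite -[leLHS]ger0_norm ?normc_ge0 //; apply: HM.
by exists z.
Qed.

Lemma area_identity_split n w : normc w < 1 ->
  cint (area R) (@diskp R) (fun p => f (plane_pt p) *
    ((tw (plane_pt p))%:C ^+ n.+1 * ker n.+3 (plane_pt p) w)) =
  f w * cint (area R) (@diskp R) (fun p => (tw (plane_pt p))%:C ^+ n.+1 * ker n.+3 (plane_pt p) w).
Proof.
move=> w1; have mD : measurable (@diskp R) by exact: measurable_disk.
have [M _ fM] := closed_disk_bounded.
have i1 : cintegrable (area R) (@diskp R) (fun p => f (plane_pt p) *
    ((tw (plane_pt p))%:C ^+ n.+1 * ker n.+3 (plane_pt p) w)).
  by apply: (@ker_integrable f M) => // z z1; [exact: cf (ltW z1)|exact: fM (ltW z1)].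
have i2 : cintegrable (area R) (@diskp R) (fun p =>
    (tw (plane_pt p))%:C ^+ n.+1 * ker n.+3 (plane_pt p) w).
  have := @ker_integrable (fun=> 1) 1 n.+1 n.+3 w w1 (fun z _ => wd_continuous (wd_cst 1 z)).
  rewrite normc1 => /(_ (fun _ _ => lexx 1)); apply: eq_cintegrable => // p _.
  by rewrite mul1r.
rewrite -cintZ //; apply/eqP; rewrite -subr_eq0 -cintB //; last exact: cintegrableZ.
apply/eqP; rewrite -[RHS](area_identity n w1 df); apply: eq_cint => p _.
by rewrite mulrBl.
Qed.

End closed_disk.

(** The conjugate of the kernel is holomorphic in [z] on the closed disk and equals 1 at 0. Applying
    the identity to it at the point 0, where the other kernel is 1, gives the conjugate of the
    claim. *)
Lemma ker_mass n w : normc w < 1 ->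
  cint (area R) (@diskp R) (fun p => (tw (plane_pt p))%:C ^+ n.+1 * ker n.+3 (plane_pt p) w) =
  (tw_mass n.+1)%:C.
Proof.
move=> w1; have mD : measurable (@diskp R) by exact: measurable_disk.
pose f z : C := (1 - z * conjc w)^-1 ^+ n.+3.
have fE z : f z = conjc (ker n.+3 z w).
  by rewrite /f /ker rmorphXn fmorphV rmorphB rmorphM /= conjcK oppr0.
have df z : normc z <= 1 -> exists A, wd f z A 0.
  move=> z1; have nz : 1 - z * conjc w != 0.
    have := ker_denom_neq0 z1 w1; rewrite -(conjc_eq0 (1 - _ * _)).
    by rewrite rmorphB rmorphM /= conjcK oppr0.
  have h1 : wd (fun z => 1 - z * conjc w) z (- conjc w) 0.
    by apply: (wd_eq (wdD (wd_cst 1 z) (wdM (wdM (wd_cst (-1) z) (wd_id z)) (wd_cst (conjc w) z)))) => [?||]; ring.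
  eexists; apply: (wd_eq (wdX n.+2 (wdV (f := fun z => 1 - z * conjc w) nz h1))) => [//||].
    by reflexivity.
  by rewrite oppr0 mul0r mulr0.
have f0 : f 0 = 1 by rewrite /f mul0r subr0 invr1 expr1n.
have n0 : normc (0 : C) < 1 by rewrite normc0.
have := area_identity_split df n n0; rewrite f0 mul1r.
have k0 z : ker n.+3 z 0 = 1 :> C by rewrite /ker mulr0 subr0 invr1 expr1n.
rewrite (@eq_cint _ _ _ _ _ _ (fun p => conjc ((tw (plane_pt p))%:C ^+ n.+1 * ker n.+3 (plane_pt p) w))); last first.
  move=> p _; rewrite k0 mulr1 fE -rmorphXn; case: (ker _ _ _) => a b /=.
  by simpc; rewrite mulrC [b * _]mulrC.
rewrite cint_conj //; last first.
  have := @ker_integrable (fun=> 1) 1 n.+1 n.+3 w w1 (fun z _ => wd_continuous (wd_cst 1 z)).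
  rewrite normc1 => /(_ (fun _ _ => lexx 1)); apply: eq_cintegrable => // p _.
  by rewrite mul1r.
rewrite [X in _ = X](@eq_cint _ _ _ _ _ _ (fun p => (tw (plane_pt p))%:C ^+ n.+1)); last first.
  by move=> p _; rewrite k0 mulr1.
by rewrite cint_tw => h; rewrite -[LHS]conjcK h conjc_real.
Qed.

Lemma reproducing_closed f n w : (forall z, normc z <= 1 -> exists A, wd f z A 0) ->
  normc w < 1 ->
  cint (area R) (@diskp R) (fun p => f (plane_pt p) *
    ((tw (plane_pt p))%:C ^+ n.+1 * ker n.+3 (plane_pt p) w)) = f w * (tw_mass n.+1)%:C.
Proof. by move=> df w1; rewrite area_identity_split // ker_mass. Qed.

End reproducing.

(** * Holomorphic derivatives and ray integrals *)

Section derivative.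
Variable R : realType.
Local Notation C := R[i].
Implicit Types (f g m F : C -> C) (z w k : C).

(** Differentiation under the integral calls for a quadratic remainder whose constant is the same
    for all [z]; the bound [B] on both inverse denominators provides it. *)
Lemma ker_taylor (j : nat) (B : R) : 0 < B -> exists2 K : R, 0 < K & forall z w k : C,
  normc z <= 1 -> 1 - conjc z * w != 0 -> 1 - conjc z * (w + k) != 0 ->
  normc (ker 1 z w) <= B -> normc (ker 1 z (w + k)) <= B ->
  normc (ker j z (w + k) - ker j z w - j%:R * conjc z * ker j.+1 z w * k) <= K * normc k ^+ 2.
Proof.
move=> B0; elim: j => [|j [K K0 IH]].
  exists 1 => // z w k _ _ _ _ _; rewrite /ker !expr0 subrr !mul0r subr0 normc0.
  by rewrite mul1r sqr_ge0.
exists (B * K + j.+1%:R * B ^+ j.+3).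
  by apply: addr_gt0; apply: mulr_gt0 => //; rewrite ?ltr0Sn ?exprn_gt0.
move=> z w k z1 n1 n2 uB vB; have := IH z w k z1 n1 n2 uB vB.
move: uB vB; rewrite /ker !expr1; set u := (1 - _ * w)^-1; set v := (1 - _ * (w + k))^-1.
move=> uB vB IHk.
rewrite (_ : _ - _ = v * (v ^+ j - u ^+ j - j%:R * conjc z * u ^+ j.+1 * k) +
  j.+1%:R * (conjc z * k) ^+ 2 * u ^+ j.+2 * v); last first.
  rewrite !exprS -natr1; move: (u ^+ j) (v ^+ j) => U V; rewrite /u /v.
  by field; apply/andP; split; [exact: n2|exact: n1].
apply: le_trans (normcD _ _) _; rewrite mulrDl; apply: lerD.
  by rewrite (normcM v) -[leRHS]mulrA; apply: ler_pM; rewrite ?normc_ge0.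
rewrite (_ : normc _ = j.+1%:R * ((normc z * normc k) ^+ 2 * (normc u ^+ j.+2 * normc v))); last first.
  rewrite (normcM (j.+1%:R * (conjc z * k) ^+ 2 * u ^+ j.+2)).
  rewrite (normcM (j.+1%:R * (conjc z * k) ^+ 2)) (normcM j.+1%:R) normc_nat.
  by rewrite (normcX (conjc z * k)) (normcX u) (normcM (conjc z)) normc_conj !mulrA.
rewrite -[leRHS]mulrA ler_pM2l ?ltr0Sn // [leRHS]mulrC.
apply: ler_pM.
- exact: sqr_ge0.
- by apply: mulr_ge0; [apply: exprn_ge0|]; exact: normc_ge0.
- by rewrite lerXn2r ?nnegrE ?mulr_ge0 ?normc_ge0 // ler_piMl ?normc_ge0.
rewrite [in leRHS]exprSr; apply: ler_pM => //.
- by apply: exprn_ge0; exact: normc_ge0.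
- exact: normc_ge0.
- by rewrite lerXn2r ?nnegrE ?normc_ge0 // ltW.
Qed.

Lemma wd_cint_ker m (M : R) n j w : normc w < 1 ->
  (forall z, normc z < 1 -> {for z, continuous m}) ->
  (forall z, normc z < 1 -> normc (m z) <= M) ->
  wd (fun w => cint (area R) (@diskp R) (fun p => m (plane_pt p) *
      ((tw (plane_pt p))%:C ^+ n * ker j (plane_pt p) w))) w
    (cint (area R) (@diskp R) (fun p => (j%:R * conjc (plane_pt p) * m (plane_pt p)) *
      ((tw (plane_pt p))%:C ^+ n * ker j.+1 (plane_pt p) w))) 0.
Proof.
move=> w1 cm mM e e0; have mD : measurable (@diskp R) by exact: measurable_disk.
have M0 : 0 <= M by apply: le_trans (mM 0 _); rewrite ?normc_ge0 ?normc0.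
(* Halfway between [|w|] and 1: for [|v| < r] all inverse denominators are at most [B], and small
   [k] keep [w + k] in that range. *)
pose r := (1 + normc w) / 2; have r1 : r < 1 by rewrite /r; lra.
have wr : normc w < r by rewrite /r; lra.
pose B := (1 - r)^-1; have B0 : 0 < B by rewrite invr_gt0 subr_gt0.
have [K K0 HK] := ker_taylor j B0.
have cm' z : normc z < 1 -> {for z, continuous (fun z => j%:R * conjc z * m z)}.
  move=> z1; apply: continuousCM; last exact: cm.
  by apply: wd_continuous (wdM (wd_cst j%:R z) (wd_conj z)).
have mM' z : normc z < 1 -> normc (j%:R * conjc z * m z) <= j%:R * M.
  move=> z1; rewrite !(normcM (_ * _)) (normcM j%:R) normc_nat normc_conj -mulrA.
  rewrite ler_wpM2l ?ler0n // (le_trans (ler_piMl _ (ltW z1))) ?normc_ge0 //; exact: mM.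
pose A := fine (area R (@diskp R)).
have A0 : 0 <= A by rewrite fine_ge0.
pose D := 2 * (M * K * A) + 1; have D0 : 0 < D by rewrite ltr_wpDl // !mulr_ge0 // ltW.
exists (Num.min (r - normc w) (e / D)) => [|k].
  by rewrite lt_min subr_gt0 wr divr_gt0.
rewrite lt_min => /andP[kr ke].
have wk : normc (w + k) < r by apply: le_lt_trans (normcD _ _) _; lra.
have wk1 : normc (w + k) < 1 by exact: lt_trans r1.
rewrite mul0r subr0 mulrC -cintZ //; last exact: (ker_integrable n j.+1 w1 cm' mM').
have i1 := ker_integrable n j wk1 cm mM; have i2 := ker_integrable n j w1 cm mM.
have i3 := cintegrableZ k mD (ker_integrable n j.+1 w1 cm' mM').
rewrite -cintB // -cintB //; last exact: cintegrableB.
have kerB z v : normc z < 1 -> normc v < r -> normc (ker 1 z v) <= B.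
  move=> z1 vr; have v1 : normc v < 1 by exact: lt_trans r1.
  apply: le_trans (normc_ker_le 1 (ltW z1) v1) _; rewrite expr1.
  by rewrite lef_pV2 ?posrE ?subr_gt0 // lerB // ltW.
apply: (@le_trans _ _ (2 * (M * (K * normc k ^+ 2) * A))).
  apply: normc_cint_cst => //.
  - exact: area_disk_lty.
  - by apply: cintegrableB => //; exact: cintegrableB.
  move=> p dp; set z := plane_pt p; have z1 : normc z < 1 := dp.
  rewrite (_ : _ - _ = m z * ((tw z)%:C ^+ n *
     (ker j z (w + k) - ker j z w - j%:R * conjc z * ker j.+1 z w * k))); last by ring.
  rewrite (normcM (m z)) (normcM (_ ^+ _)) normc_twX //.
  have /andP[t0 t1] := twX_le1 n z1.
  apply: ler_pM; rewrite ?normc_ge0 ?mulr_ge0 ?normc_ge0 ?mM //.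
  rewrite -[leRHS]mul1r; apply: ler_pM; rewrite ?normc_ge0 //.
  apply: HK; rewrite ?(ltW z1) ?(ker_denom_neq0 (ltW z1)) // kerB //.
rewrite (_ : _ * _ = 2 * (M * K * A) * normc k * normc k); last by ring.
rewrite ler_wpM2r ?normc_ge0 //; move: ke; rewrite ltr_pdivlMr // => ke.
have := normc_ge0 k; rewrite /D in ke; nra.
Qed.

Lemma wd_scale f (c z a : C) : wd f (c * z) a 0 -> wd (fun z => f (c * z)) z (a * c) 0.
Proof.
move=> hf e e0; have c0 : 0 < normc c + 1 by rewrite ltr_wpDl ?normc_ge0.
have [|d d0 H] := hf (e / (normc c + 1)); first by rewrite divr_gt0.
exists (d / (normc c + 1)) => [|k]; first by rewrite divr_gt0.
rewrite ltr_pdivlMr // => kd.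
have ck : normc (c * k) <= normc k * (normc c + 1).
  by rewrite (normcM c) mulrDr mulr1 mulrC lerDl normc_ge0.
have := H (c * k) (le_lt_trans ck kd); rewrite !mul0r !subr0 mulrDr mulrA => h.
apply: (le_trans h); apply: (le_trans (ler_wpM2l _ ck)); first by rewrite ltW // divr_gt0.
by rewrite mulrCA mulfVK ?gt_eqF // mulrC.
Qed.

(** [holomorphic] is mere pointwise differentiability. After dilation by [r] the function is
    holomorphic on the closed disk, the reproducing formula with [tw ^ 1] and [ker 3] represents it,
    and that integral can be differentiated twice in its parameter. *)
Lemma wd_derive_holomorphic f z : holomorphic f -> disk z ->
  exists A, wd (derive1 f) z A 0.
Proof.
move=> hf z1; have {}z1 : normc z < 1 := z1.
pose r := (1 + normc z) / 2; have r1 : r < 1 by rewrite /r; lra.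
have zr : normc z < r by rewrite /r; lra.
have r0 : 0 < r by have := normc_ge0 z; rewrite /r; lra.
pose c : C := r%:C; have nc : normc c = r by rewrite normcC ger0_norm // ltW.
have c0 : c != 0 by rewrite -normc_gt0 nc.
have dc w : normc w <= 1 -> disk (c * w).
  move=> w1; apply: (@le_lt_trans _ _ r) => //; rewrite (normcM c) nc.
  by rewrite ler_piMr // ltW.
pose fc w := f (c * w).
have dfc w : normc w <= 1 -> wd fc w (derive1 f (c * w) * c) 0.
  by move=> /dc h; apply: wd_scale; apply: derivable_wd; exact: hf.
have dfc' w : normc w <= 1 -> exists A, wd fc w A 0 by move=> /dfc ?; eexists; eassumption.
have [M M0 fM] := closed_disk_bounded dfc'.
have cfc w : normc w < 1 -> {for w, continuous fc}.
  by move=> w1; exact: wd_continuous (dfc _ (ltW w1)).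
have fcM w : normc w < 1 -> normc (fc w) <= M by move=> w1; exact: fM (ltW w1).
pose I := (tw_mass R 1)%:C; have I0 : I != 0.
  by rewrite -normc_gt0 normcC normr_gt0 gt_eqF // tw_mass_gt0.
pose m w := 3%:R * conjc w * fc w.
have cm w : normc w < 1 -> {for w, continuous m}.
  move=> w1; apply: continuousCM; last exact: cfc.
  by apply: wd_continuous (wdM (wd_cst 3%:R w) (wd_conj w)).
have mM w : normc w < 1 -> normc (m w) <= 3%:R * M.
  move=> w1; rewrite !(normcM (_ * _)) (normcM 3%:R) normc_nat normc_conj -mulrA.
  rewrite ler_wpM2l ?ler0n // (le_trans (ler_piMl _ (ltW w1))) ?normc_ge0 //; exact: fcM.
pose G w := cint (area R) (@diskp R) (fun p => m (plane_pt p) *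
      ((tw (plane_pt p))%:C ^+ 1 * ker 4 (plane_pt p) w)).
have GE w : normc w < 1 -> derive1 f (c * w) = (c * I)^-1 * G w.
  move=> w1; have h := wd_cint_ker 1 3 w1 cfc fcM.
  have h2 : wd fc w (I^-1 * G w) 0.
    apply: (wd_local (d := 1 - normc w)); last first.
    - by apply: (wd_eq (wdM (wd_cst I^-1 w) h)) => [//||]; rewrite !mul0r ?add0r ?mulr0 ?addr0.
    - move=> k kw; have wk : normc (w + k) < 1 by apply: le_lt_trans (normcD _ _) _; lra.
      by rewrite (reproducing_closed 0 dfc' wk) mulrCA mulVf // mulr1.
    - by rewrite subr_gt0.
  have := wd_derive1 h2; rewrite (wd_derive1 (dfc _ (ltW w1))) => h3.
  by rewrite invfM -mulrA -h3 mulrCA mulVf // mulr1.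
have zc : normc (c^-1 * z) < 1 by rewrite (normcM c^-1) normcV nc mulrC ltr_pdivrMr // mul1r.
have h := wd_scale (wd_cint_ker 1 4 zc cm mM).
eexists; apply: (wd_local (d := r - normc z)); last first.
- by apply: (wd_eq (wdM (wd_cst (c * I)^-1 z) h)) => [//||]; [reflexivity|rewrite mul0r mulr0 addr0].
- move=> k kw; rewrite -[X in _ = derive1 f X](mulVKf c0) GE //.
  rewrite (normcM c^-1) normcV nc mulrC ltr_pdivrMr // mul1r.
  by apply: le_lt_trans (normcD _ _) _; lra.
- by rewrite subr_gt0.
Qed.

End derivative.

Section ray_integral.
Variable R : realType.
Local Notation C := R[i].
Local Notation lam := (@lebesgue_measure R).
Implicit Types (f g F : C -> C) (z w k : C).

Definition segment_cont (G : R -> C) (a b : R) := forall x : R, a <= x <= b ->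
  forall e : R, 0 < e -> exists2 d : R, 0 < d & forall k : R, `|k| < d -> normc (G (x + k) - G x) <= e.

Lemma segment_cont_Re G a b : segment_cont G a b ->
  {within `[a, b], continuous (fun t => complex.Re (G t))}.
Proof.
move=> cG; apply: continuous_in_subspaceT => x /set_mem; rewrite /= in_itv /= => xab.
apply: real_continuous => e /(cG x xab)[d d0 H]; exists d => // k /H.
by rewrite -raddfB; apply: le_trans; exact: normc_Re.
Qed.

Lemma segment_cont_Im G a b : segment_cont G a b ->
  {within `[a, b], continuous (fun t => complex.Im (G t))}.
Proof.
move=> cG; apply: continuous_in_subspaceT => x /set_mem; rewrite /= in_itv /= => xab.
apply: real_continuous => e /(cG x xab)[d d0 H]; exists d => // k /H.
by rewrite -raddfB; apply: le_trans; exact: normc_Im.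
Qed.

Lemma segment_cont_integrable G a b : segment_cont G a b -> cintegrable lam `[a, b] G.
Proof.
move=> cG; split; apply: continuous_compact_integrable (@segment_compact _ _ _) _.
  exact: segment_cont_Re.
exact: segment_cont_Im.
Qed.

Lemma Rintegral_scale (G : R -> R) (s : R) : 0 < s -> {within `[0, s], continuous G} ->
  \int[lam]_(t in `[0, s]) G t = \int[lam]_(t in `[0, 1]) (G (s * t) * s).
Proof.
move=> s0 cG; rewrite /Rintegral; congr fine.
have dF (x : R) : is_derive x 1 ( *%R s) s.
  have : is_derive x 1 (s \*: (@id R)) (s *: (1 : R)) by exact: is_deriveZ.
  by rewrite [s *: 1]mulr1.
have F' : derive1 (fun x : R => s * x) = fun=> s.
  by apply/funext => x; rewrite derive1E derive_val.
have := @integration_by_substitution_increasing R (fun t => s * t) G 0 1 ler01.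
rewrite mulr0 mulr1 => ->.
- by apply: eq_integral => t _ /=; rewrite F'.
- by move=> x y _ _ xy; rewrite ltr_pM2l.
- by rewrite F' => x _; exact: cst_continuous.
- by rewrite F'; exact: is_cvg_cst.
- by rewrite F'; exact: is_cvg_cst.
- split.
  + by move=> x _; have [] := dF x.
  + apply: cvg_at_right_filter.
    by apply: differentiable_continuous; apply/derivable1_diffP; have [] := dF 0.
  + apply: cvg_at_left_filter.
    by apply: differentiable_continuous; apply/derivable1_diffP; have [] := dF 1.
- exact: cG.
Qed.

Lemma cint_scale (G : R -> C) (s : R) : 0 < s -> segment_cont G 0 s ->
  cint lam `[0, s] G = cint lam `[0, 1] (fun t => G (s * t) * s%:C).
Proof.
move=> s0 cG; rewrite /cint (Rintegral_scale s0 (segment_cont_Re cG)).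
rewrite (Rintegral_scale s0 (segment_cont_Im cG)); congr (_ +i* _); apply: eq_Rintegral => t _;
  by case: (G _) => a b /=; simpc.
Qed.

(** As [h] is known to be holomorphic, its derivative can be read off along the ray through [z],
    where the integral is a real primitive of a continuous function. *)
Lemma derive_ray_integral (h F : C -> C) : holomorphic h ->
  (forall z, disk z -> {for z, continuous F}) ->
  (forall z, disk z -> h z = integral01 (fun t => F (t%:C * z) * z)) ->
  forall z, disk z -> derive1 h z = F z.
Proof.
move=> hh cF hE.
(* At 0 the ray degenerates. There the identity follows from the continuity of both sides, that of
   [derive1 h] being given by [wd_derive_holomorphic]. *)
suff off0 z : disk z -> z != 0 -> derive1 h z = F z.
  move=> z dz; have [->|z0] := eqVneq z 0; last exact: off0.
  apply/eqP; rewrite -subr_eq0 -[_ == _]negbK -normc_gt0; apply/negP => n0.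
  set e := normc _ in n0; have e4 : 0 < e / 4 by rewrite divr_gt0.
  have d0 : disk (0 : C) by exact: disk0.
  have [A /wd_cont/(_ _ e4)[d1 d10 H1]] := wd_derive_holomorphic hh d0.
  have /continuousCP/(_ _ e4)[d2 d20 H2] := cF 0 d0.
  pose d := Num.min 1 (Num.min d1 d2); have d_gt0 : 0 < d by rewrite !lt_min ltr01 d10.
  pose k : C := (d / 2)%:C; have nk : normc k = d / 2 by rewrite normcC ger0_norm // divr_ge0 // ltW.
  have kd : normc k < d by rewrite nk; lra.
  move: (kd); rewrite !lt_min => /and3P[k1 /H1 {}H1 /H2 {}H2].
  have k0 : k != 0 by rewrite -normc_gt0 nk divr_gt0.
  move: H1 H2; rewrite add0r (off0 _ k1 k0) => H1 H2.
  have : e <= e / 4 + e / 4.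
    rewrite {1}/e (_ : derive1 h 0 - F 0 = - (F k - derive1 h 0) + (F k - F 0)); last by ring.
    by apply: le_trans (normcD _ _) _; rewrite normcN lerD.
  lra.
move=> dz z0; have {}dz : normc z < 1 := dz.
have nz0 : 0 < normc z by rewrite normc_gt0.
(* The parameter at which the ray leaves the disk; since [S > 1], there is room to increase the
   parameter beyond 1. *)
pose S := (normc z)^-1; have S1 : 1 < S by rewrite invf_gt1.
have dsz (s : R) : 0 <= s < S -> disk (s%:C * z).
  move=> /andP[s0 sS]; rewrite /disk /= (normcM s%:C) normcC ger0_norm //.
  by rewrite -ltr_pdivlMr // div1r.
pose G (t : R) := F (t%:C * z).
have cG a b : 0 <= a -> b < S -> segment_cont G a b.
  move=> a0 bS x /andP[ax xb] e e0.
  have x0S : 0 <= x < S by rewrite (le_trans a0 ax) (le_lt_trans xb bS).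
  have /continuousCP/(_ _ e0)[d d0 H] := cF _ (dsz _ x0S).
  exists d => // k kd; rewrite /G rmorphD mulrDl; apply: H.
  rewrite (normcM k%:C) normcC; apply: le_lt_trans kd.
  by rewrite ler_piMr // ltW.
(* Rescaling the parameter makes [h] along the ray a primitive in [s] of the single function [G]. *)
have hG (s : R) : 0 < s < S -> h (s%:C * z) = z * cint lam `[0, s] G.
  move=> /andP[s0 sS]; have sS' : 0 <= s < S by rewrite ltW.
  rewrite (hE _ (dsz _ sS')) (cint_scale s0 (cG _ _ (lexx 0) sS)) -cintZ //; last first.
    apply: segment_cont_integrable => x /andP[x0 x1] e e0.
    have xs : 0 <= s * x <= s by rewrite mulr_ge0 ?(ltW s0) //= ler_piMr // ltW.
    have es : 0 < e / s by rewrite divr_gt0.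
    have [d d0 H] := cG 0 s (lexx 0) sS (s * x) xs (e / s) es.
    exists (d / s) => [|k]; first by rewrite divr_gt0.
    rewrite ltr_pdivlMr // => kd; rewrite mulrDr -mulrBl (normcM _ s%:C) normcC gtr0_norm //.
    by rewrite -ler_pdivlMr //; apply: H; rewrite normrM gtr0_norm // mulrC.
  apply: eq_cint => t _; rewrite /G (_ : t%:C * (s%:C * z) = (s * t)%:C * z); last first.
    by rewrite rmorphM; ring.
  by ring.
apply/eqP; rewrite -subr_eq0 -[_ == _]negbK -normc_gt0; apply/negP => n0.
set e := normc _ in n0; have e4 : 0 < e / 4 by rewrite divr_gt0.
have [d1 d10 H1] := derivable_wd (hh z dz) e4.
have e8 : 0 < e / 8 by rewrite divr_gt0.
have [d2 d20 H2] : exists2 d : R, 0 < d & forall k : R, `|k| < d -> normc (G (1 + k) - G 1) <= e / 8.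
  by apply: (cG 1 1 ler01 S1) => //; rewrite !lexx.
pose d := Num.min (S - 1) (Num.min d1 d2).
have d_gt0 : 0 < d by rewrite !lt_min subr_gt0 S1 d10.
pose r := d / 2; have r0 : 0 < r by rewrite divr_gt0.
have : r < d by rewrite /r; lra.
rewrite !lt_min => /and3P[rS r1 r2].
have rS' : 1 + r < S by lra.
have cG1 := segment_cont_integrable (cG 0 (1 + r) (lexx 0) rS').
have sub a b : 0 <= a -> b <= 1 + r -> cintegrable lam `[a, b] G.
  by move=> a0 b1; apply: segment_cont_integrable; apply: cG => //; lra.
have Isplit : cint lam `[0, 1 + r] G = cint lam `[0, 1] G + cint lam `[1, 1 + r] G.
  by apply: cint_itv_split => //; lra.
have I1 : normc (cint lam `[1, 1 + r] G - F z * r%:C) <= 2 * (e / 8 * r).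
  rewrite -(segment_cst _ 1 (ltW r0)) -cintB //; [|exact: sub|exact: segment_cst_integrable (ltW r0)].
  apply: segment_le (ltW r0) _ _.
    by apply: cintegrableB => //; [exact: sub|exact: segment_cst_integrable (ltW r0)].
  move=> x /andP[x1 x2]; have := H2 (x - 1); rewrite subrKC /G mul1r; apply.
  by rewrite ger0_norm; lra.
have nr : normc (r%:C * z) <= r.
  by rewrite (normcM r%:C) normcC gtr0_norm // ler_piMr // ltW.
have := H1 (r%:C * z) (le_lt_trans nr r1); rewrite mul0r subr0.
have hz : h z = z * cint lam `[0, 1] G.
  by have := hG 1; rewrite mul1r; apply; rewrite ltr01.
have -> : h (z + r%:C * z) = z * cint lam `[0, 1 + r] G.
  by rewrite -hG ?rS' ?andbT; [rewrite rmorphD mulrDl mul1r | lra].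
rewrite hz Isplit => H3.
have : normc z * r * e <= normc z * r * (e / 2).
  rewrite (_ : normc z * r * e = normc (z * r%:C * (derive1 h z - F z))); last first.
    by rewrite (normcM (z * r%:C)) (normcM z) normcC gtr0_norm.
  rewrite (_ : z * r%:C * _ = z * (cint lam `[1, 1 + r] G - F z * r%:C) -
    (z * (cint lam `[0, 1] G + cint lam `[1, 1 + r] G) - z * cint lam `[0, 1] G -
       derive1 h z * (r%:C * z))); last by ring.
  apply: le_trans (normcD _ _) _; rewrite normcN (normcM z).
  have : normc z * normc (cint lam `[1, 1 + r] G - F z * r%:C) <= normc z * (2 * (e / 8 * r)).
    by rewrite ler_pM2l.
  move: H3; rewrite (normcM r%:C) normcC gtr0_norm //; lra.
by rewrite ler_pM2l ?mulr_gt0 //; lra.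
Qed.

End ray_integral.

(** * The Forelli-Rudin estimate *)

Section real_integrals.
Variable R : realType.
Local Notation lam := (@lebesgue_measure R).
Implicit Types (f F : R -> R) (a b x y X T k M : R).

Lemma powR_le0 k x y : k <= 0 -> 0 < x -> x <= y -> y `^ k <= x `^ k.
Proof.
move=> k0 x0 xy; have y0 := lt_le_trans x0 xy.
rewrite -[k]opprK ![_ `^ (- - _)]powRN lef_pV2 ?posrE ?powR_gt0 //.
by rewrite ge0_ler_powR ?nnegrE ?oppr_ge0 // ltW.
Qed.

Lemma powR_ge0_le k x y : 0 <= k -> 0 <= x -> x <= y -> x `^ k <= y `^ k.
Proof. by move=> k0 x0 xy; rewrite ge0_ler_powR ?nnegrE // (le_trans x0). Qed.

(** The primitive is given only inside the open interval, at whose ends the integrand may blow up.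
    Closed subintervals exhaust it, and the bound on [F] survives monotone convergence. *)
Lemma ge0_integral_derivative_le f F a b M : a < b ->
  (forall x, a < x < b -> 0 <= f x) ->
  (forall x, a < x < b -> {for x, continuous f}) ->
  (forall x, a < x < b -> is_derive x 1 F (f x)) ->
  (forall x, a < x < b -> 0 <= F x <= M) ->
  (\int[lam]_(x in `]a, b[) (f x)%:E <= M%:E)%E.
Proof.
move=> ab f0 cf dF FM.
pose h := b - a; have h0 : 0 < h by rewrite subr_gt0.
(* Starting the sequence at [h / 3] makes all the closed subintervals nondegenerate. *)
have [u [u0 u3 uE]] : exists u : nat -> R, [/\ forall n, 0 < u n, forall n, u n <= h / 3 & u = fun n => h / n.+3%:R].
  exists (fun n => h / n.+3%:R); split => // n; first by rewrite divr_gt0 ?ltr0Sn.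
  by rewrite ler_pM2l // lef_pV2 ?posrE ?ltr0Sn // ler_nat.
pose A n := `[a + u n, b - u n]%classic.
have inA n x : A n x -> a < x < b.
  rewrite /A /= in_itv /= => /andP[h1 h2]; have h3 := u0 n; apply/andP; split; lra.
have AE n x : a + u n <= x <= b - u n -> A n x.
  by move=> h3; rewrite /A /= ?in_itv.
have UA : `]a, b[%classic = \bigcup_n A n.
  apply/seteqP; split => [x /=|x [n _ /inA]]; last by rewrite /= in_itv.
  rewrite in_itv /= => /andP[ax xb].
  have [n Hn] : exists n : nat, h / Num.min (x - a) (b - x) < n%:R.
    by exists (Num.truncn (h / Num.min (x - a) (b - x))).+1; exact: truncnS_gt.
  have m0 : 0 < Num.min (x - a) (b - x) by rewrite lt_min !subr_gt0 ax.
  exists n => //; apply: AE.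
  have : u n < Num.min (x - a) (b - x).
    rewrite uE ltr_pdivrMr ?ltr0Sn // mulrC -ltr_pdivrMr //; apply: lt_le_trans Hn _.
    by rewrite ler_nat !leqW.
  by rewrite lt_min => /andP[h1 h2]; apply/andP; split; lra.
have mf : measurable_fun `]a, b[%classic f.
  apply: open_continuous_measurable_fun; first exact: interval_open.
  by move=> x /set_mem /=; rewrite in_itv /=; exact: cf.
have mAf n : measurable_fun (A n) f.
  by apply: measurable_funS mf => // x /inA; rewrite /= in_itv.
have intA n : (\int[lam]_(x in A n) (f x)%:E <= M%:E)%E.
  have lt : a + u n < b - u n by have := u3 n; have := u0 n; rewrite /h; lra.
  have /inA ea : A n (a + u n) by apply: AE; rewrite lexx (ltW lt).
  have /inA eb : A n (b - u n) by apply: AE; rewrite lexx (ltW lt).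
  rewrite (@continuous_FTC2 R f F _ _ lt).
  - have /andP[? ?] := FM _ ea; have /andP[? ?] := FM _ eb.
    by rewrite -EFinB lee_fin; lra.
  - by apply: continuous_in_subspaceT => x /set_mem /inA; exact: cf.
  - have d x : a < x < b -> {for x, continuous F}.
      by move=> /dF[dx _]; apply: differentiable_continuous; exact/derivable1_diffP.
    split.
    + by move=> x xab; have [] := dF x (inA n x (subset_itv_oo_cc xab)).
    + by apply: cvg_at_right_filter; exact: d.
    + by apply: cvg_at_left_filter; exact: d.
  - move=> x xab; rewrite derive1E; have := dF x (inA n x (subset_itv_oo_cc xab)) => ?.
    by rewrite derive_val.
have nd : nondecreasing_seq A.
  move=> m n mn; rewrite subsetEset => x; rewrite /A /= !in_itv /= => /andP[h1 h2].
  have : u n <= u m by rewrite uE ler_pM2l // lef_pV2 ?posrE ?ltr0Sn // ler_nat !ltnS.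
  by move=> h3; apply/andP; split; lra.
have mA n : measurable (A n) by exact: measurable_itv.
have mfA n : measurable_fun (A n) (EFin \o f) by exact/measurable_EFinP.
have fA n x : A n x -> (0 <= (EFin \o f) x)%E by move=> /inA/f0; rewrite lee_fin.
have cv := ge0_nondecreasing_set_cvg_integral (mu := lam) nd mA mfA fA.
have E := cvg_lim (@ereal_hausdorff R) cv.
rewrite UA -[leLHS]E; apply: lime_le; last by apply: nearW => n; exact: intA.
apply: ereal_nondecreasing_is_cvgn.
exact: ge0_nondecreasing_set_nondecreasing_integral.
Qed.

Lemma is_derive_powR_affine (c s k x : R) : 0 < c + s * x ->
  is_derive x 1 (fun x => (c + s * x) `^ k) (k * (c + s * x) `^ (k - 1) * s).
Proof.
move=> h; have d : is_derive x 1 (fun x : R => c + s * x) s.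
  have h1 : is_derive x 1 (s \*: (@id R)) (s *: (1 : R)) by exact: is_deriveZ.
  by have := is_deriveD (is_derive_cst c x 1) h1; rewrite add0r [s *: 1]mulr1.
exact: (@is_derive1_comp R (@powR R ^~ k) (fun x => c + s * x) x _ _ (is_derive1_powR k h) d).
Qed.

Lemma continuous_derivable (F : R -> R) x d : is_derive x 1 F d -> {for x, continuous F}.
Proof. by move=> [dx _]; apply: differentiable_continuous; exact/derivable1_diffP. Qed.

(* [s = 1] and [s = -1] are the two sides of the singularity [y0]. *)
Lemma integral_powR_shift_le (s y0 a b T k : R) : 0 < k -> 0 < T -> `|s| = 1 -> a < b ->
  (forall y, a < y < b -> 0 < s * (y - y0)) ->
  (\int[lam]_(y in `]a, b[) ((s * (y - y0) + T) `^ (- 1 - k))%:E <= (T `^ (- k) / k)%:E)%E.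
Proof.
move=> k0 T0 s1 ab sy.
have s2 : s * s = 1 by rewrite -expr2 -real_normK ?num_real // s1 expr1n.
pose v y := (T - s * y0) + s * y.
have vE y : s * (y - y0) + T = v y by rewrite /v; ring.
have v0 y : a < y < b -> T <= v y by move=> /sy h; rewrite -vE; lra.
have v0' y : a < y < b -> 0 < v y by move=> /v0; exact: lt_le_trans.
under eq_integral do rewrite vE.
(* The constant shifts the primitive into [[0, T ^ (- k) / k]]: the bare primitive is negative for
   [s = 1] and positive for [s = -1]. *)
pose K : R := if s == 1 then T `^ (- k) / k else 0.
have sE : s = 1 \/ s = -1.
  by move/eqP: s1; rewrite eqr_norml ler01 andbT => /orP[] /eqP ->; [left|right].
pose F := cst K + (- s / k) \*: (fun y => v y `^ (- k)).
have FE y : F y = K - s * (v y `^ (- k) / k).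
  by rewrite (_ : F y = K + (- s / k) * v y `^ (- k)) //; ring.
have dv y : a < y < b -> is_derive y 1 F (v y `^ (-1 - k)).
  move=> yab; have d1 := is_derive_powR_affine (- k) (v0' y yab).
  have d2 : is_derive y 1 ((- s / k) \*: (fun y => v y `^ (- k))) ((- s / k) *: (- k * (v y) `^ (- k - 1) * s)).
    exact: is_deriveZ.
  apply: (is_derive_eq (is_deriveD (is_derive_cst K y 1) d2)).
  rewrite add0r (_ : - k - 1 = -1 - k); last by ring.
  transitivity (s * s * v y `^ (-1 - k)); last by rewrite s2 mul1r.
  change ((- s / k) * (- k * v y `^ (-1 - k) * s) = s * s * v y `^ (-1 - k)).
  by field; rewrite gt_eqF.
apply: (ge0_integral_derivative_le ab _ _ dv).
- by move=> y _; exact: powR_ge0.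
- move=> y yab; exact: continuous_derivable (is_derive_powR_affine (-1 - k) (v0' y yab)).
- move=> y yab; have h1 := powR_ge0 (v y) (- k).
  have h2 : v y `^ (- k) / k <= T `^ (- k) / k.
    by rewrite ler_pM2r ?invr_gt0 // powR_le0 ?oppr_le0 ?(ltW k0) // v0.
  have h3 : 0 <= v y `^ (- k) / k by rewrite divr_ge0 // ltW.
  rewrite FE /K; case: sE => ->; rewrite ?eqxx ?mul1r; first by apply/andP; split; lra.
  by rewrite ifF; [rewrite mulN1r sub0r opprK h3 | apply/negbTE; lra].
Qed.

(* With [P = T ^ k], comparable to [t ^ (k - 1)] for [t <= T] and to
   [T ^ (2 k) t ^ (- 1 - k)] for [t >= T], with an elementary primitive. *)
Definition ratio_bump (k P t : R) : R := t `^ (k - 1) * P ^+ 2 / (P + t `^ k) ^+ 2.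

Lemma ratio_bump_ge0 k P t : 0 <= ratio_bump k P t.
Proof. by rewrite /ratio_bump divr_ge0 ?sqr_ge0 // mulr_ge0 ?powR_ge0 ?sqr_ge0. Qed.

Lemma ratio_bump_nincr k P t t' : 0 < P -> 0 < k <= 1 -> 0 < t -> t <= t' -> ratio_bump k P t' <= ratio_bump k P t.
Proof.
move=> P0 /andP[k0 k1] t0 tt; have t'0 := lt_le_trans t0 tt.
have h1 : 0 < P + t `^ k by rewrite addr_gt0 ?powR_gt0.
have h2 : 0 < P + t' `^ k by rewrite addr_gt0 ?powR_gt0.
rewrite /ratio_bump; apply: ler_pM.
- by apply: mulr_ge0; [exact: powR_ge0 | exact: sqr_ge0].
- by rewrite invr_ge0; exact: sqr_ge0.
- by apply: ler_wpM2r; [exact: sqr_ge0 | apply: powR_le0; rewrite ?subr_le0].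
rewrite lef_pV2 ?posrE ?exprn_gt0 // lerXn2r ?nnegrE ?(ltW h1) ?(ltW h2) //.
by rewrite lerD2l powR_ge0_le // ltW.
Qed.

Lemma continuous_ratio_bump k P x : 0 < P -> 0 < x -> {for x, continuous (ratio_bump k P)}.
Proof.
move=> P0 x0; have cp e : {for x, continuous (fun t : R => t `^ e)}.
  exact: continuous_derivable (is_derive1_powR e x0).
have h : P + x `^ k != 0 by rewrite gt_eqF // addr_gt0 ?powR_gt0.
apply: cvgM; first by apply: cvgM; [exact: cp | exact: cvg_cst].
apply: cvgV; first by rewrite expf_neq0.
by apply: cvgM; apply: cvgD; (exact: cvg_cst || exact: cp).
Qed.

(** The bump is the derivative of a multiple of [(P + v ^ k)^-1], which stays bounded even where
    [v ^ (k - 1)] blows up. As before, [K] shifts the primitive to nonnegative values. *)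
Lemma integral_ratio_bump_le (s c a b P k : R) : 0 < k -> 0 < P -> s != 0 -> a < b ->
  (forall x, a < x < b -> 0 < c + s * x) ->
  (\int[lam]_(x in `]a, b[) (ratio_bump k P (c + s * x))%:E <= (P / k / `|s|)%:E)%E.
Proof.
move=> k0 P0 s0 ab v0; pose v x := c + s * x.
have Pv x : a < x < b -> 0 < P + v x `^ k by move=> /v0 h; rewrite addr_gt0 ?powR_gt0.
pose K : R := if 0 < s then P / k / s else 0.
pose F := cst K + (- (P ^+ 2 / k / s)) \*: (fun x => (P + v x `^ k)^-1).
have FE x : F x = K - P ^+ 2 / k / s / (P + v x `^ k).
  by rewrite (_ : F x = K + (- (P ^+ 2 / k / s)) * (P + v x `^ k)^-1) //; ring.
have dF x : a < x < b -> is_derive x 1 F (ratio_bump k P (v x)).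
  move=> xab; have Pv0 : P + v x `^ k != 0 by rewrite gt_eqF // Pv.
  have d1 := is_deriveD (is_derive_cst P x 1) (is_derive_powR_affine k (v0 _ xab)).
  have d2 := is_deriveV (f := fun x => P + v x `^ k) Pv0 d1.
  have d3 : is_derive x 1 ((- (P ^+ 2 / k / s)) \*: (fun x => (P + v x `^ k)^-1))
     ((- (P ^+ 2 / k / s)) *: (- (P + v x `^ k) ^- 2 *: (0 + k * v x `^ (k - 1) * s))).
    exact: is_deriveZ.
  apply: (is_derive_eq (is_deriveD (is_derive_cst K x 1) d3)).
  change (0 + (- (P ^+ 2 / k / s)) * (- (P + v x `^ k) ^- 2 * (0 + k * v x `^ (k - 1) * s)) = ratio_bump k P (v x)).
  by rewrite /ratio_bump; field; rewrite s0 Pv0 gt_eqF.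
apply: (ge0_integral_derivative_le ab _ _ dF).
- by move=> x _; exact: ratio_bump_ge0.
- move=> x xab; apply: (@continuous_comp _ _ _ v (ratio_bump k P)).
    have h1 : is_derive x 1 (s \*: (@id R)) (s *: (1 : R)) by exact: is_deriveZ.
    exact: continuous_derivable (is_deriveD (is_derive_cst c x 1) h1).
  by apply: continuous_ratio_bump => //; exact: v0.
move=> x xab; have h0 := Pv x xab; have h1 := powR_ge0 (v x) k.
have Q0 : 0 <= P / (P + v x `^ k) by rewrite divr_ge0 ?ltW.
have Q1 : P / (P + v x `^ k) <= 1 by rewrite ler_pdivrMr // mul1r lerDl.
have -> : F x = K - P / k / s * (P / (P + v x `^ k)).
  by rewrite FE; field; rewrite s0 gt_eqF //= gt_eqF.
have Pk : 0 < P / k by rewrite divr_gt0.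
rewrite /K; case: ltP => ss.
  have Y : 0 < P / k / s by rewrite divr_gt0.
  rewrite gtr0_norm // -{1 3}[P / k / s]mulr1 -mulrBr; apply/andP; split.
    by rewrite mulr_ge0 ?subr_ge0 // ltW.
  by rewrite -[leRHS]mulr1 ler_pM2l // gerBl.
have {}ss : s < 0 by rewrite lt_neqAle s0.
have Y : 0 < P / k / `|s| by rewrite divr_gt0 // normr_gt0.
rewrite sub0r (_ : - _ = P / k / `|s| * (P / (P + v x `^ k))); last first.
  by rewrite ltr0_norm // invrN mulrN mulNr.
by rewrite mulr_ge0 ?(ltW Y) //= -[leRHS]mulr1 ler_pM2l.
Qed.

(** On a chord, [X ^ 2 - x ^ 2 = (X - |x|) * (X + |x|) >= (X - |x|) / 2] because [X >= 1 / 2]. The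
    bump being nonincreasing, each half of the chord reduces to an affine argument. *)
Lemma integral_circle_section_le (phi : R -> R) (A X P k : R) : 0 < k <= 1 -> 0 < P ->
  0 <= A -> 1 / 2 <= X -> measurable_fun setT phi -> (forall x, 0 <= phi x) ->
  (forall x : R, - X < x < X -> phi x <= A * ratio_bump k P (X ^+ 2 - x ^+ 2)) ->
  (\int[lam]_(x in `](- X)%R, X[) (phi x)%:E <= (A * (4 * P / k))%:E)%E.
Proof.
move=> k01 P0 A0 X2 mphi phi0 le; have /andP[k0 k1] := k01.
have XX : - X < X by lra.
have v1 (x : R) : - X < x < X -> 0 < X / 2 + (1 / 2) * x by move=> /andP[? ?]; lra.
have v2 (x : R) : - X < x < X -> 0 < X / 2 + (- (1 / 2)) * x by move=> /andP[? ?]; lra.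
have mb (s c : R) : (forall x : R, - X < x < X -> 0 < c + s * x) ->
    measurable_fun `](- X)%R, X[%classic (fun x => ratio_bump k P (c + s * x)).
  move=> v0; apply: open_continuous_measurable_fun; first exact: interval_open.
  move=> x /set_mem /=; rewrite in_itv /= => xab.
  apply: (@continuous_comp _ _ _ (fun x => c + s * x) (ratio_bump k P)).
    have h1 : is_derive x 1 (s \*: (@id R)) (s *: (1 : R)) by exact: is_deriveZ.
    exact: continuous_derivable (is_deriveD (is_derive_cst c x 1) h1).
  by apply: continuous_ratio_bump => //; exact: v0.
have B1 := integral_ratio_bump_le k0 P0 (_ : (1 / 2 : R) != 0) XX v1.
have B2 := integral_ratio_bump_le k0 P0 (_ : (- (1 / 2) : R) != 0) XX v2.
have n2 : (1 / 2 : R) != 0 by rewrite gt_eqF.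
have {}B1 := B1 n2; have {}B2 : (\int[lam]_(x in `](- X)%R, X[) (ratio_bump k P (X / 2 + (- (1 / 2)) * x))%:E <= (P / k / `|- (1 / 2)|)%:E)%E.
  by apply: B2; rewrite oppr_eq0.
have b0 x : (0 <= (ratio_bump k P x)%:E)%E by rewrite lee_fin ratio_bump_ge0.
apply: (@le_trans _ _ (\int[lam]_(x in `](- X)%R, X[)
   (A%:E * ((ratio_bump k P (X / 2 + (1 / 2) * x))%:E + (ratio_bump k P (X / 2 + (- (1 / 2)) * x))%:E)))%E).
  apply: ge0_le_integral => //.
  - by move=> x _; rewrite lee_fin.
  - by apply/measurable_EFinP; exact: measurable_funS mphi.
  - by apply: emeasurable_funM => //; apply: emeasurable_funD; apply/measurable_EFinP; exact: mb.
  move=> x; rewrite /= in_itv /= => xab; rewrite -EFinD -EFinM lee_fin.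
  apply: (le_trans (le _ xab)); rewrite ler_wpM2l //.
  have /andP[x1 x2] := xab; have [x0|x0] := leP 0 x.
    apply: (@le_trans _ _ (ratio_bump k P (X / 2 + (- (1 / 2)) * x))); last by rewrite lerDr ratio_bump_ge0.
    apply: ratio_bump_nincr => //; first exact: v2.
    rewrite (_ : X ^+ 2 - x ^+ 2 = (X - x) * (X + x)); last by ring.
    have : (X - x) * (1 / 2) <= (X - x) * (X + x) by apply: ler_wpM2l; lra.
    by lra.
  apply: (@le_trans _ _ (ratio_bump k P (X / 2 + (1 / 2) * x))); last by rewrite lerDl ratio_bump_ge0.
  apply: ratio_bump_nincr => //; first exact: v1.
  rewrite (_ : X ^+ 2 - x ^+ 2 = (X + x) * (X - x)); last by ring.
  have : (X + x) * (1 / 2) <= (X + x) * (X - x) by apply: ler_wpM2l; lra.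
  by lra.
rewrite ge0_integralZl //; last 2 first.
- by apply: emeasurable_funD; apply/measurable_EFinP; exact: mb.
- by move=> x _; rewrite adde_ge0.
rewrite ge0_integralD //; [|by apply/measurable_EFinP; exact: mb|by apply/measurable_EFinP; exact: mb].
rewrite EFinM lee_wpmul2l ?lee_fin //.
apply: (le_trans (leeD B1 B2)); rewrite -EFinD lee_fin normrN gtr0_norm //.
by rewrite le_eqVlt; apply/orP; left; apply/eqP; field; rewrite gt_eqF.
Qed.

End real_integrals.

(** * A distance factor times a bump, integrated over the disk *)

Section planar_bound.
Variable R : realType.
Local Notation lam := (@lebesgue_measure R).
Local Notation C := R[i].
Implicit Types (x y X T k M A : R).

Lemma measurable_shift_powR y0 T e : measurable_fun setT (fun y : R => (`|y - y0| + T) `^ e).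
Proof.
apply: (measurableT_comp (measurable_powR e)); apply: measurable_funD => //.
by apply: measurableT_comp => //; apply: measurable_funB.
Qed.

Lemma integral_shift_abs_le y0 T k : 0 < k -> 0 < T ->
  (\int[lam]_(y in `](-1)%R, 1%R[) ((`|y - y0| + T) `^ (- 1 - k))%:E <= (2 * T `^ (- k) / k)%:E)%E.
Proof.
(* The interval of radius [m] around [y0] covers []-1, 1[]. *)
move=> k0 T0; pose m := `|y0| + 1; pose g y := (`|y - y0| + T) `^ (- 1 - k).
have m0 : 0 < m by rewrite ltr_wpDl.
have mg D : measurable_fun D (EFin \o g).
  by apply/measurable_EFinP; apply: measurable_funS (measurable_shift_powR y0 T _).
have g0 x : (0 <= (g x)%:E)%E by rewrite lee_fin powR_ge0.
have ml : measurable `](y0 - m), y0[%classic by exact: measurable_itv.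
have mr : measurable `[y0, (y0 + m)[%classic by exact: measurable_itv.
apply: (@le_trans _ _ (\int[lam]_(y in `](y0 - m)%R, y0[ `|` `[y0, (y0 + m)%R[) (g y)%:E)%E).
  apply: ge0_subset_integral; [exact: measurable_itv|exact: measurableU|exact: mg|by move=> ? _; exact: g0|].
  move=> x xI; have /andP[x1 x2] : -1 < x < 1 by move: xI; rewrite /= in_itv.
  have := ler_norm y0; have := ler_norm (- y0); rewrite normrN => h1 h2.
  by case: (ltP x y0) => xy; [left|right]; rewrite /= in_itv /=; apply/andP; split => //; rewrite /m; lra.
rewrite ge0_integral_setU //; last 2 first.
- exact: mg.
- by apply/disj_setPS => x; rewrite /setI /= !in_itv /= => -[/andP[_ h1] /andP[h2 _]]; exfalso; lra.
rewrite (_ : 2 * T `^ (- k) / k = T `^ (- k) / k + T `^ (- k) / k); last by field; rewrite gt_eqF.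
rewrite EFinD; apply: leeD.
  rewrite [leLHS](_ : _ = (\int[lam]_(y in `](y0 - m)%R, y0[) ((-1 * (y - y0) + T) `^ (- 1 - k))%:E)%E); last first.
    apply: eq_integral => y /set_mem /=; rewrite in_itv /= => /andP[_ yy]; rewrite /g ltr0_norm ?subr_lt0 //.
    by rewrite mulN1r.
  apply: integral_powR_shift_le => //; rewrite ?normrN1 //; first lra.
  by move=> y /andP[_ yy]; lra.
rewrite -(@integral_itv_obnd_cbnd _ y0); last exact: mg.
rewrite [leLHS](_ : _ = (\int[lam]_(y in `]y0, (y0 + m)%R[) ((1 * (y - y0) + T) `^ (- 1 - k))%:E)%E); last first.
  apply: eq_integral => y /set_mem /=; rewrite in_itv /= => /andP[yy _]; rewrite /g gtr0_norm ?subr_gt0 //.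
  by rewrite mul1r.
apply: integral_powR_shift_le => //; rewrite ?normr1 //; first lra.
by move=> y /andP[yy _]; lra.
Qed.

(** Where [y ^ 2 <= 1 / 2] the chord has half-length at least 1/2. The inner integral yields a
    multiple of [T ^ k], the outer one a multiple of [T ^ (- k)], and the bound is free of [T]. *)
Lemma iterated_le (Psi : R -> R -> R) (A T k y0 : R) : 0 < k <= 1 -> 0 < T -> 0 <= A ->
  (forall y x, 0 <= Psi y x) ->
  (forall y, measurable_fun setT (Psi y)) ->
  measurable_fun setT (fun y => \int[lam]_x (Psi y x)%:E)%E ->
  (forall y x, ~~ (x ^+ 2 + y ^+ 2 < 1) || ~~ (y ^+ 2 <= 1 / 2) -> Psi y x = 0) ->
  (forall y x, x ^+ 2 + y ^+ 2 < 1 -> Psi y x <=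
     A * (`|y - y0| + T) `^ (- 1 - k) * ratio_bump k (T `^ k) (1 - (x ^+ 2 + y ^+ 2))) ->
  (\int[lam]_y \int[lam]_x (Psi y x)%:E <= (A * (8 / k ^+ 2))%:E)%E.
Proof.
move=> k01 T0 A0 P0 mP mI sup bd; have /andP[k0 k1] := k01.
have Tk0 : 0 < T `^ k by rewrite powR_gt0.
pose g y := (`|y - y0| + T) `^ (- 1 - k).
have g0 y : 0 <= g y by exact: powR_ge0.
pose B := A * (4 * T `^ k / k).
have B0 : 0 <= B by rewrite mulr_ge0 // divr_ge0 ?mulr_ge0 ?(ltW k0) ?(ltW Tk0).
have inner y : y ^+ 2 <= 1 / 2 -> (\int[lam]_x (Psi y x)%:E <= (B * g y)%:E)%E.
  move=> y2; pose X := Num.sqrt (1 - y ^+ 2).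
  have XX : X ^+ 2 = 1 - y ^+ 2 by rewrite sqr_sqrtr //; lra.
  have X0 : 0 <= X by exact: sqrtr_ge0.
  have X2 : 1 / 2 <= X.
    rewrite -(@ler_pXn2r _ 2) ?nnegrE ?divr_ge0 // XX; lra.
  have inX x : (- X < x < X) = (x ^+ 2 + y ^+ 2 < 1).
    rewrite -ltr_norml -(@ltr_pXn2r _ 2) ?nnegrE // real_normK ?num_real // XX.
    by rewrite ltrBrDr.
  rewrite (_ : (\int[lam]_x (Psi y x)%:E)%E = (\int[lam]_(x in `](- X)%R, X[) (Psi y x)%:E)%E); last first.
    rewrite [RHS]integral_mkcond; apply: eq_integral => x _; rewrite patchE.
    case: ifPn => // /negP; rewrite inE /= in_itv /= inX => /negP h.
    by rewrite sup // h.
  rewrite (_ : B * g y = (A * g y) * (4 * T `^ k / k)); last by rewrite /B; ring.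
  apply: integral_circle_section_le => //; first by rewrite mulr_ge0.
  by move=> x; rewrite inX => h; rewrite XX -addrA -opprD (addrC (y ^+ 2)); exact: bd.
have outer y : ~~ (y ^+ 2 <= 1 / 2) -> (\int[lam]_x (Psi y x)%:E = 0)%E.
  by move=> h; apply: integral0_eq => x _; rewrite sup // h orbT.
have y1 (y : R) : y ^+ 2 <= 1 / 2 -> -1 < y < 1.
  move=> h; rewrite -ltr_norml -(@ltr_pXn2r _ 2) ?nnegrE // real_normK ?num_real // expr1n; lra.
have I0 y : (0 <= \int[lam]_x (Psi y x)%:E)%E by apply: integral_ge0 => x _; rewrite lee_fin.
apply: (@le_trans _ _ (\int[lam]_(y in `](-1)%R, 1%R[) (B%:E * (g y)%:E))%E).
  rewrite (_ : (\int[lam]_y \int[lam]_x (Psi y x)%:E)%E =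
     (\int[lam]_(y in `](-1)%R, 1%R[) \int[lam]_x (Psi y x)%:E)%E); last first.
    rewrite [RHS]integral_mkcond; apply: eq_integral => y _; rewrite patchE.
    case: ifPn => // /negP; rewrite inE /= in_itv /= => h; apply: outer.
    by apply/negP => /y1.
  apply: ge0_le_integral => //.
  - exact: measurable_funS mI.
  - by apply: emeasurable_funM => //; apply/measurable_EFinP; exact: measurable_funS (measurable_shift_powR y0 T _).
  - move=> y _; case: (boolP (y ^+ 2 <= 1 / 2)) => h; first by rewrite -EFinM inner.
    by rewrite outer // -EFinM lee_fin mulr_ge0.
rewrite ge0_integralZl //; last 2 first.
- by apply/measurable_EFinP; exact: measurable_funS (measurable_shift_powR y0 T _).
- by move=> y _; rewrite lee_fin.
apply: (le_trans (lee_wpmul2l _ (integral_shift_abs_le y0 k0 T0))); first by rewrite lee_fin.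
rewrite -EFinM lee_fin /B powRN le_eqVlt; apply/orP; left; apply/eqP; field.
by rewrite !gt_eqF.
Qed.

(** Short chords escape the estimate, so the part of the disk with [y ^ 2 <= 1 / 2] is integrated
    along horizontal chords and the part with [x ^ 2 <= 1 / 2] along vertical ones; together they
    cover the disk. In each case [|z - w|] is bounded below by the coordinate left for the outer
    integral. *)
Lemma planar_bound (Phi : C -> R) (A T k : R) (w : C) : 0 < k <= 1 -> 0 < T -> 0 <= A ->
  (forall z, normc z < 1 -> 0 <= Phi z) ->
  measurable_fun (@diskp R) (fun p => Phi (plane_pt p)) ->
  (forall z, normc z < 1 -> Phi z <= A * (normc (z - w) + T) `^ (- 1 - k) * ratio_bump k (T `^ k) (tw z)) ->
  (\int[area R]_(p in @diskp R) (Phi (plane_pt p))%:E <= (A * (16 / k ^+ 2))%:E)%E.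
Proof.
move=> k01 T0 A0 P0 mP bd; have /andP[k0 k1] := k01.
have n2 x y : normc (x +i* y) ^+ 2 = x ^+ 2 + y ^+ 2.
  by rewrite /= sqr_sqrtr // addr_ge0 ?sqr_ge0.
have nd x y : (normc (x +i* y) < 1) = (x ^+ 2 + y ^+ 2 < 1).
  by rewrite -n2 -(@ltr_pXn2r _ 2 _ (normc _)) ?nnegrE ?normc_ge0 // expr1n.
have mD : measurable (@diskp R) by exact: measurable_disk.
have h2 (t : R) : measurable [set s : R | s ^+ 2 <= t].
  rewrite (_ : [set _ | _] = (fun s : R => s ^+ 2) @^-1` `]-oo, t]); last first.
    by apply/seteqP; split => s /=; rewrite in_itv.
  rewrite -[X in measurable X]setTI; exact: measurable_funX.
pose H1 : set (plane R) := [set p | p.2 ^+ 2 <= 1 / 2].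
pose H2 : set (plane R) := [set p | p.1 ^+ 2 <= 1 / 2].
have mH1 : measurable H1.
  by rewrite (_ : H1 = setT `*` [set s : R | s ^+ 2 <= 1 / 2]); [apply: measurableX => //; exact: h2|apply/seteqP; split => p //= []].
have mH2 : measurable H2.
  by rewrite (_ : H2 = [set s : R | s ^+ 2 <= 1 / 2] `*` setT); [apply: measurableX => //; exact: h2|apply/seteqP; split => p //= []].
pose Psi H := (fun p : plane R => Phi (plane_pt p)) \_ (@diskp R `&` H).
have Psi0 H p : 0 <= Psi H p.
  by rewrite /Psi patchE; case: ifP => // /set_mem[] /P0.
have mPsi H : measurable H -> measurable_fun setT (Psi H).
  move=> mH; apply/(measurable_restrictT _ _).1; first exact: measurableI.
  by apply: measurable_funS mP => //; exact: subIsetl.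
have PsiE H : (\int[area R]_(p in @diskp R `&` H) (Phi (plane_pt p))%:E = \int[area R]_p (Psi H p)%:E)%E.
  by rewrite integral_mkcond; apply: eq_integral => p _; rewrite /Psi !patchE; case: ifP.
have Psi_out H p : ~ (diskp p /\ H p) -> Psi H p = 0.
  by move=> h; rewrite /Psi patchE; case: ifP => // /set_mem.
have Psi_le H x y : x ^+ 2 + y ^+ 2 < 1 -> Psi H (x, y) <=
    A * (normc (x +i* y - w) + T) `^ (- 1 - k) * ratio_bump k (T `^ k) (1 - (x ^+ 2 + y ^+ 2)).
  move=> xy; rewrite /Psi patchE; case: ifP => _.
    by rewrite -n2 -/(tw _); apply: bd; rewrite nd.
  by apply: mulr_ge0; [apply: mulr_ge0 => //; exact: powR_ge0 | exact: ratio_bump_ge0].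
have mono (u v : R) : 0 <= u -> u <= v -> (v + T) `^ (- 1 - k) <= (u + T) `^ (- 1 - k).
  by move=> u0 uv; apply: powR_le0; lra.
have I1 : (\int[area R]_(p in @diskp R `&` H1) (Phi (plane_pt p))%:E <= (A * (8 / k ^+ 2))%:E)%E.
  rewrite PsiE (fubini_tonelli2 (EFin \o Psi H1)); last 2 first.
  - by apply/measurable_EFinP; exact: mPsi.
  - by move=> p; rewrite lee_fin.
  apply: (@iterated_le (fun y x => Psi H1 (x, y)) A T k (complex.Im w)) => //.
  - by move=> y; apply: measurableT_comp (mPsi _ mH1) _.
  - apply: (measurable_fun_fubini_tonelli_G (EFin \o Psi H1)).
      by apply/measurable_EFinP; exact: mPsi.
    by move=> p; rewrite lee_fin.
  - move=> y x h; apply: Psi_out => -[d1 d2]; move: h; rewrite -nd.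
    by rewrite [_ < _]d1 [_ <= _]d2.
  - move=> y x xy; apply: (le_trans (Psi_le _ _ _ xy)).
    rewrite ler_wpM2r ?ratio_bump_ge0 // ler_wpM2l // mono //.
    by have := normc_Im (x +i* y - w); rewrite raddfB.
have I2 : (\int[area R]_(p in @diskp R `&` H2) (Phi (plane_pt p))%:E <= (A * (8 / k ^+ 2))%:E)%E.
  rewrite PsiE (fubini_tonelli1 (EFin \o Psi H2)); last 2 first.
  - by apply/measurable_EFinP; exact: mPsi.
  - by move=> p; rewrite lee_fin.
  apply: (@iterated_le (fun x y => Psi H2 (x, y)) A T k (complex.Re w)) => //.
  - by move=> x; apply: measurableT_comp (mPsi _ mH2) _.
  - apply: (measurable_fun_fubini_tonelli_F (EFin \o Psi H2)).
      by apply/measurable_EFinP; exact: mPsi.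
    by move=> p; rewrite lee_fin.
  - move=> x y h; apply: Psi_out => -[d1 d2]; move: h; rewrite addrC -nd.
    by rewrite [_ < _]d1 [_ <= _]d2.
  - move=> x y xy; rewrite addrC in xy; rewrite (addrC (y ^+ 2)); apply: (le_trans (Psi_le _ _ _ xy)).
    rewrite ler_wpM2r ?ratio_bump_ge0 // ler_wpM2l // mono //.
    by have := normc_Re (x +i* y - w); rewrite raddfB.
rewrite (_ : A * (16 / k ^+ 2) = A * (8 / k ^+ 2) + A * (8 / k ^+ 2)); last by field; rewrite gt_eqF.
rewrite EFinD; apply: le_trans (leeD I1 I2); rewrite !PsiE -ge0_integralD //; last 4 first.
- by move=> p _; rewrite lee_fin.
- by apply/measurable_EFinP; exact: mPsi.
- by move=> p _; rewrite lee_fin.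
- by apply/measurable_EFinP; exact: mPsi.
rewrite integral_mkcond; apply: ge0_le_integral => //.
- by move=> p _; rewrite patchE; case: ifP => // /set_mem h; rewrite lee_fin P0.
- apply/(measurable_restrictT _ _).1 => //; exact/measurable_EFinP.
- by apply: emeasurable_funD; apply/measurable_EFinP; exact: mPsi.
move=> p _; rewrite patchE; case: ifP => [/set_mem dp|_]; last by rewrite -EFinD lee_fin addr_ge0.
rewrite -EFinD lee_fin.
have : H1 p \/ H2 p.
  case: p dp => x y; rewrite /diskp /= /disk /= nd /H1 /H2 /= => xy.
  by case: (leP (y ^+ 2) (1 / 2)) => hy; [left | right; lra].
move=> [hp|hp].
  by rewrite {1}/Psi patchE mem_set // lerDl.
by rewrite [Psi H2 p]/Psi patchE [p \in _]mem_set // lerDr.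
Qed.

End planar_bound.

Section forelli_rudin.
Variable R : realType.
Local Notation C := R[i].
Implicit Types (z w : C) (nu : radial_weight R).

Lemma powRDp (x r s : R) : 0 < x -> x `^ (r + s) = x `^ r * x `^ s.
Proof. by move=> x0; rewrite powRD //; apply/implyP => _; rewrite gt_eqF. Qed.

Lemma powR_div (x y r : R) : 0 < x -> 0 < y -> (x / y) `^ r = x `^ r / y `^ r.
Proof.
move=> x0 y0; rewrite powRM ?invr_ge0 ?ltW //; congr (_ * _).
by rewrite -(powR_inv1 (ltW y0)) -powRrM mulN1r powRN.
Qed.

Lemma tw_mono z w : normc z <= normc w -> tw w <= tw z.
Proof. by move=> zw; rewrite /tw lerB // lerXn2r ?nnegrE ?normc_ge0. Qed.

Lemma weight_ratio_incr nu beta : normal_exponent nu beta -> exists2 c : R, 0 < c &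
  forall z w, normc z < 1 -> normc w <= normc z -> nu w <= c * nu z * (tw w / tw z) `^ beta.
Proof.
move=> [b0 [c c0 H]]; exists c => // z w z1 wz; have w1 := le_lt_trans wz z1.
have t0 := tw_gt0 z1; have T0 := tw_gt0 w1.
have := H _ _ (normc_ge0 w) wz z1; rewrite -!weight_radial // -/(tw w) -/(tw z).
rewrite ler_pdivrMr ?powR_gt0 // powR_div //.
by move=> h; apply: (le_trans h); rewrite le_eqVlt; apply/orP; left; apply/eqP; ring.
Qed.

Lemma weight_ratio_decr nu gamma :
  almost_decreasing (fun r => nu r%:C / (1 - r ^+ 2) `^ gamma) -> exists2 c : R, 0 < c &
  forall z w, normc w < 1 -> normc z <= normc w -> nu w <= c * nu z * (tw w / tw z) `^ gamma.
Proof.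
move=> [c c0 H]; exists c => // z w w1 zw; have z1 := le_lt_trans zw w1.
have t0 := tw_gt0 z1; have T0 := tw_gt0 w1.
have := H _ _ (normc_ge0 z) zw w1; rewrite -!weight_radial // -/(tw w) -/(tw z).
rewrite ler_pdivrMr ?powR_gt0 // powR_div //.
by move=> h; apply: (le_trans h); rewrite le_eqVlt; apply/orP; left; apply/eqP; ring.
Qed.

Lemma ker_denom_sqr z w : normc (1 - conjc z * w) ^+ 2 = normc (z - w) ^+ 2 + tw z * tw w.
Proof.
case: z w => [a b] [c d]; rewrite /tw /= ?mulN1r !sqr_sqrtr ?addr_ge0 ?sqr_ge0 //.
by ring.
Qed.

Lemma ker_denom_ge_dist z w : normc z < 1 -> normc w < 1 -> normc (z - w) <= normc (1 - conjc z * w).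
Proof.
move=> z1 w1; rewrite -(@ler_pXn2r _ 2) ?nnegrE ?normc_ge0 // ker_denom_sqr lerDl.
by rewrite mulr_ge0 ?ltW ?tw_gt0.
Qed.

Lemma ker_denom_ge_tw z w : normc z < 1 -> normc w < 1 ->
  tw z / 2 <= normc (1 - conjc z * w) /\ tw w / 2 <= normc (1 - conjc z * w).
Proof.
move=> z1 w1; have h := ker_denom_ge z w; have nz := normc_ge0 z; have nw := normc_ge0 w.
have := tw_le (ltW z1); have := tw_le (ltW w1); split; nra.
Qed.

Lemma continuous_tw z : {for z, continuous (@tw R)}.
Proof.
apply: (@continuous_comp C R R (@normc R) (fun t => 1 - t ^+ 2) z).
  exact: normc_continuous.
by apply: cvgB; [exact: cvg_cst | exact: exprn_continuous].
Qed.

Lemma continuous_powR (e x : R) : 0 < x -> {for x, continuous (fun t : R => t `^ e)}.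
Proof. by move=> x0; exact: continuous_derivable (is_derive1_powR e x0). Qed.

Lemma continuous_ker_denom z w : {for z, continuous (fun z => normc (1 - conjc z * w))}.
Proof.
have d : wd (fun z => 1 - conjc z * w) z 0 (- w).
  by apply: (wd_eq (wdD (wd_cst 1 z) (wdM (wdM (wd_cst (-1) z) (wd_conj z)) (wd_cst w z)))) => [?||]; ring.
apply: (@continuous_comp C C R _ (@normc R) z); first exact: wd_continuous d.
exact: normc_continuous.
Qed.

Lemma continuous_disk_measurable (F : C -> R) :
  (forall z, normc z < 1 -> {for z, continuous F}) ->
  measurable_fun (@diskp R) (fun p => F (plane_pt p)).
Proof.
move=> cF; apply: (@nopen_rcont_measurable R (@disk R) F); first exact: nopen_disk.
by move=> z z1; apply: continuous_rcont; exact: cF.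
Qed.

Lemma continuous_weight nu z : normc z < 1 -> {for z, continuous nu}.
Proof. by move=> z1; apply: (weight_continuous (r := nu)); rewrite inE. Qed.

Definition fr_kernel nu (a : R) w z : R :=
  tw z `^ a / nu z * normc (1 - conjc z * w) `^ (- (a + 2)).

Lemma fr_kernel_ge0 nu a w z : normc z < 1 -> 0 <= fr_kernel nu a w z.
Proof.
move=> z1; rewrite mulr_ge0 ?powR_ge0 // divr_ge0 ?powR_ge0 //.
by apply: ltW; exact: weight_gt0.
Qed.

Lemma continuous_fr_kernel nu a w z : normc z < 1 -> normc w < 1 ->
  {for z, continuous (fr_kernel nu a w)}.
Proof.
move=> z1 w1.
have c1 : {for z, continuous (fun z => tw z `^ a)}.
  apply: (@continuous_comp C R R (@tw R) (fun t => t `^ a) z); first exact: continuous_tw.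
  by apply: continuous_powR; exact: tw_gt0.
have c2 : {for z, continuous (fun z => (nu z)^-1)}.
  apply: (@continuous_comp C R R nu (fun t => t^-1) z); first exact: continuous_weight.
  by apply: inv_continuous; rewrite gt_eqF // weight_gt0.
have c3 : {for z, continuous (fun z => normc (1 - conjc z * w) `^ (- (a + 2)))}.
  apply: (@continuous_comp C R R _ (fun t => t `^ (- (a + 2))) z); first exact: continuous_ker_denom.
  by apply: continuous_powR; exact: ker_denom_gt0 (ltW z1) w1.
exact: (cvgM (cvgM c1 c2) c3).
Qed.

Lemma fr_kernel_measurable nu a w : normc w < 1 ->
  measurable_fun (@diskp R) (fun p => fr_kernel nu a w (plane_pt p)).
Proof.
by move=> w1; apply: continuous_disk_measurable => z z1; exact: continuous_fr_kernel.
Qed.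

Lemma ratio_bump_lower (k t T : R) : 0 < k -> 0 < t -> 0 < T ->
  (t <= T -> t `^ (k - 1) <= 4 * ratio_bump k (T `^ k) t) /\
  (T <= t -> T `^ (2 * k) * t `^ (- 1 - k) <= 4 * ratio_bump k (T `^ k) t).
Proof.
move=> k0 t0 T0; have tk := powR_gt0 k t0; have Tk := powR_gt0 k T0.
have s0 : 0 < (T `^ k + t `^ k) ^+ 2 by rewrite exprn_gt0 // addr_gt0.
have E (x : R) : (x <= 4 * ratio_bump k (T `^ k) t) =
    (x * (T `^ k + t `^ k) ^+ 2 <= t `^ (k - 1) * (2 * T `^ k) ^+ 2).
  rewrite (_ : 4 * _ = t `^ (k - 1) * (2 * T `^ k) ^+ 2 / (T `^ k + t `^ k) ^+ 2).
    by rewrite ler_pdivlMr.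
  by rewrite /ratio_bump; ring.
split => h; rewrite E.
  have h2 : t `^ k <= T `^ k by apply: powR_ge0_le => //; exact: ltW.
  by apply: ler_wpM2l; [exact: powR_ge0 | apply: lerXn2r; rewrite ?nnegrE; lra].
have h2 : T `^ k <= t `^ k by apply: powR_ge0_le => //; exact: ltW.
have h3 : (T `^ k + t `^ k) ^+ 2 <= (2 * t `^ k) ^+ 2.
  by apply: lerXn2r; rewrite ?nnegrE; lra.
rewrite [2 * k]mulr_natl mulr2n (powRDp k k T0) (_ : k - 1 = (- 1 - k) + k + k); last by ring.
rewrite (powRDp _ k t0) (powRDp _ k t0); set u := t `^ (- 1 - k); have u0 : 0 < u by rewrite powR_gt0.
apply: (@le_trans _ _ (T `^ k * T `^ k * u * (2 * t `^ k) ^+ 2)).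
  by rewrite ler_wpM2l // !mulr_ge0 // ltW.
by rewrite le_eqVlt; apply/orP; left; apply/eqP; ring.
Qed.

(** With [d = |1 - conj z * w|], the power [d ^ -(a + 2)] is split as [d ^ (-1 - k) * d ^ (- e)].
    The first factor is compared with [|z - w| + tw w], the second with the larger of [tw z] and
    [tw w]; condition (I) if [z] is the outer point, (II) if [w] is, then brings the ratio of the
    weights into the form of [ratio_bump]. *)
Theorem forelli_rudin nu (a beta gamma : R) : normal_exponent nu beta -> 0 < gamma ->
  almost_decreasing (fun r => nu r%:C / (1 - r ^+ 2) `^ gamma) -> beta - 1 < a ->
  exists2 K : R, 0 < K & forall w, normc w < 1 ->
    (\int[area R]_(p in @diskp R) (fr_kernel nu a w (plane_pt p))%:E <= (K / nu w)%:E)%E.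
Proof.
move=> nb g0 ng ba; have b0 : 0 < beta by case: nb.
have [c1 c10 H1] := weight_ratio_incr nb; have [c2 c20 H2] := weight_ratio_decr ng.
(* The bound [k <= a + 1 - beta] gives [beta <= e] for (I), the bound [k <= gamma / 2] gives
   [2 * k <= gamma] for (II), and [k <= 1] is the range in which the bump is nonincreasing. *)
pose k := Num.min 1 (Num.min (a + 1 - beta) (gamma / 2)).
have k0 : 0 < k by rewrite !lt_min ltr01 divr_gt0 //= subr_gt0 andbT; lra.
have k1 : k <= 1 by rewrite ge_min lexx.
have k2 : k <= a + 1 - beta by rewrite !ge_min lexx orbT.
have k3 : k <= gamma / 2 by rewrite !ge_min lexx !orbT.
pose e := a + 1 - k; have eb : beta <= e by rewrite /e; lra.
have e0 : 0 < e by lra.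
(* As [d] is at least [|z - w|] and [tw w / 2], it is at least a third of [|z - w| + tw w]; the
   factor 1/2 comes from [s / 2 <= d] for [s] either of [tw z], [tw w]. *)
pose q : R := (1 / 3) `^ (- 1 - k) * (1 / 2) `^ (- e).
have q0 : 0 < q by rewrite mulr_gt0 ?powR_gt0 // divr_gt0.
pose c := c1 + c2; have c0 : 0 < c by rewrite addr_gt0.
pose K := q * (c * 4); have K0 : 0 < K by rewrite !mulr_gt0.
exists (K * (16 / k ^+ 2)) => [|w w1].
  by rewrite mulr_gt0 // divr_gt0 // exprn_gt0.
have T0 := tw_gt0 w1; have nw0 : 0 < nu w by rewrite weight_gt0.
rewrite mulrAC; apply: (@planar_bound R _ _ (tw w) k w) => //.
- by rewrite k0.
- by rewrite divr_ge0 // ltW.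
- by move=> z z1; exact: fr_kernel_ge0.
- exact: fr_kernel_measurable.
move=> z z1; have t0 := tw_gt0 z1; have nz0 : 0 < nu z by rewrite weight_gt0.
have [dt dT] := ker_denom_ge_tw z1 w1; have dd := ker_denom_ge_dist z1 w1.
rewrite /fr_kernel; set d := normc (1 - _) in dt dT dd *; set t := tw z in t0 dt *; set T := tw w in T0 dT *.
have d0 : 0 < d by apply: lt_le_trans dt; rewrite divr_gt0.
set D := normc (z - w) + T; have D0 : 0 < D by rewrite ltr_wpDl ?normc_ge0.
have -> : - (a + 2) = (- 1 - k) + (- e) by rewrite /e; ring.
rewrite powRDp //.
have A1 : d `^ (- 1 - k) <= (1 / 3) `^ (- 1 - k) * D `^ (- 1 - k).
  by rewrite -powRM ?divr_ge0 ?(ltW D0) //; apply: powR_le0; rewrite ?mulr_gt0 ?divr_gt0 //; rewrite /D; lra.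
have A2 s : 0 < s -> s / 2 <= d -> d `^ (- e) <= (1 / 2) `^ (- e) * s `^ (- e).
  move=> s0 sd; rewrite -powRM ?divr_ge0 ?(ltW s0) //; apply: powR_le0; rewrite ?oppr_le0 ?(ltW e0) ?mulr_gt0 ?divr_gt0 //.
  by rewrite mulrC mulrA mulr1.
have [B1 B2] := ratio_bump_lower k0 t0 T0.
suff A3 : nu w / nu z * t `^ a * d `^ (- e) <= (1 / 2) `^ (- e) * (c * (4 * ratio_bump k (T `^ k) t)).
  rewrite (_ : K / nu w * _ * _ = ((1 / 3) `^ (- 1 - k) * D `^ (- 1 - k)) *
    ((1 / 2) `^ (- e) * (c * (4 * ratio_bump k (T `^ k) t)) / nu w)); last by rewrite /K /q; ring.
  rewrite (_ : _ * (_ * _) = d `^ (- 1 - k) * ((nu w / nu z * t `^ a * d `^ (- e)) / nu w)); last first.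
    by field; rewrite !gt_eqF.
  apply: ler_pM; rewrite ?powR_ge0 //; last by rewrite ler_pM2r ?invr_gt0.
  by rewrite !mulr_ge0 ?invr_ge0 ?powR_ge0 // ltW.
have main (r c' s : R) : 0 < c' -> c' <= c -> 0 < s -> s / 2 <= d -> nu w <= c' * nu z * (T / t) `^ r ->
    (T / t) `^ r * t `^ a * s `^ (- e) <= 4 * ratio_bump k (T `^ k) t ->
    nu w / nu z * t `^ a * d `^ (- e) <= (1 / 2) `^ (- e) * (c * (4 * ratio_bump k (T `^ k) t)).
  move=> c'0 c'c s0 sd hn hb.
  apply: (@le_trans _ _ ((c' * (T / t) `^ r) * t `^ a * ((1 / 2) `^ (- e) * s `^ (- e)))).
    apply: ler_pM; rewrite ?mulr_ge0 ?powR_ge0 ?invr_ge0 ?(ltW nw0) ?(ltW nz0) //; last exact: A2.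
    by rewrite ler_wpM2r ?powR_ge0 // ler_pdivrMr // mulrAC.
  rewrite (_ : _ * _ * _ = (1 / 2) `^ (- e) * (c' * ((T / t) `^ r * t `^ a * s `^ (- e)))); last by ring.
  rewrite ler_wpM2l ?powR_ge0 //; apply: ler_pM; rewrite ?(ltW c'0) //.
  by rewrite !mulr_ge0 ?powR_ge0.
have Tt0 : 0 < T / t by rewrite divr_gt0.
have Ttp r : (T / t) `^ r = T `^ r * t `^ (- r).
  by rewrite powR_div // powRN.
have [wz|/ltW zw] := leP (normc w) (normc z).
  have tT : t <= T by exact: tw_mono.
  apply: (main beta c1 T) => //; first by rewrite /c; lra.
    exact: H1.
  apply: le_trans (B1 tT).
  apply: (@le_trans _ _ ((T / t) `^ e * t `^ a * T `^ (- e))).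
    by rewrite !ler_wpM2r ?powR_ge0 // ler_powR // ler_pdivlMr // mul1r.
  rewrite Ttp (_ : k - 1 = - e + a); last by rewrite /e; ring.
  rewrite (powRDp (- e) a t0) [T `^ (- e)]powRN.
  have TE : T `^ e != 0 by rewrite gt_eqF // powR_gt0.
  by rewrite le_eqVlt; apply/orP; left; apply/eqP; field.
have Tt : T <= t by exact: tw_mono.
apply: (main gamma c2 t) => //; first by rewrite /c; lra.
  exact: H2.
apply: le_trans (B2 Tt).
apply: (@le_trans _ _ ((T / t) `^ (2 * k) * t `^ a * t `^ (- e))).
  rewrite !ler_wpM2r ?powR_ge0 // ger_powR ?Tt0 //=; first by rewrite ler_pdivrMr // mul1r.
  by lra.
rewrite Ttp (_ : - 1 - k = - (2 * k) + a + - e); last by rewrite /e; ring.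
by rewrite !powRDp // !mulrA.
Qed.

End forelli_rudin.

(** * Whitney cells of the disk *)

Section cells.
Variable R : realType.
Local Notation C := R[i].
Implicit Types (z w q : C) (n m K : nat).

Definition mesh n : R := (2 ^+ n)^-1.

Lemma mesh_gt0 n : 0 < mesh n. Proof. by rewrite invr_gt0 exprn_gt0. Qed.

Lemma meshS n : mesh n = 2 * mesh n.+1.
Proof. by rewrite /mesh exprS; field; rewrite expf_neq0. Qed.

Lemma mesh_small (e : R) : 0 < e -> exists n, mesh n < e.
Proof.
move=> e0; have [n Hn] := lt_expr2 e^-1; exists n.
by rewrite /mesh -[e]invrK ltf_pV2 ?posrE ?exprn_gt0 ?invr_gt0.
Qed.

Lemma mesh_mono n m : (n <= m)%N -> mesh m <= mesh n.
Proof.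
by move=> nm; rewrite /mesh lef_pV2 ?posrE ?exprn_gt0 // ler_weXn2l // ler1n.
Qed.

Definition idx n (x : R) : nat := Num.truncn (2 ^+ n * ((x + 1) / 2)).

Lemma idxP n (x : R) i : -1 < x -> (idx n x == i) =
  (-1 + 2 * i%:R * mesh n <= x < -1 + 2 * i%:R * mesh n + 2 * mesh n).
Proof.
move=> x1; have P0 : 0 < 2 ^+ n :> R by rewrite exprn_gt0.
rewrite /idx truncn_eq; last by rewrite mulr_ge0 ?ltW //; lra.
rewrite -natr1 /mesh; congr (_ && _).
  rewrite -(ler_pM2r (x := (2 ^+ n)^-1)) ?invr_gt0 // mulrC.
  rewrite (_ : 2 ^+ n * ((x + 1) / 2) / 2 ^+ n = (x + 1) / 2); last by field; rewrite gt_eqF.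
  by apply/idP/idP => h; lra.
rewrite -(ltr_pM2r (x := (2 ^+ n)^-1)) ?invr_gt0 //.
rewrite (_ : 2 ^+ n * ((x + 1) / 2) / 2 ^+ n = (x + 1) / 2); last by field; rewrite gt_eqF.
by apply/idP/idP => h; lra.
Qed.

Lemma idx_lt n (x : R) : -1 < x < 1 -> (idx n x < 2 ^ n)%N.
Proof.
move=> /andP[x1 x2]; rewrite /idx truncn_lt_nat //; last first.
  by rewrite mulr_ge0 ?exprn_ge0 //; lra.
by rewrite natrX gtr_pMr ?exprn_gt0 //; lra.
Qed.

Lemma idx_half n (x : R) : -1 < x -> idx n x = (idx n.+1 x)./2.
Proof.
move=> x1; apply/eqP; rewrite idxP //.
have /eqP := erefl (idx n.+1 x); rewrite idxP // (meshS n).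
move: (idx n.+1 x) => i; rewrite -{1 2}(odd_double_half i) -muln2 natrD natrM.
have := mesh_gt0 n.+1; move: (mesh n.+1) => h h0 /andP[h1 h2].
by case: (odd i) h1 h2 => /= h1 h2; apply/andP; split; nra.
Qed.

(* [code n z] numbers the dyadic square of generation [n] (side [2 * mesh n])
   containing [z]; it lies in [4 ^ n, 4 ^ n.+1[, so the generation can be read
   off by [lev]. *)
Definition code n z : nat :=
  (4 ^ n + (idx n (complex.Re z) * 2 ^ n + idx n (complex.Im z)))%N.

Lemma disk_ReIm z : disk z -> -1 < complex.Re z < 1 /\ -1 < complex.Im z < 1.
Proof.
move=> z1; rewrite -!ltr_norml.
by split; [exact: le_lt_trans (normc_Re z) z1 | exact: le_lt_trans (normc_Im z) z1].
Qed.

Lemma code_range n z : disk z -> (4 ^ n <= code n z < 4 ^ n.+1)%N.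
Proof.
move=> /disk_ReIm[/(idx_lt n) h1 /(idx_lt n) h2]; rewrite leq_addr /=.
rewrite (_ : 4 ^ n.+1 = 4 ^ n + 3 * 4 ^ n)%N; last by rewrite expnS; lia.
rewrite ltn_add2l (_ : 4 ^ n = 2 ^ n * 2 ^ n)%N; last by rewrite -expnMn.
by move: (2 ^ n)%N h1 h2 => P h1 h2; nia.
Qed.

Lemma code_inj n z z' : disk z -> disk z' -> code n z = code n z' ->
  idx n (complex.Re z) = idx n (complex.Re z') /\ idx n (complex.Im z) = idx n (complex.Im z').
Proof.
move=> /disk_ReIm[_ /(idx_lt n) h2] /disk_ReIm[_ /(idx_lt n) h2'] /addnI.
move=> e; have P0 : (0 < 2 ^ n)%N by rewrite expn_gt0.
have ej : idx n (complex.Im z) = idx n (complex.Im z').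
  by have := congr1 (modn^~ (2 ^ n)%N) e; rewrite !modnMDl !modn_small.
by split => //; move: e; rewrite ej => /addIn/eqP; rewrite eqn_pmul2r // => /eqP.
Qed.

Lemma code_par n z z' : disk z -> disk z' -> code n.+1 z = code n.+1 z' -> code n z = code n z'.
Proof.
move=> dz dz' /(code_inj dz dz')[e1 e2].
have [/andP[? _] /andP[? _]] := disk_ReIm dz; have [/andP[? _] /andP[? _]] := disk_ReIm dz'.
by rewrite /code !(idx_half n) // e1 e2.
Qed.

Lemma code_dist n z z' : disk z -> disk z' -> code n z = code n z' ->
  normc (z - z') <= 4 * mesh n.
Proof.
move=> dz dz' /(code_inj dz dz')[e1 e2].
have [/andP[? _] /andP[? _]] := disk_ReIm dz; have [/andP[? _] /andP[? _]] := disk_ReIm dz'.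
apply: le_trans (normc_ReIm _) _; rewrite !raddfB /=.
have /eqP : idx n (complex.Re z) = idx n (complex.Re z) by []; rewrite idxP // => /andP[a1 a2].
have /eqP := esym e1; rewrite idxP // => /andP[a3 a4].
have /eqP : idx n (complex.Im z) = idx n (complex.Im z) by []; rewrite idxP // => /andP[b1 b2].
have /eqP := esym e2; rewrite idxP // => /andP[b3 b4].
have : `|complex.Re z - complex.Re z'| <= 2 * mesh n by rewrite ler_norml; apply/andP; split; lra.
have : `|complex.Im z - complex.Im z'| <= 2 * mesh n by rewrite ler_norml; apply/andP; split; lra.
lra.
Qed.

Definition lev m := trunc_log 4 m.

Lemma lev_code n z : disk z -> lev (code n z) = n.
Proof. by move=> /(code_range n) h; apply: trunc_log_eq. Qed.

Definition cell m : set C := [set z | disk z /\ code (lev m) z = m].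

Lemma cell_code n z : disk z -> cell (code n z) z.
Proof. by move=> dz; split => //; rewrite lev_code. Qed.

(* [rep m = 0] when the cell is empty. *)
Definition rep m : C := xget 0 (cell m).

Lemma rep_disk m : disk (rep m).
Proof. by rewrite /rep; case: xgetP => [z _ []|_] //; exact: disk0. Qed.

Lemma cell_rep m z : cell m z -> cell m (rep m).
Proof. by move=> h; rewrite /rep; apply: xgetPex; exists z. Qed.

Lemma cell_dist m z : cell m z -> normc (z - rep m) <= 4 * mesh (lev m).
Proof.
move=> h; have [dz cz] := h; have [dr cr] := cell_rep h.
by apply: code_dist => //; rewrite cz cr.
Qed.

(** The predecessor truncates at generation 0, where the parent is again of generation 0 and hence
    bad by [code0_bad]. *)
Definition par m := code (lev m).-1 (rep m).

Lemma par_code n z : disk z -> par (code n.+1 z) = code n z.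
Proof.
move=> dz; rewrite /par lev_code //=; apply: code_par => //; first exact: rep_disk.
by have [_] := cell_rep (cell_code n.+1 dz); rewrite lev_code.
Qed.

(** The number 16 is four times the factor 4 that bounds the diameter in units of [mesh]: a good
    square lies inside the disk, and the kernels vary on it by a bounded factor. The first conjunct
    excludes empty cells, whose representative is the default 0. *)
Definition good m : bool := `[< cell m (rep m) >] && (16 * mesh (lev m) <= 1 - normc (rep m)).

Lemma good_cell m : good m -> cell m (rep m).
Proof. by move=> /andP[/asboolP]. Qed.

Lemma good_code n z : disk z -> good (code n z) = (16 * mesh n <= 1 - normc (rep (code n z))).
Proof.
move=> dz; rewrite /good lev_code //; case: asboolP => //= -[].
exact: cell_rep (cell_code n dz).
Qed.

Lemma code_rep_dist n z : disk z -> normc (z - rep (code n z)) <= 4 * mesh n.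
Proof. by move=> dz; have := cell_dist (cell_code n dz); rewrite lev_code. Qed.

Lemma normc_dist z w : normc z - normc w <= normc (z - w).
Proof. by apply: le_trans (normcB z w); exact: ler_norm. Qed.

(** Goodness refers to representatives, which change with the generation. Those of the two squares
    are at most [12 * mesh n.+1] apart, and [32 - 12] is still at least 16. *)
Lemma good_codeS n z : disk z -> good (code n z) -> good (code n.+1 z).
Proof.
move=> dz; rewrite !good_code //.
have := code_rep_dist n dz; have := code_rep_dist n.+1 dz.
have := normc_dist z (rep (code n z)); have := normc_dist (rep (code n.+1 z)) z.
by rewrite (normc_sub (rep _)) (meshS n); have := mesh_gt0 n.+1; lra.
Qed.

Lemma good_code_le n m z : disk z -> (n <= m)%N -> good (code n z) -> good (code m z).
Proof.
move=> dz nm; rewrite -(subnKC nm); elim: (m - n)%N => [|k IH]; first by rewrite addn0.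
by move=> /IH h; rewrite addnS; exact: good_codeS.
Qed.

Lemma good_code_mesh n z : disk z -> 20 * mesh n <= 1 - normc z -> good (code n z).
Proof.
move=> dz; rewrite good_code // => h; have := code_rep_dist n dz.
by have := normc_dist (rep (code n z)) z; rewrite (normc_sub (rep _)); lra.
Qed.

Lemma code0_bad z : disk z -> ~~ good (code 0 z).
Proof.
move=> dz; rewrite good_code // -ltNge /mesh expr0 invr1.
by have := normc_ge0 (rep (code 0 z)); lra.
Qed.

Lemma good_cell_dist m z : good m -> cell m z ->
  normc (z - rep m) <= 4 * mesh (lev m) /\ 12 * mesh (lev m) <= 1 - normc z.
Proof.
move=> /andP[_ h] cz; have d := cell_dist cz; split => //.
by have := normc_dist z (rep m); lra.
Qed.

(* The maximal good cells: a Whitney decomposition of the disk. *)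
Definition sel m := good m && ~~ good (par m).

Lemma sel_cell m z : sel m -> cell m z -> exists2 n, m = code n.+1 z & lev m = n.+1.
Proof.
move=> /andP[gm _] [dz cz]; have [cr _] := good_cell gm.
case E : (lev m) cz => [|n] cz; last by exists n.
by have := code0_bad dz; rewrite cz gm.
Qed.

(** With [h] the mesh of the square, its bad parent has a representative within [32 h] of the
    circle, and [z] is within [8 h] of that representative. *)
Lemma sel_mesh m z : sel m -> cell m z -> 1 - normc z <= 40 * mesh (lev m).
Proof.
move=> sm cz; have [n mE lE] := sel_cell sm cz; have [dz _] := cz.
move: sm => /andP[_]; rewrite mE par_code // good_code // -ltNge lev_code // => h.
have := code_rep_dist n dz; have := normc_dist (rep (code n z)) z.
by rewrite (normc_sub (rep _)); move: h; rewrite (meshS n); lra.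
Qed.

Lemma sel_exists z : disk z -> exists2 m, sel m & cell m z.
Proof.
move=> dz; have e : exists n, good (code n z).
  have [|n hn] := @mesh_small ((1 - normc z) / 20); first by rewrite divr_gt0 // subr_gt0.
  by exists n; apply: good_code_mesh => //; lra.
pose n := ex_minn e; have [gn minn] : good (code n z) /\ forall k, good (code k z) -> (n <= k)%N.
  by rewrite /n; case: ex_minnP.
case E : n gn minn => [|k] gn minn; first by have := code0_bad dz; rewrite gn.
exists (code k.+1 z); last exact: cell_code.
rewrite /sel gn par_code //=; apply/negP => /minn; by rewrite ltnn.
Qed.

Lemma sel_unique m m' z : sel m -> sel m' -> cell m z -> cell m' z -> m = m'.
Proof.
wlog le : m m' / (lev m <= lev m')%N => [H|] sm sm' cz cz'.
  have [h|/ltnW h] := leqP (lev m) (lev m'); first exact: (H m m').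
  by apply/esym; apply: (H m' m).
have [n mE lE] := sel_cell sm cz; have [n' mE' lE'] := sel_cell sm' cz'; have [dz _] := cz.
move: le; rewrite lE lE' ltnS leq_eqVlt => /orP[/eqP e|lt]; first by rewrite mE mE' e.
move: sm' => /andP[_]; rewrite mE' par_code // => /negP[].
by apply: (@good_code_le n.+1) => //; rewrite -mE; case/andP: sm.
Qed.

Lemma cell_box m z : cell m z -> exists a c : R,
  @plane_pt R @^-1` cell m = @diskp R `&` box a c (2 * mesh (lev m)).
Proof.
move=> [dz cz]; set n := lev m in cz *.
exists (-1 + 2 * (idx n (complex.Re z))%:R * mesh n), (-1 + 2 * (idx n (complex.Im z))%:R * mesh n).
have E p : diskp p -> box (-1 + 2 * (idx n (complex.Re z))%:R * mesh n) (-1 + 2 * (idx n (complex.Im z))%:R * mesh n) (2 * mesh n) p <->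
    idx n p.1 = idx n (complex.Re z) /\ idx n p.2 = idx n (complex.Im z).
  move=> dp; have [/andP[h1 _] /andP[h2 _]] := disk_ReIm dp.
  rewrite /box /= !in_itv /= -!idxP //.
  by split => -[/eqP ? /eqP ?].
apply/seteqP; split => [p [dp cp]|p [dp bp]]; split => //.
  by apply/(E p dp); apply: (code_inj dp dz); rewrite -/n in cp; rewrite cp cz.
have [e1 e2] := (E p dp).1 bp; transitivity (code n z) => //.
by rewrite /code -e1 -e2.
Qed.

Lemma measurable_cell m : measurable (@plane_pt R @^-1` cell m).
Proof.
have [[z cz]|h] := pselect (exists z, cell m z).
  have [a [c ->]] := cell_box cz; apply: measurableI; first exact: measurable_disk.
  exact: measurable_box.
rewrite (_ : _ @^-1` _ = set0) //; apply/seteqP; split => // p cp.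
by apply: h; exists (plane_pt p).
Qed.

Lemma area_cell m : good m -> ((4 * mesh (lev m) ^+ 2)%:E <= area R (@plane_pt R @^-1` cell m))%E.
Proof.
move=> gm; have cr := good_cell gm; have [a [c E]] := cell_box cr.
have h0 := mesh_gt0 (lev m).
have /andP[_ g16] := gm.
have rb : box a c (2 * mesh (lev m)) (complex.Re (rep m), complex.Im (rep m)).
  have : (@plane_pt R @^-1` cell m) (complex.Re (rep m), complex.Im (rep m)).
    by rewrite /= /plane_pt /=; case: (rep m) cr.
  by rewrite E => -[].
rewrite E (_ : _ `&` _ = box a c (2 * mesh (lev m))).
  have s0 : 0 <= 2 * mesh (lev m) by rewrite mulr_ge0 // ltW.
  by rewrite area_box // lee_fin exprMn -natrX.
(* Points of the box are within [4 * mesh] of the representative, which keeps a distance [16 * mesh]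
   from the circle. *)
apply/seteqP; split => [p []//|[x y] bp]; split => //.
move: bp rb; rewrite /box /= !in_itv /= => -[/andP[a1 a2] /andP[b1 b2]] [/andP[a3 a4] /andP[b3 b4]].
suff : normc (x +i* y) < 1 by [].
have := @square_dist R a c (2 * mesh (lev m)) (complex.Re (rep m)) (complex.Im (rep m)) x y.
move=> /(_ _ _ _ _); rewrite a1 a3 b1 b3 (ltW a2) (ltW a4) (ltW b2) (ltW b4).
move=> /(_ isT isT isT isT).
have -> : complex.Re (rep m) +i* complex.Im (rep m) = rep m by case: (rep m).
by have := normc_dist (x +i* y) (rep m); lra.
Qed.

(** Codes of generation [n] lie in [[4 ^ n, 4 ^ n.+1[], so a sum over integers runs through the
    generations in order, and each contributes the one square containing [z]. The index 0 is not a
    code. *)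
Lemma block_sum (V : zmodType) (F : nat -> V) z K : disk z ->
  \sum_(0 <= m < 4 ^ K) (if m == code (lev m) z then F m else 0) = \sum_(0 <= n < K) F (code n z).
Proof.
move=> dz; elim: K => [|K IH].
  by rewrite expn0 big_nat1 big_geq // /code /lev trunc_log0.
rewrite (big_cat_nat (n := 4 ^ K)) ?leq_exp2l //= IH big_nat_recr //=; congr (_ + _).
have [h1 h2] := andP (code_range K dz).
rewrite (big_cat_nat (n := code K z)) //=; last exact: ltnW.
rewrite big1_seq ?add0r; last first.
  move=> m /andP[_]; rewrite mem_index_iota => /andP[m1 m2]; rewrite ifF //.
  rewrite (_ : lev m = K); first by rewrite ltn_eqF.
  by apply: trunc_log_eq => //; rewrite m1 (ltn_trans m2).
rewrite big_ltn // lev_code // eqxx big1_seq ?addr0 // => m /andP[_].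
rewrite mem_index_iota => /andP[m1 m2]; rewrite ifF //.
rewrite (_ : lev m = K); first by rewrite gtn_eqF.
by apply: trunc_log_eq => //; rewrite m2 andbT (leq_trans h1) // ltnW.
Qed.

End cells.

(** * Kernel comparison and the reproducing formula in the growth space *)

Section kernels.
Variable R : realType.
Local Notation C := R[i].
Implicit Types (z w q : C) (nu : radial_weight R).

Lemma ker_denom_ge2 z w : normc z < 1 -> normc w <= 1 -> 1 - normc z <= normc (1 - conjc z * w).
Proof.
move=> z1 w1; apply: le_trans (ker_denom_ge z w); rewrite lerB //.
by rewrite ler_piMr ?normc_ge0.
Qed.

Lemma ker_denom_shift z q w : normc w <= 1 ->
  normc (1 - conjc z * w) <= normc (1 - conjc q * w) + normc (z - q).
Proof.
move=> w1; rewrite (_ : 1 - conjc z * w = (1 - conjc q * w) + conjc (q - z) * w); last first.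
  by rewrite rmorphB /=; ring.
apply: le_trans (normcD _ _) _; rewrite lerD2l (normcM (conjc _)) normc_conj (normc_sub q).
by rewrite ler_piMr ?normc_ge0.
Qed.

(** A move by a quarter of the distance to the circle changes the denominator at [q] by at most a
    quarter of itself, since [1 - |q|] bounds it from below. *)
Lemma ker_denom_compare z q w : normc q < 1 -> normc w <= 1 ->
  normc (z - q) <= (1 - normc q) / 4 ->
  normc (1 - conjc z * w) <= 2 * normc (1 - conjc q * w) /\
  normc (1 - conjc q * w) <= 2 * normc (1 - conjc z * w).
Proof.
move=> q1 w1 zq; have h1 := ker_denom_shift z q w1; have h2 := ker_denom_shift q z w1.
have h3 := ker_denom_ge2 q1 w1; rewrite (normc_sub q) in h2; split; lra.
Qed.

(** In [u - v = conj (q - q') * w * (u * v)] one inverse denominator is spent on [1 / (1 - |z|)] and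
    the other is kept towards [|ker M z w|]; induction on the exponent does the rest. *)
Lemma ker_diff M z q q' w : normc z < 1 -> normc q < 1 -> normc q' < 1 -> normc w < 1 ->
  normc (1 - conjc z * w) <= 2 * normc (1 - conjc q * w) ->
  normc (1 - conjc z * w) <= 2 * normc (1 - conjc q' * w) ->
  normc (ker M q w - ker M q' w) <=
    (M%:R * 2 ^+ M * 4) * (normc (q - q') / (1 - normc z)) * normc (ker M z w).
Proof.
move=> z1 q1 q'1 w1 hq hq'.
have nz := ker_denom_gt0 (ltW z1) w1; have nq := ker_denom_neq0 (ltW q1) w1.
have nq' := ker_denom_neq0 (ltW q'1) w1.
have z0 : 0 < 1 - normc z by rewrite subr_gt0.
rewrite normc_ker /ker; set x := (normc (1 - conjc z * w))^-1.
have x0 : 0 < x by rewrite invr_gt0.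
set u := (1 - conjc q * w)^-1; set v := (1 - conjc q' * w)^-1.
have bnd y : 0 < normc y -> normc (1 - conjc z * w) <= 2 * normc y -> normc (y^-1) <= 2 * x.
  by move=> y0 h; rewrite normcV /x -div1r ler_pdivrMr // mulrAC ler_pdivlMr // mul1r.
have ub : normc u <= 2 * x by apply: bnd => //; rewrite normc_gt0.
have vb : normc v <= 2 * x by apply: bnd => //; rewrite normc_gt0.
set E := normc (q - q') / (1 - normc z); have E0 : 0 <= E by rewrite divr_ge0 ?normc_ge0 ?ltW.
have uv : normc (u - v) <= 4 * E * x.
  rewrite (_ : u - v = conjc (q - q') * w * (u * v)); last first.
    rewrite /u /v rmorphB /=; field; apply/andP; split; [exact: nq'|exact: nq].
  rewrite (normcM (_ * w)) (normcM (conjc _)) normc_conj (normcM u).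
  apply: (@le_trans _ _ (normc (q - q') * 1 * (2 * x * (2 * x)))).
    apply: ler_pM; rewrite ?mulr_ge0 ?normc_ge0 //.
      by apply: ler_pM; rewrite ?normc_ge0 // ltW.
    by apply: ler_pM; rewrite ?normc_ge0.
  rewrite mulr1 (_ : normc (q - q') * (2 * x * (2 * x)) = 4 * x * (normc (q - q') * x)); last by ring.
  rewrite (_ : 4 * E * x = 4 * x * E); last by ring.
  rewrite ler_wpM2l ?mulr_ge0 ?(ltW x0) // ler_wpM2l ?normc_ge0 // lef_pV2 ?posrE //.
  exact: ker_denom_ge2 z1 (ltW w1).
elim: M => [|M IH]; first by rewrite !expr0 subrr normc0 !mul0r.
rewrite (_ : u ^+ M.+1 - v ^+ M.+1 = u * (u ^+ M - v ^+ M) + (u - v) * v ^+ M); last first.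
  by rewrite !exprS; ring.
apply: le_trans (normcD _ _) _; rewrite (normcM u) (normcM (u - v)) (normcX v).
apply: (@le_trans _ _ (2 * x * (M%:R * 2 ^+ M * 4 * E * x ^+ M) + (4 * E * x) * (2 * x) ^+ M)).
  apply: lerD; first by apply: ler_pM; rewrite ?normc_ge0.
  apply: ler_pM; rewrite ?normc_ge0 // ?exprn_ge0 ?normc_ge0 //.
  by apply: lerXn2r; rewrite ?nnegrE ?normc_ge0 // mulr_ge0 // ltW.
rewrite -natr1 !exprS exprMn; set Y := x ^+ M; set P := 2 ^+ M.
have Y0 : 0 <= Y by rewrite exprn_ge0 // ltW.
have P0 : 0 <= P by rewrite exprn_ge0.
have : 0 <= 4 * E * x * (P * Y).
  by apply: mulr_ge0; apply: mulr_ge0 => //; [apply: mulr_ge0 | exact: ltW].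
have -> : 2 * x * (M%:R * P * 4 * E * Y) + 4 * E * x * (P * Y) =
  (M%:R + 1) * (2 * P) * 4 * E * (x * Y) - 4 * E * x * (P * Y) by ring.
by lra.
Qed.

(** The family is uncountable, but a supremum of continuous functions is lower semicontinuous, with
    open superlevel sets. *)
Lemma lsc_sup_measurable (I : set C) (F : C -> C -> R) :
  (forall w z, I w -> normc z < 1 -> {for z, continuous (F w)}) ->
  measurable_fun (@diskp R) (fun p => ereal_sup [set (F w (plane_pt p))%:E | w in I]).
Proof.
move=> cF; apply: (measurability _ (ErealGenOInfty.measurableE R)) => _ [_ [a ->] <-].
rewrite (_ : _ `&` _ = @plane_pt R @^-1` [set z | disk z /\ exists2 w, I w & a < F w z]).
  apply: nopen_measurable => z [dz [w Iw aw]].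
  have [d d0 H] := nopen_disk dz; have := continuous_rcont (cF w z Iw dz).
  move=> /(_ ((F w z - a) / 2))[|r r0 Hr]; first by rewrite divr_gt0 // subr_gt0.
  exists (Num.min d r); first by rewrite lt_min d0.
  move=> k; rewrite lt_min => /andP[kd /Hr]; rewrite ler_norml => /andP[h _].
  by split; [exact: H | exists w => //; lra].
apply/seteqP; split => p [dp].
  rewrite /= in_itv /= andbT => /ereal_sup_gt[_ [w Iw <-]].
  by rewrite lte_fin => aw; split => //; exists w.
move=> [w Iw aw]; split => //=; rewrite in_itv /= andbT.
by apply: (@lt_le_trans _ _ (F w (plane_pt p))%:E); [rewrite lte_fin|apply: ereal_sup_ubound; exists w].
Qed.

Lemma tw_weight_bounded nu beta n : normal_exponent nu beta -> beta <= n%:R ->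
  exists2 B : R, 0 < B & forall z, normc z < 1 -> tw z ^+ n <= B * nu z.
Proof.
move=> nb bn; have [c c0 H] := weight_ratio_incr nb.
have n0 : 0 < nu 0 by apply: weight_gt0; exact: disk0.
exists (c / nu 0) => [|z z1]; first by rewrite divr_gt0.
have t0 := tw_gt0 z1; have := H z 0 z1; rewrite normc0 => /(_ (normc_ge0 z)).
have t00 : tw 0 = 1 :> R by rewrite /tw normc0 expr0n subr0.
rewrite t00 powR_div // powR1 => h.
have tb0 := powR_gt0 beta t0.
have h2 : tw z `^ beta <= c / nu 0 * nu z.
  move: h; rewrite /= mulrA mulr1 ler_pdivlMr // => h.
  by rewrite mulrAC ler_pdivlMr // mulrC.
apply: le_trans h2; rewrite -powR_mulrn ?(ltW t0) //; apply: ger_powR => //.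
by rewrite t0 tw_le1.
Qed.

Lemma real_dct d (T : measurableType d) (mu : {measure set T -> \bar R}) (D : set T)
    (f_ : nat -> T -> R) (f G : T -> R) : measurable D ->
  (forall n, measurable_fun D (f_ n)) -> measurable_fun D f ->
  (forall t, D t -> forall e : R, 0 < e -> exists N, forall n, (N <= n)%N -> `|f_ n t - f t| <= e) ->
  (forall n t, D t -> `|f_ n t| <= G t) -> mu.-integrable D (EFin \o G) ->
  forall e : R, 0 < e -> exists N, forall n, (N <= n)%N ->
    `|\int[mu]_(t in D) f_ n t - \int[mu]_(t in D) f t| <= e.
Proof.
move=> mD mf_ mf fcv fG iG e e0.
have [] := @dominated_convergence _ _ _ mu D mD (fun n => EFin \o f_ n) (EFin \o f) (EFin \o G).
- by move=> n; exact/measurable_EFinP.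
- exact/measurable_EFinP.
- apply: aeW => t Dt; apply: cvg_EFin; first by apply: nearW.
  apply/cvgrPdist_le => r r0; have [N HN] := fcv t Dt r r0.
  by exists N => // n /= Nn; rewrite distrC; exact: HN.
- exact: iG.
- by apply: aeW => t n Dt; rewrite lee_fin fG.
move=> i1 _ cv; have fin : (\int[mu]_(x in D) (f x)%:E)%E \is a fin_num by exact: integrable_fin_num.
move: cv; rewrite /= -(fineK fin) => /fine_cvgP[_ /cvgrPdist_le/(_ _ e0)[N _ HN]].
by exists N => n Nn; rewrite distrC; exact: HN.
Qed.

Lemma cint_dct d (T : measurableType d) (mu : {measure set T -> \bar R}) (D : set T)
    (F_ : nat -> T -> C) (F : T -> C) (G : T -> R) : measurable D ->
  (forall n, measurable_fun D (fun t => complex.Re (F_ n t))) ->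
  (forall n, measurable_fun D (fun t => complex.Im (F_ n t))) ->
  measurable_fun D (fun t => complex.Re (F t)) ->
  measurable_fun D (fun t => complex.Im (F t)) ->
  (forall t, D t -> forall e : R, 0 < e -> exists N, forall n, (N <= n)%N -> normc (F_ n t - F t) <= e) ->
  (forall n t, D t -> normc (F_ n t) <= G t) -> mu.-integrable D (EFin \o G) ->
  forall e : R, 0 < e -> exists N, forall n, (N <= n)%N ->
    normc (cint mu D (F_ n) - cint mu D F) <= e.
Proof.
move=> mD m1 m2 m3 m4 fcv fG iG e e0; have e2 : 0 < e / 2 by rewrite divr_gt0.
have [||N1 H1] := @real_dct _ _ mu D (fun n t => complex.Re (F_ n t)) (fun t => complex.Re (F t)) G mD m1 m3 _ _ iG _ e2.
- move=> t Dt r /(fcv t Dt)[N HN]; exists N => n /HN; apply: le_trans.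
  by rewrite -raddfB; exact: normc_Re.
- by move=> n t Dt; apply: le_trans (normc_Re _) (fG n t Dt).
have [||N2 H2] := @real_dct _ _ mu D (fun n t => complex.Im (F_ n t)) (fun t => complex.Im (F t)) G mD m2 m4 _ _ iG _ e2.
- move=> t Dt r /(fcv t Dt)[N HN]; exists N => n /HN; apply: le_trans.
  by rewrite -raddfB; exact: normc_Im.
- by move=> n t Dt; apply: le_trans (normc_Im _) (fG n t Dt).
exists (maxn N1 N2) => n; rewrite geq_max => /andP[/H1 h1 /H2 h2].
by apply: le_trans (normc_ReIm _) _; rewrite [e]splitr /cint /= lerD.
Qed.

(** The dilates [f (r z)] are holomorphic on the closed disk. They are dominated because [nu] is
    nonincreasing in the modulus: [nu z * |f (r z)| <= nu (r z) * |f (r z)|]. Then [r] tends to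
    1. *)
Lemma reproducing nu f (B : R) n w : (forall z, normc z < 1 -> tw z ^+ n.+1 <= B * nu z) ->
  holomorphic f -> weighted_bounded nu f -> normc w < 1 ->
  cint (area R) (@diskp R) (fun p => f (plane_pt p) *
    ((tw (plane_pt p))%:C ^+ n.+1 * ker n.+3 (plane_pt p) w)) = f w * (tw_mass R n.+1)%:C.
Proof.
move=> HB hf bf w1.
pose M := weighted_sup nu f; have fM z : normc z < 1 -> nu z * normc (f z) <= M.
  by move=> z1; exact: weighted_sup_ub.
have M0 : 0 <= M.
  apply: le_trans (fM 0 _); last by rewrite normc0.
  by rewrite mulr_ge0 ?normc_ge0 // ltW // weight_gt0 //; exact: disk0.
have cf z : normc z < 1 -> {for z, continuous f} by move=> z1; exact: holomorphic_continuous.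
pose r k : R := 1 - k.+2%:R^-1.
have r01 k : 0 <= r k < 1.
  rewrite /r subr_ge0 invf_le1 ?ltr0Sn // ler1n /= ltrBlDr ltrDl invr_gt0 ltr0Sn //.
pose fr k z := f ((r k)%:C * z).
have nrz k z : normc ((r k)%:C * z) <= normc z.
  have /andP[h0 h1] := r01 k; rewrite (normcM _%:C) normcC ger0_norm //.
  by rewrite ler_piMl ?normc_ge0 // ltW.
have dfr k z : normc z <= 1 -> exists A, wd (fr k) z A 0.
  move=> z1; have /andP[h0 h1] := r01 k; eexists; apply: wd_scale; apply: derivable_wd; apply: hf.
  apply: (@le_lt_trans _ _ (r k)) => //; rewrite (normcM _%:C) normcC ger0_norm //.
  by rewrite ler_piMr.
have rcv (e : R) : 0 < e -> exists N, forall k, (N <= k)%N -> 1 - r k < e.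
  move=> e0; exists (Num.truncn e^-1) => k Nk; rewrite /r opprB addrC subrK.
  rewrite -[e]invrK ltf_pV2 ?posrE ?ltr0Sn ?invr_gt0 //.
  by apply: lt_le_trans (truncnS_gt _) _; rewrite ler_nat !ltnS ltnW // ltnS.
have frcv z : normc z < 1 -> forall e : R, 0 < e -> exists N, forall k, (N <= k)%N -> normc (fr k z - f z) <= e.
  move=> z1 e e0; have /continuousCP/(_ _ e0)[d d0 H] := cf z z1.
  have [N HN] := rcv d d0; exists N => k /HN hk; rewrite /fr.
  have -> : (r k)%:C * z = z + ((r k)%:C - 1) * z by ring.
  apply: H; have /andP[h0 h1] := r01 k.
  have nr : normc ((r k)%:C - 1) = 1 - r k.
    rewrite -(rmorph1 (real_complex R)) -rmorphB normcC ler0_norm ?opprB //; lra.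
  rewrite (normcM (_ - 1)) nr; apply: le_lt_trans hk.
  by rewrite ler_piMr ?(ltW z1) // subr_ge0 ltW.
pose L := (1 - normc w)^-1 ^+ n.+3; have L0 : 0 <= L by rewrite exprn_ge0 // invr_ge0 subr_ge0 ltW.
have mD : measurable (@diskp R) by exact: measurable_disk.
have cG (h : C -> C) z : normc z < 1 -> {for z, continuous h} ->
    {for z, continuous (fun z => h z * ((tw z)%:C ^+ n.+1 * ker n.+3 z w))}.
  move=> z1 ch; apply: continuousCM; first exact: ch.
  by apply: continuousCM; [exact: continuous_twX | exact: continuous_ker].
have cfr k z : normc z < 1 -> {for z, continuous (fr k)}.
  by move=> /ltW/(dfr k)[A hA]; exact: wd_continuous hA.
apply/eqP; rewrite -subr_eq0 -[_ == _]negbK -normc_gt0; apply/negP => n0.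
set e := normc _ in n0; have e4 : 0 < e / 4 by rewrite divr_gt0.
have [||||||N1 H1] := @cint_dct _ _ (area R) (@diskp R)
   (fun k p => fr k (plane_pt p) * ((tw (plane_pt p))%:C ^+ n.+1 * ker n.+3 (plane_pt p) w))
   (fun p => f (plane_pt p) * ((tw (plane_pt p))%:C ^+ n.+1 * ker n.+3 (plane_pt p) w))
   (fun=> M * B * L) mD _ _ _ _ _ _ (integrable_cst_lty _ mD (area_disk_lty R)) _ e4.
- by move=> k; apply: (@disk_measurable_Re R (fun z => fr k z * ((tw z)%:C ^+ n.+1 * ker n.+3 z w))) => z z1; apply: cG => //; exact: cfr.
- by move=> k; apply: (@disk_measurable_Im R (fun z => fr k z * ((tw z)%:C ^+ n.+1 * ker n.+3 z w))) => z z1; apply: cG => //; exact: cfr.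
- by apply: (@disk_measurable_Re R (fun z => f z * ((tw z)%:C ^+ n.+1 * ker n.+3 z w))) => z z1; apply: cG => //; exact: cf.
- by apply: (@disk_measurable_Im R (fun z => f z * ((tw z)%:C ^+ n.+1 * ker n.+3 z w))) => z z1; apply: cG => //; exact: cf.
- move=> p dp e' e'0; set z := plane_pt p; have z1 : normc z < 1 := dp.
  pose b := normc ((tw z)%:C ^+ n.+1 * ker n.+3 z w) + 1.
  have b0 : 0 < b by rewrite ltr_wpDl ?normc_ge0.
  have [|N HN] := frcv z z1 (e' / b); first by rewrite divr_gt0.
  exists N => k /HN h; rewrite -mulrBl (normcM (_ - _)).
  apply: (@le_trans _ _ (e' / b * b)); last by rewrite mulfVK // gt_eqF.
  by apply: ler_pM; rewrite ?normc_ge0 // /b lerDl.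
- move=> k p dp; set z := plane_pt p; have z1 : normc z < 1 := dp.
  have nz0 : 0 < nu z by rewrite weight_gt0.
  have rz1 : normc ((r k)%:C * z) < 1 := le_lt_trans (nrz k z) z1.
  rewrite (normcM (fr k z)) (normcM (_ ^+ _)) normc_twX // mulrA.
  apply: ler_pM; rewrite ?mulr_ge0 ?normc_ge0 //; try by have /andP[] := twX_le1 n.+1 z1.
    apply: (@le_trans _ _ (normc (fr k z) * (B * nu z))).
      by rewrite ler_wpM2l ?normc_ge0 // HB.
    have B0 : 0 <= B.
      have := HB z z1; have /andP[h _] := twX_le1 n.+1 z1 => /(le_trans h).
      by rewrite pmulr_lge0.
    rewrite mulrC -mulrA mulrC ler_wpM2r //.
    apply: le_trans (fM _ rz1); rewrite ler_wpM2r ?normc_ge0 //.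
    exact: weight_nincr (nrz k z).
  exact: normc_ker_le (ltW z1) w1.
have c0 := tw_mass_gt0 R n.+1.
have [|N2 H2] := frcv w w1 (e / 4 / tw_mass R n.+1); first by rewrite divr_gt0.
have {}H1 := H1 (maxn N1 N2) (leq_maxl _ _); have {}H2 := H2 (maxn N1 N2) (leq_maxr _ _).
move: H1; rewrite (reproducing_closed n (dfr _) w1) => H1.
have : e <= e / 4 + e / 4.
  rewrite {1}/e.
  set I := cint _ _ _ in H1 *.
  rewrite (_ : I - _ = - (fr (maxn N1 N2) w * (tw_mass R n.+1)%:C - I) +
    (fr (maxn N1 N2) w - f w) * (tw_mass R n.+1)%:C); last by ring.
  apply: le_trans (normcD _ _) _; rewrite normcN lerD //.
  by rewrite (normcM (_ - _)) normcC gtr0_norm // -ler_pdivlMr.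
lra.
Qed.

End kernels.

(** * Kernels and functionals in the growth spaces *)

Section dual_norm.
Variable R : realType.
Local Notation C := R[i].
Variable V : normedModType C.
Implicit Types (x : V).

Lemma real_normE x : `|x| = (real_norm x)%:C.
Proof.
have := normr_ge0 x; rewrite /real_norm; case: `|x| => a b.
by rewrite lecE /= => /andP[/eqP -> _].
Qed.

Lemma real_norm_ge0 x : 0 <= real_norm x.
Proof. by rewrite -lecR -real_normE normr_ge0. Qed.

Lemma real_norm_eq0 x : real_norm x = 0 -> x = 0.
Proof. by move=> h; apply/normr0_eq0; rewrite real_normE h. Qed.

Lemma real_normZ c x : real_norm (c *: x) = normc c * real_norm x.
Proof.
have : `|c *: x| = `|c| * `|x| by rewrite normrZ.
by rewrite !real_normE normE -rmorphM => -[].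
Qed.

Lemma linear_bound_continuous (x' : {linear V -> C}) (A : R) :
  (forall x, normc (x' x) <= A * real_norm x) -> continuous x'.
Proof.
move=> xA; apply/linear_bounded_continuous/bounded_funP => r.
exists (`|A|%:C * r) => x xr; rewrite normE.
apply: (@le_trans _ _ (`|A|%:C * `|x|)); last by rewrite ler_wpM2l // lecR.
rewrite real_normE -rmorphM lecR (le_trans (xA x)) //.
by rewrite ler_wpM2r ?real_norm_ge0 // ler_norm.
Qed.

Lemma dual_norm_bounded (x' : {linear V -> C}) : continuous x' ->
  has_sup [set normc (x' x) | x in [set x : V | real_norm x <= 1]].
Proof.
move=> cx; split; first by exists (normc (x' 0)); exists 0 => //=; rewrite /real_norm normr0.
have /linear_bounded_continuous/bounded_funP/(_ 1)[M HM] := cx.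
exists (complex.Re M) => _ [x /= x1 <-].
have : `|x' x| <= M by apply: HM; rewrite real_normE -(rmorph1 (real_complex R)) lecR.
by rewrite normE; case: M {HM} => a b; rewrite lecE => /andP[].
Qed.

Lemma dual_norm_ge0 (x' : {linear V -> C}) : continuous x' -> 0 <= dual_norm x'.
Proof.
move=> /dual_norm_bounded[_ hub]; apply: (@le_trans _ _ (normc (x' 0))); first exact: normc_ge0.
by apply: ub_le_sup => //; exists 0 => //=; rewrite /real_norm normr0.
Qed.

Lemma dual_normP (x' : {linear V -> C}) x : continuous x' -> normc (x' x) <= dual_norm x' * real_norm x.
Proof.
move=> cx; have [_ hub] := dual_norm_bounded cx.
have [x0|x0] := eqVneq (real_norm x) 0.
  by rewrite (real_norm_eq0 x0) linear0 normc0 /real_norm normr0 mulr0.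
have xp : 0 < real_norm x by rewrite lt_neqAle eq_sym x0 real_norm_ge0.
rewrite -ler_pdivrMr //.
have -> : normc (x' x) / real_norm x = normc (x' ((real_norm x)^-1%:C *: x)).
  rewrite linearZ /= (normcM _%:C) normcC ger0_norm ?invr_ge0 ?real_norm_ge0 //.
  by rewrite mulrC.
apply: ub_le_sup => //; eexists; last reflexivity.
by rewrite /= real_normZ normcC ger0_norm ?invr_ge0 ?real_norm_ge0 // mulVf.
Qed.

Lemma dual_norm_le (x' : {linear V -> C}) (A : R) : 0 <= A -> (forall x, normc (x' x) <= A * real_norm x) ->
  dual_norm x' <= A.
Proof.
move=> A0 xA; apply: ge_sup.
  by exists (normc (x' 0)); exists 0 => //=; rewrite /real_norm normr0.
move=> _ [x /= x1 <-]; apply: le_trans (xA x) _.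
by rewrite ler_piMr.
Qed.

End dual_norm.

Section spaces.
Variables (R : realType) (nu mu : radial_weight R).
Local Notation C := R[i].
Implicit Types (z w : C) (f g phi : C -> C).

(** Cut off outside the disk, as the elements of the function spaces are. *)
Definition kfun n z : C -> C := fun w => if normc w < 1 then ker n z w else 0.

Lemma wd_ker_r n z w : normc z <= 1 -> normc w < 1 -> exists A, wd (ker n z) w A 0.
Proof.
move=> z1 w1; case: n => [|n].
  by exists 0; apply: (wd_local ltr01 _ (wd_cst 1 w)) => k _; rewrite /ker expr0.
have nz := ker_denom_neq0 z1 w1.
have h1 : wd (fun w => 1 - conjc z * w) w (- conjc z) 0.
  by apply: (wd_eq (wdD (wd_cst 1 w) (wdM (wdM (wd_cst (-1) w) (wd_cst (conjc z) w)) (wd_id w)))) => [?||]; ring.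
eexists; apply: (wd_eq (wdX n (wdV (f := fun w => 1 - conjc z * w) nz h1))) => [//||].
  by reflexivity.
by rewrite oppr0 mul0r mulr0.
Qed.

Lemma kfun_holomorphic n z : normc z <= 1 -> holomorphic_on_disk (kfun n z).
Proof.
move=> z1; split => [w dw|w ndw]; last first.
  by rewrite /kfun; case: ltP => // h; case: ndw.
have w1 : normc w < 1 := dw; have [A hA] := wd_ker_r n z1 w1.
have : wd (kfun n z) w A 0.
  apply: (wd_local (d := 1 - normc w)) hA => [|k kw]; first by rewrite subr_gt0.
  by rewrite /kfun ifT //; apply: le_lt_trans (normcD _ _) _; lra.
by move=> /wd_derivable[].
Qed.

Lemma kfun_le n z w : normc z < 1 -> normc (kfun n z w) <= (1 - normc z)^-1 ^+ n.
Proof.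
move=> z1; have z0 : 0 <= (1 - normc z)^-1 by rewrite invr_ge0 subr_ge0 ltW.
rewrite /kfun; case: ltP => w1; last by rewrite normc0 exprn_ge0.
rewrite normc_ker; apply: lerXn2r; [by rewrite nnegrE invr_ge0 normc_ge0|by rewrite nnegrE|].
by rewrite lef_pV2 ?posrE ?subr_gt0 ?ker_denom_gt0 ?(ltW z1) // ker_denom_ge2 // ltW.
Qed.

(** The kernel at a point of the open disk is bounded, and (II) makes [nu] tend to 0 at the
    circle. *)
Lemma kfun_H0 (gamma : R) n z : 0 < gamma ->
  almost_decreasing (fun r => nu r%:C / (1 - r ^+ 2) `^ gamma) -> normc z < 1 ->
  kfun n z \in H0_pred nu.
Proof.
move=> g0 ng z1; apply/mem_set; split; first exact: kfun_holomorphic (ltW z1).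
move=> e e0; have [c c0 H] := weight_ratio_decr ng.
pose B := (1 - normc z)^-1 ^+ n; have B0 : 0 < B by rewrite exprn_gt0 // invr_gt0 subr_gt0.
have n0 : 0 < nu 0 by apply: weight_gt0; exact: disk0.
pose d := e / (2 * (c * nu 0 * B)); have d0 : 0 < d by rewrite divr_gt0 // !mulr_gt0.
(* So that [s ^ gamma = d]; beyond the radius [1 - s / 2] one has [tw w <= 2 * (1 - |w|) <= s]. *)
pose s := d `^ gamma^-1; have s0 : 0 < s by rewrite powR_gt0.
exists (1 - s / 2) => [|w /andP[rw w1]]; first by rewrite gtrBl divr_gt0.
have tw0 := tw_gt0 w1; have nw0 : 0 < nu w by rewrite weight_gt0.
rewrite ger0_norm; last by rewrite mulr_ge0 ?normc_ge0 // ltW.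
have h1 : nu w <= c * nu 0 * d.
  have := H 0 w w1; rewrite normc0 => /(_ (normc_ge0 w)) h; apply: (le_trans h).
  rewrite ler_pM2l ?mulr_gt0 //.
  have -> : tw 0 = 1 :> R by rewrite /tw normc0 expr0n subr0.
  have -> : d = s `^ gamma by rewrite -powRrM mulVf ?gt_eqF // powRr1 // ltW.
  rewrite divr1; apply: powR_ge0_le; rewrite ?ltW //.
  by have := tw_le (ltW w1); lra.
apply: (@le_lt_trans _ _ (c * nu 0 * d * B)).
  by apply: ler_pM; rewrite ?(ltW nw0) ?normc_ge0 //; exact: kfun_le.
have -> : c * nu 0 * d * B = e / 2.
  by rewrite /d; field; rewrite !gt_eqF.
by lra.
Qed.

Lemma H0_sub_Hinf (f : H0 nu) : (f : C -> C) \in Hinf_pred nu.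
Proof. by apply/mem_set; have [] := H0P f. Qed.

Definition H0_incl (f : H0 nu) : Hinf nu := MkHinf (H0_sub_Hinf f).

Lemma H0_incl_is_linear : linear H0_incl.
Proof. by move=> c f g; apply: val_inj. Qed.

HB.instance Definition _ :=
  GRing.isLinear.Build C (H0 nu) (Hinf nu) _ H0_incl H0_incl_is_linear.

Lemma real_norm_Hinf (f : Hinf nu) : real_norm f = weighted_sup nu f.
Proof. by []. Qed.

Lemma real_norm_H0 (f : H0 nu) : real_norm f = weighted_sup nu f.
Proof. by []. Qed.

Lemma real_norm_bloch (f : bloch mu) : real_norm f = normc (f 0) + weighted_sup mu (derive1 f).
Proof. by []. Qed.

Section induced.
Variables (X : function_space R) (g phi : C -> C) (L : X -> Bloch mu).
Hypothesis hg : holomorphic g.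
Hypothesis hphi : self_map phi.
Hypothesis hL : induced_by (T_op g phi) L.

(** The Bloch norm of an image thereby reduces to the supremum over its derivative. *)
Lemma induced_at0 (f : X) : eval (L f) 0 = 0.
Proof.
rewrite hL; last exact: disk0.
rewrite /T_op /integral01 (@eq_Rintegral _ _ _ _ _ (fun=> 0)) => [|t _]; last by rewrite mulr0.
rewrite [X in _ +i* X](@eq_Rintegral _ _ _ _ _ (fun=> 0)) => [|t _]; last by rewrite mulr0.
by rewrite /Rintegral integral0.
Qed.

Lemma induced_derive (f : X) z : holomorphic (eval f) -> disk z ->
  derive1 (eval (L f)) z = eval f (phi z) * derive1 g z.
Proof.
move=> hf dz; have [[hLf _] _] := blochP (L f).
pose F := (fun z => eval f (phi z) * derive1 g z) : C -> C.
have cF : forall w, disk w -> {for w, continuous F}.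
  move=> w dw; rewrite /F; apply: continuousCM.
    apply: (@continuous_comp C C C phi (eval f) w).
      exact: holomorphic_continuous hphi.1 dw.
    apply: holomorphic_continuous; first exact: hf.
    exact: hphi.2.
  by have [A hA] := wd_derive_holomorphic hg dw; exact: wd_continuous hA.
have hi w : disk w -> eval (L f) w = integral01 (fun t => F (t%:C * w) * w).
  by move=> dw; rewrite hL.
have hh : holomorphic (eval (L f)) := hLf.
exact: (@derive_ray_integral R _ F hh cF hi z dz).
Qed.

End induced.
End spaces.

(** The inclusion is isometric, so restricting the functionals does not increase their dual
    norms. *)
Lemma nuclear_H0_of_Hinf (R : realType) (nu mu : radial_weight R) (T : (R[i] -> R[i]) -> R[i] -> R[i]) :
  nuclear_from_to T (H_infty nu) (Bloch mu) -> nuclear_from_to T (H_zero nu) (Bloch mu).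
Proof.
move=> [L hL [x' [y [cx sxy cv]]]].
exists (L \o @H0_incl R nu).
  by move=> f z dz; exact: hL (H0_incl f) z dz.
pose X k : {linear H_zero nu -> R[i]} := x' k \o @H0_incl R nu.
have xin k (f : H_zero nu) : normc (X k f) <= dual_norm (x' k) * real_norm f.
  exact: (dual_normP (H0_incl f) (cx k)).
have cX k : continuous (X k).
  exact: (@linear_bound_continuous R (H_zero nu) (X k) _ (xin k)).
exists X, y; split => //.
- apply: le_lt_trans sxy; apply: lee_nneseries => [k _ _|k _].
    by rewrite lee_fin mulr_ge0 ?real_norm_ge0 // dual_norm_ge0.
  rewrite lee_fin ler_wpM2r ?real_norm_ge0 //.
  by apply: dual_norm_le; [exact: dual_norm_ge0 (cx k)|exact: xin].
- by move=> f; exact: cv (H0_incl f).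
Qed.

(** * From nuclearity to the integral condition *)

Section cell_sums.
Variable R : realType.
Local Notation C := R[i].
Implicit Types (z w q : C) (nu : radial_weight R).

Definition cellp m : set (plane R) := @plane_pt R @^-1` @cell R m.

Lemma cellp_diskp m : cellp m `<=` @diskp R.
Proof. by move=> p []. Qed.

Lemma good_cell_compare m z : good R m -> cell m z ->
  [/\ normc (z - rep R m) <= (1 - normc (rep R m)) / 4,
      tw z <= 3 * tw (rep R m) & tw (rep R m) <= 3 * tw z].
Proof.
move=> gm cz; have [d1 d2] := good_cell_dist gm cz.
have q1 : normc (rep R m) < 1 := rep_disk R m; have z1 : normc z < 1 := cz.1.
have h16 : 16 * mesh R (lev m) <= 1 - normc (rep R m) by case/andP: gm.
have nd := normcB z (rep R m); have := le_trans nd d1; rewrite ler_norml => /andP[n1 n2].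
have := tw_ge z1; have := tw_ge q1; have := tw_le (ltW z1); have := tw_le (ltW q1).
by split; lra.
Qed.

(** If [z] is the outer point, monotonicity of [nu] suffices; otherwise (I) bounds the ratio of the
    weights by a power of [tw z / tw q <= 3]. *)
Lemma weight_compare nu beta : normal_exponent nu beta -> exists2 c : R, 0 < c &
  forall z q, normc z < 1 -> normc q < 1 -> tw z <= 3 * tw q -> nu z <= c * nu q.
Proof.
move=> hnu; have [c c0 H] := weight_ratio_incr hnu; have [b0 _] := hnu.
exists (1 + c * 3 `^ beta) => [|z q z1 q1 zq]; first by rewrite ltr_pwDl // mulr_ge0 ?powR_ge0 // ltW.
have nq : 0 < nu q by exact: weight_gt0.
rewrite mulrDl mul1r.
have c3 : 0 <= c * 3 `^ beta * nu q by rewrite !mulr_ge0 ?powR_ge0 // ltW.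
have [qz|/ltW qz] := leP (normc q) (normc z).
  by have := @weight_nincr _ nu q z z1 qz; lra.
apply: (le_trans (H _ _ q1 qz)); apply: ler_wpDl; first exact: ltW.
rewrite mulrAC ler_wpM2r ?(ltW nq) // ler_wpM2l ?(ltW c0) //.
apply: powR_ge0_le; first exact: ltW.
  by rewrite divr_ge0 // ltW // tw_gt0.
by rewrite ler_pdivrMr ?tw_gt0.
Qed.

Lemma sel_integral_sum (F : plane R -> \bar R) Q :
  measurable_fun (@diskp R) F -> (forall p, diskp p -> 0 <= F p)%E ->
  (\sum_(0 <= m < Q | sel R m) \int[area R]_(p in cellp m) F p <=
   \int[area R]_(p in @diskp R) F p)%E.
Proof.
move=> mF F0; set s := [seq m <- index_iota 0 Q | sel R m].
have mc m : measurable (cellp m) by exact: measurable_cell.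
have sub : \big[setU/set0]_(m <- s) cellp m `<=` @diskp R.
  rewrite -bigcup_seq => p [m _]; exact: cellp_diskp.
have mU : measurable (\big[setU/set0]_(m <- s) cellp m).
  by rewrite -bigcup_seq; apply: bigcup_measurable.
rewrite -big_filter -/s -ge0_integral_bigsetU //.
- by apply: ge0_subset_integral => //; exact: measurable_disk.
- by rewrite filter_uniq // iota_uniq.
- move=> i j /= + + [p [pi pj]].
  rewrite !mem_filter => /andP[si _] /andP[sj _]; exact: (sel_unique si sj pi pj).
- by apply: measurable_funS mF => //; exact: measurable_disk.
- by move=> p /sub; exact: F0.
Qed.

(** Up to a constant, the density [tw ^ p / nu] at the representative times the area of the cell. *)
Definition cell_mass nu p m : R :=
  tw (rep R m) ^+ p * mesh R (lev m) ^+ 2 / nu (rep R m).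

Lemma cell_mass_gt0 nu p m : 0 < cell_mass nu p m.
Proof.
have q1 : normc (rep R m) < 1 := rep_disk R m.
by rewrite divr_gt0 ?weight_gt0 // mulr_gt0 // exprn_gt0 ?mesh_gt0 ?tw_gt0.
Qed.

Lemma fr_kernel_nat nu p w z : normc z < 1 -> normc w < 1 ->
  fr_kernel nu p%:R w z = tw z ^+ p / nu z * normc (ker p.+2 z w).
Proof.
move=> z1 w1; rewrite /fr_kernel powR_mulrn ?(ltW (tw_gt0 z1)) //; congr (_ * _).
rewrite powRN -natrD addn2 powR_mulrn ?normc_ge0 // normc_ker.
by rewrite exprVn.
Qed.

(** On a good cell [tw] and the kernel vary by a bounded factor, [nu] is at most a multiple of its
    value at the representative, and the area is at least [mesh ^ 2]: a value at the representative
    is dominated by an integral over the cell. *)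
Lemma cell_mass_kernel nu beta p : normal_exponent nu beta -> exists2 c : R, 0 < c &
  forall m w, good R m -> normc w < 1 ->
  ((cell_mass nu p m * normc (ker p.+2 (rep R m) w))%:E <=
   c%:E * \int[area R]_(t in cellp m) (fr_kernel nu p%:R w (plane_pt t))%:E)%E.
Proof.
move=> hnu; have [c c0 H] := weight_compare hnu.
exists (3 ^+ p * c * 2 ^+ p.+2) => [|m w gm w1]; first by apply: mulr_gt0; [apply: mulr_gt0; first exact: exprn_gt0|exact: exprn_gt0].
have q1 : normc (rep R m) < 1 := rep_disk R m.
have nq : 0 < nu (rep R m) by exact: weight_gt0.
have mc : measurable (cellp m) by exact: measurable_cell.
pose k := tw (rep R m) ^+ p / nu (rep R m) * normc (ker p.+2 (rep R m) w).
have k0 : 0 <= k.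
  by rewrite mulr_ge0 ?normc_ge0 // divr_ge0 ?(ltW nq) // exprn_ge0 // ltW // tw_gt0.
have mfr : measurable_fun (cellp m) (fun t => (fr_kernel nu p%:R w (plane_pt t))%:E).
  apply: (@measurable_funS _ _ _ _ _ _ (fun t => (fr_kernel nu p%:R w (plane_pt t))%:E)
    (@measurable_disk R) (@cellp_diskp m)).
  by apply/measurable_EFinP; exact: fr_kernel_measurable.
have kfr z : cell m z -> k <= 3 ^+ p * c * 2 ^+ p.+2 * fr_kernel nu p%:R w z.
  move=> cz; have z1 : normc z < 1 := cz.1; have [d t1 t2] := good_cell_compare gm cz.
  have nz : 0 < nu z by exact: weight_gt0.
  rewrite fr_kernel_nat // /k.
  have -> : 3 ^+ p * c * 2 ^+ p.+2 * (tw z ^+ p / nu z * normc (ker p.+2 z w)) =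
     ((3 * tw z) ^+ p * (c / nu z)) * (2 ^+ p.+2 * normc (ker p.+2 z w)).
    by rewrite exprMn; ring.
  have tq := tw_gt0 q1; have tz := tw_gt0 z1.
  apply: ler_pM; rewrite ?normc_ge0 //.
  - by rewrite divr_ge0 ?(ltW nq) // exprn_ge0 // ltW.
  - apply: ler_pM; rewrite ?exprn_ge0 ?invr_ge0 ?(ltW tq) ?(ltW nq) //.
      by apply: lerXn2r; rewrite // nnegrE ?mulr_ge0 // ltW.
    by rewrite ler_pdivlMr // mulrC ler_pdivrMr // H.
  - rewrite !normc_ker -exprMn; apply: lerXn2r.
    + by rewrite nnegrE invr_ge0 normc_ge0.
    + by rewrite nnegrE mulr_ge0 // invr_ge0 normc_ge0.
    have [h _] := ker_denom_compare q1 (ltW w1) d.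
    rewrite -(invrK 2) -invfM lef_pV2 ?posrE ?mulr_gt0 ?invr_gt0 ?ker_denom_gt0 ?(ltW q1) ?(ltW z1) //.
    by rewrite -ler_pdivlMl // invrK.
have -> : cell_mass nu p m * normc (ker p.+2 (rep R m) w) = k * mesh R (lev m) ^+ 2.
  by rewrite /cell_mass /k; ring.
apply: (@le_trans _ _ (k%:E * area R (cellp m))%E).
  rewrite EFinM; apply: lee_pmul => //; first by rewrite lee_fin exprn_ge0 // ltW // mesh_gt0.
  apply: le_trans (area_cell gm); rewrite lee_fin.
  by have := @exprn_ge0 _ 2 _ (ltW (mesh_gt0 R (lev m))); lra.
rewrite -integral_cst // -ge0_integralZl //; last 2 first.
- by move=> t ct; rewrite lee_fin fr_kernel_ge0 //; exact: ct.1.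
- by rewrite lee_fin; apply: mulr_ge0; [apply: mulr_ge0; [exact: exprn_ge0|exact: ltW]|exact: exprn_ge0].
apply: ge0_le_integral => //.
- by apply: measurable_funeM.
- by move=> t ct; rewrite -EFinM lee_fin; exact: kfr ct.
Qed.

(** A discrete Forelli-Rudin estimate, obtained because the maximal good cells are disjoint. It
    bounds the norms of the test functions uniformly in their coefficients. *)
Lemma cell_mass_sum nu beta gamma p : normal_exponent nu beta -> 0 < gamma ->
  almost_decreasing (fun r => nu r%:C / (1 - r ^+ 2) `^ gamma) -> beta - 1 < p%:R ->
  exists2 c : R, 0 < c & forall Q w, normc w < 1 ->
    nu w * \sum_(0 <= m < Q | sel R m) (cell_mass nu p m * normc (ker p.+2 (rep R m) w)) <= c.
Proof.
move=> hnu g0 hg bp; have [c c0 H] := cell_mass_kernel p hnu.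
have [K K0 HK] := forelli_rudin hnu g0 hg bp.
exists (c * K) => [|Q w w1]; first exact: mulr_gt0.
have nw : 0 < nu w by exact: weight_gt0.
rewrite mulrC -ler_pdivlMr // -lee_fin -sumEFin.
apply: (@le_trans _ _ (\sum_(0 <= m < Q | sel R m)
   c%:E * \int[area R]_(t in cellp m) (fr_kernel nu p%:R w (plane_pt t))%:E)%E).
  by apply: lee_sum => m /andP[gm _]; exact: H.
rewrite -ge0_sume_distrr => [|m _]; last first.
  by apply: integral_ge0 => t ct; rewrite lee_fin fr_kernel_ge0 //; exact: ct.1.
rewrite -mulrA EFinM; apply: lee_pmul => //.
- by rewrite lee_fin ltW.
- by rewrite sume_ge0 // => m _; apply: integral_ge0 => t ct; rewrite lee_fin fr_kernel_ge0 //; exact: ct.1.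
apply: le_trans (HK w w1); apply: sel_integral_sum.
  by apply/measurable_EFinP; exact: fr_kernel_measurable.
by move=> t dt; rewrite lee_fin fr_kernel_ge0.
Qed.

End cell_sums.

(** * Testing a nuclear representation on finite sums *)

Section nuclear_sums.
Variable R : realType.
Local Notation C := R[i].

Lemma real_normD (V : normedModType C) (x y : V) : real_norm (x + y) <= real_norm x + real_norm y.
Proof. by rewrite -lecR rmorphD /= -!real_normE ler_normD. Qed.

Lemma real_norm_sum (V : normedModType C) (x : nat -> V) n :
  real_norm (\sum_(0 <= k < n) x k) <= \sum_(0 <= k < n) real_norm (x k).
Proof.
elim: n => [|n IH]; first by rewrite !big_geq // /real_norm normr0.
by rewrite !big_nat_recr //=; apply: le_trans (real_normD _ _) _; rewrite lerD2r.
Qed.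

(** The coefficients [e m] rotate each [x' (v m)] onto the positive axis, which turns the sum of the
    moduli into one value of [x']. *)
Lemma dual_norm_sum (V : normedModType C) (x' : {linear V -> C}) (P : pred nat)
    (a : nat -> R) (v : nat -> V) Q (c : R) : continuous x' ->
  (forall e : nat -> C, (forall m, normc (e m) <= 1) ->
    real_norm (\sum_(0 <= m < Q | P m) ((a m)%:C * e m) *: v m) <= c) ->
  \sum_(0 <= m < Q | P m) a m * normc (x' (v m)) <= c * dual_norm x'.
Proof.
move=> cx H.
pose e m : C := if x' (v m) == 0 then 0 else conjc (x' (v m)) / (normc (x' (v m)))%:C.
have nc m : x' (v m) != 0 -> normc (x' (v m)) != 0 by move=> h; rewrite gt_eqF // normc_gt0.
have ne m : normc (e m) <= 1.
  rewrite /e; case: eqVneq => [_|/nc h]; first by rewrite normc0.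
  by rewrite (normcM (conjc _)) normc_conj normcV normcC ger0_norm ?normc_ge0 // divff.
have ex m : e m * x' (v m) = (normc (x' (v m)))%:C.
  rewrite /e; case: eqVneq => [->|/nc h]; first by rewrite mul0r normc0.
  rewrite mulrAC (mulrC (conjc _)) mulcJ -fmorphV -rmorphM; congr (_ %:C).
  by rewrite expr2 mulfK.
have E : x' (\sum_(0 <= m < Q | P m) ((a m)%:C * e m) *: v m) =
    (\sum_(0 <= m < Q | P m) a m * normc (x' (v m)))%:C.
  rewrite linear_sum rmorph_sum; apply: eq_bigr => m _.
  by rewrite linearZ /= -[_ *: _]/(_ * _) -mulrA ex -rmorphM.
apply: le_trans (ler_norm _) _; rewrite -normcC -E.
apply: le_trans (dual_normP _ cx) _; rewrite mulrC ler_wpM2r ?dual_norm_ge0 //.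
exact: H.
Qed.

Section nuclear_operator.
Variables (X Y : normedModType C) (T : X -> Y).
Variables (x' : nat -> {linear X -> C}) (y : nat -> Y).
Hypothesis cx : forall k, continuous (x' k).
Hypothesis cv : forall x, [series x' k x *: y k]_k @ \oo --> T x.

Lemma nuclear_norm_le x :
  ((real_norm (T x))%:E <= \sum_(0 <= k <oo) (normc (x' k x) * real_norm (y k))%:E)%E.
Proof.
have pos k : true -> (0 <= (normc (x' k x) * real_norm (y k))%:E)%E.
  by rewrite lee_fin mulr_ge0 ?normc_ge0 ?real_norm_ge0.
apply/lee_addgt0Pr => e e0.
have eC : 0 < e%:C by rewrite ltcR.
have /cvgrPdist_le/(_ _ eC)[n _ /(_ n (leqnn n)) /= hn] := @cv x.
apply: (@le_trans _ _ ((\sum_(0 <= k < n) (normc (x' k x) * real_norm (y k)))%:E + e%:E)%E); last first.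
  rewrite leeD2r // -sumEFin; apply: nneseries_lim_ge => k _; exact: pos.
rewrite -EFinD lee_fin.
have -> : T x = series (fun k => x' k x *: y k) n + (T x - series (fun k => x' k x *: y k) n).
  by rewrite addrC subrK.
apply: le_trans (real_normD _ _) _; rewrite lerD //.
  apply: le_trans (real_norm_sum _ _) _; apply: ler_sum => k _.
  by rewrite real_normZ.
by rewrite real_normE lecR in hn.
Qed.

(** After the sums are exchanged, the coefficients are chosen anew for each [x' k], so that the
    index [k] contributes at most [c * dual_norm (x' k) * real_norm (y k)], whatever [Q] is. *)
Lemma nuclear_test_sum (P : pred nat) (a : nat -> R) (v : nat -> X) (c : R) :
  (\sum_(0 <= k <oo) (dual_norm (x' k) * real_norm (y k))%:E < +oo)%E ->
  (forall m, 0 <= a m) -> 0 <= c ->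
  (forall Q (e : nat -> C), (forall m, normc (e m) <= 1) ->
    real_norm (\sum_(0 <= m < Q | P m) ((a m)%:C * e m) *: v m) <= c) ->
  exists2 A : R, 0 <= A &
    forall Q, \sum_(0 <= m < Q | P m) a m * real_norm (T (v m)) <= A.
Proof.
move=> fin a0 c0 H.
have pos k : true -> (0 <= (dual_norm (x' k) * real_norm (y k))%:E)%E.
  by rewrite lee_fin mulr_ge0 ?dual_norm_ge0 ?real_norm_ge0.
have S0 : (0 <= \sum_(0 <= k <oo) (dual_norm (x' k) * real_norm (y k))%:E)%E.
  by apply: nneseries_ge0 => k _; exact: pos.
exists (c * fine (\sum_(0 <= k <oo) (dual_norm (x' k) * real_norm (y k))%:E)%E) => [|Q].
  by rewrite mulr_ge0 ?fine_ge0.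
rewrite -lee_fin EFinM fineK; last by rewrite ge0_fin_numE.
rewrite -sumEFin.
apply: (@le_trans _ _ (\sum_(0 <= m < Q | P m)
   \sum_(0 <= k <oo) (a m * (normc (x' k (v m)) * real_norm (y k)))%:E)%E).
  apply: lee_sum => m _.
  under eq_eseriesr do rewrite EFinM.
  rewrite nneseriesZl; last by move=> k _; rewrite lee_fin mulr_ge0 ?normc_ge0 ?real_norm_ge0.
  rewrite EFinM; apply: lee_pmul; rewrite ?lee_fin ?real_norm_ge0 //.
  exact: nuclear_norm_le.
rewrite -nneseries_sum; last first.
  by move=> m k _; rewrite lee_fin !mulr_ge0 ?normc_ge0 ?real_norm_ge0.
rewrite -nneseriesZl; last exact: pos.
apply: lee_nneseries => [k _ _|k _].
  by apply: sume_ge0 => m _; rewrite lee_fin !mulr_ge0 ?normc_ge0 ?real_norm_ge0.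
rewrite sumEFin -EFinM lee_fin.
under eq_bigr do rewrite mulrA.
rewrite -mulr_suml mulrA ler_wpM2r ?real_norm_ge0 //.
by apply: dual_norm_sum => // e; exact: H.
Qed.

End nuclear_operator.
End nuclear_sums.

Lemma nneseries_partial_le (R : realType) (u : nat -> \bar R) (A : \bar R) :
  (forall k, 0 <= u k)%E -> (forall n, \sum_(0 <= k < n) u k <= A)%E ->
  (\sum_(0 <= k <oo) u k <= A)%E.
Proof.
move=> u0 uA; apply: lime_le; first by apply: is_cvg_nneseries => k _ _; exact: u0.
by apply: nearW => n; exact: uA.
Qed.

(** * Bounding the integrand of (c) by Forelli-Rudin kernels *)

Section sup_kernel.
Variable R : realType.
Local Notation C := R[i].
Implicit Types (nu mu : radial_weight R) (g phi : C -> C).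

Definition op_kernel mu g phi (a : R) z w : R :=
  mu w * normc (derive1 g w) / normc (1 - conjc z * phi w) `^ (a + 2).

Lemma op_kernel_ge0 mu g phi a z w : disk w -> 0 <= op_kernel mu g phi a z w.
Proof.
move=> dw; apply: divr_ge0; last exact: powR_ge0.
by apply: mulr_ge0; rewrite ?normc_ge0 // ltW // weight_gt0.
Qed.

Lemma op_kernel_measurable mu nu g phi a : self_map phi ->
  measurable_fun (@diskp R) (fun p =>
    (ereal_sup [set (op_kernel mu g phi a (plane_pt p) w)%:E | w in @disk R] *
     (tw (plane_pt p) `^ a / nu (plane_pt p))%:E)%E).
Proof.
move=> [_ dphi]; apply: emeasurable_funM; last first.
  apply/measurable_EFinP; apply: (@continuous_disk_measurable _ (fun z => tw z `^ a / nu z)) => z z1.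
  have c1 : {for z, continuous (fun z => tw z `^ a)}.
    apply: (@continuous_comp C R R (@tw R) (fun t => t `^ a) z); first exact: continuous_tw.
    by apply: continuous_powR; exact: tw_gt0.
  have c2 : {for z, continuous (fun z => (nu z)^-1)}.
    apply: (@continuous_comp C R R nu (fun t => t^-1) z); first exact: continuous_weight.
    by apply: inv_continuous; rewrite gt_eqF // weight_gt0.
  exact: (cvgM c1 c2).
apply: (@lsc_sup_measurable R (@disk R) (fun w z => op_kernel mu g phi a z w)) => w z dw z1.
have d0 : 0 < normc (1 - conjc z * phi w) by apply: ker_denom_gt0 (ltW z1) _; exact: dphi.
have c3 : {for z, continuous (fun z => (normc (1 - conjc z * phi w) `^ (a + 2))^-1)}.
  apply: (@continuous_comp C R R _ (fun t => t^-1) z).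
    apply: (@continuous_comp C R R _ (fun t => t `^ (a + 2)) z); first exact: continuous_ker_denom.
    exact: continuous_powR.
  by apply: inv_continuous; rewrite gt_eqF // powR_gt0.
exact: (cvgM (cvg_cst (mu w * normc (derive1 g w))) c3).
Qed.

Lemma fr_series_le nu (a beta gamma : R) : normal_exponent nu beta -> 0 < gamma ->
  almost_decreasing (fun r => nu r%:C / (1 - r ^+ 2) `^ gamma) -> beta - 1 < a ->
  exists2 K : R, 0 < K & forall (t : nat -> R) (q : nat -> C) (A : R),
    (forall m, 0 <= t m) -> (forall m, normc (q m) < 1) ->
    (forall n, \sum_(0 <= m < n) t m / nu (q m) <= A) ->
    (\int[area R]_(p in @diskp R)
       \sum_(0 <= m <oo) (t m * fr_kernel nu a (q m) (plane_pt p))%:E <= (K * A)%:E)%E.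
Proof.
move=> hnu g0 hg ab; have [K K0 HK] := forelli_rudin hnu g0 hg ab.
exists K => // t q A t0 q1 tA.
have md : measurable (@diskp R) by exact: measurable_disk.
have pos m p : diskp p -> (0 <= (t m * fr_kernel nu a (q m) (plane_pt p))%:E)%E.
  by move=> dp; rewrite lee_fin mulr_ge0 // fr_kernel_ge0.
have mt m : measurable_fun (@diskp R) (fun p => (fr_kernel nu a (q m) (plane_pt p))%:E).
  by apply/measurable_EFinP; exact: fr_kernel_measurable.
rewrite integral_nneseries //; last first.
  move=> m; under eq_fun do rewrite EFinM.
  exact: measurable_funeM.
apply: nneseries_partial_le => [m|n]; first by apply: integral_ge0 => p; exact: pos.
apply: (@le_trans _ _ (\sum_(0 <= m < n) (K * (t m / nu (q m)))%:E)%E); last first.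
  by rewrite sumEFin lee_fin -mulr_sumr ler_pM2l.
apply: lee_sum => m _; under eq_integral do rewrite EFinM.
rewrite ge0_integralZl //; last 2 first.
- by move=> p dp; rewrite lee_fin fr_kernel_ge0.
- by rewrite lee_fin.
rewrite mulrCA EFinM; apply: lee_pmul; rewrite ?lee_fin //; last exact: HK.
by apply: integral_ge0 => p dp; rewrite lee_fin fr_kernel_ge0.
Qed.

Lemma ker_denom_sym (z w : C) : normc (1 - conjc z * w) = normc (1 - conjc w * z).
Proof.
rewrite -[LHS]normc_conj rmorphB rmorph1 rmorphM; congr (normc (_ - _)).
by rewrite [RHS]mulrC; congr (_ * _); exact: conjcK.
Qed.

Section nuclear_to_integral.
Variables (nu mu : radial_weight R) (alpha : R) (p : nat) (g phi : C -> C).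
Hypothesis a1 : -1 < alpha.
Hypothesis hg : holomorphic g.
Hypothesis hphi : self_map phi.
Hypothesis Hk : forall z, normc z < 1 -> kfun p.+2 z \in H0_pred nu.
Variable L : H_zero nu -> Bloch mu.
Hypothesis hL : induced_by (T_op g phi) L.

Definition rep_kernel m : H_zero nu := MkH0 (Hk (rep_disk R m)).

Lemma rep_kernel_norm m w : disk w ->
  mu w * normc (derive1 g w) * normc (ker p.+2 (rep R m) (phi w)) <=
  real_norm (L (rep_kernel m)).
Proof.
move=> dw; rewrite (@real_norm_bloch R mu).
apply: ler_wpDl; first exact: normc_ge0.
apply: le_trans (weighted_sup_ub (blochP (L (rep_kernel m))).2 dw).
have hf : holomorphic (eval (rep_kernel m)) := (H0P (rep_kernel m)).1.1.
have E := @induced_derive R mu _ g phi L hg hphi hL (rep_kernel m) w hf dw.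
rewrite [X in _ <= _ * normc X]E (normcM (eval _ _)) -mulrA [normc (derive1 _ _) * _]mulrC.
by rewrite /= /kfun ifT //; exact: hphi.2.
Qed.

Lemma op_kernel_le_rep z w : disk z -> disk w -> exists2 m, sel R m &
  op_kernel mu g phi alpha z w * (tw z `^ alpha / nu z) <=
  84 ^+ p.+2 * 2 `^ (alpha + 2) *
  (cell_mass nu p m * real_norm (L (rep_kernel m)) * nu (rep R m)) *
  fr_kernel nu alpha (rep R m) z.
Proof.
have a2 : 0 <= alpha + 2 by move: a1; lra.
move=> dz dw; pose v := phi w; have dv : disk v by exact: hphi.2.
have [m sm cm] := sel_exists dv; exists m => //; set q := rep R m; set h := mesh R (lev m).
have z1 : normc z < 1 := dz; have v1 : normc v < 1 := dv.
have gm : good R m by case/andP: sm.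
have q1 : normc q < 1 := rep_disk R m.
have [d1 t1 t2] := good_cell_compare gm cm.
have [d2 _] := good_cell_dist gm cm.
have h16 : 16 * h <= 1 - normc q by case/andP: gm.
have hq := sel_mesh sm (cell_rep cm).
have h0 : 0 < h by exact: mesh_gt0.
have nq : 0 < nu q by exact: weight_gt0.
have mw : 0 < mu w by exact: weight_gt0.
(* By [sel_mesh], [tw q <= 2 * (1 - |q|) <= 80 * h], and [phi w] is within [4 * h] of [q]. *)
have D : normc (1 - conjc q * v) <= 84 * h.
  apply: (@le_trans _ _ (tw q + normc (v - q))); last first.
    by have := tw_le (ltW q1); rewrite -/q -/h in d2 hq *; lra.
  have -> : 1 - conjc q * v = (tw q)%:C - conjc q * (v - q).
    have -> : (tw q)%:C = 1 - q * conjc q by rewrite mulcJ /tw rmorphB rmorph1.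
    by ring.
  apply: le_trans (normcD _ _) _; rewrite normcC ger0_norm ?(ltW (tw_gt0 q1)) // lerD2l.
  by rewrite normcN (normcM (conjc q)) normc_conj ler_piMl ?normc_ge0 // ltW.
have D0 := ker_denom_gt0 (ltW q1) v1.
have E1 : mu w * normc (derive1 g w) <= real_norm (L (rep_kernel m)) * (84 * h) ^+ p.+2.
  have b := rep_kernel_norm m dw; rewrite -/q -/v in b.
  have k0 : 0 < normc (ker p.+2 q v) by rewrite normc_ker exprn_gt0 // invr_gt0.
  rewrite -ler_pdivlMr // in b; apply: (le_trans b).
  rewrite ler_wpM2l ?real_norm_ge0 // normc_ker exprVn invrK.
  by apply: lerXn2r; rewrite ?nnegrE ?normc_ge0 ?mulr_ge0 ?(ltW h0).
have E2 : h ^+ p.+2 <= cell_mass nu p m * nu q.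
  rewrite /cell_mass mulfVK ?gt_eqF // -/q -/h -addn2 exprD ler_pM2r ?exprn_gt0 //.
  apply: lerXn2r; rewrite ?nnegrE ?(ltW h0) ?(ltW (tw_gt0 q1)) //.
  by have := tw_ge q1; lra.
have E3 : (normc (1 - conjc z * v) `^ (alpha + 2))^-1 <=
    2 `^ (alpha + 2) * normc (1 - conjc z * q) `^ (- (alpha + 2)).
  have [_ dd] := ker_denom_compare q1 (ltW z1) d1.
  have dz0 := ker_denom_gt0 (ltW z1) v1; have dq0 := ker_denom_gt0 (ltW z1) q1.
  rewrite ker_denom_sym (ker_denom_sym v) -/q in dd.
  have -> : 2 `^ (alpha + 2) * normc (1 - conjc z * q) `^ (- (alpha + 2)) =
      ((2 `^ (alpha + 2))^-1 * normc (1 - conjc z * q) `^ (alpha + 2))^-1.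
    by rewrite powRN [RHS]invfM invrK.
  rewrite lef_pV2 ?posrE ?mulr_gt0 ?invr_gt0 ?powR_gt0 //.
  rewrite ler_pdivrMl ?powR_gt0 // -powRM ?(ltW dz0) //.
  by apply: powR_ge0_le; [exact: a2|exact: normc_ge0|exact: dd].
have b0 := real_norm_ge0 (L (rep_kernel m)).
rewrite /op_kernel -/v /fr_kernel.
have -> : 84 ^+ p.+2 * 2 `^ (alpha + 2) *
    (cell_mass nu p m * real_norm (L (rep_kernel m)) * nu q) *
    (tw z `^ alpha / nu z * normc (1 - conjc z * q) `^ (- (alpha + 2))) =
   (real_norm (L (rep_kernel m)) * (84 ^+ p.+2 * (cell_mass nu p m * nu q))) *
   (2 `^ (alpha + 2) * normc (1 - conjc z * q) `^ (- (alpha + 2))) * (tw z `^ alpha / nu z).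
  by ring.
apply: ler_wpM2r; first by apply: divr_ge0; rewrite ?powR_ge0 // ltW // weight_gt0.
apply: ler_pM; rewrite ?invr_ge0 ?powR_ge0 //; first by apply: mulr_ge0; rewrite ?normc_ge0 // ltW.
apply: (le_trans E1); rewrite ler_wpM2l // exprMn ler_wpM2l // exprn_ge0 //.
Qed.

End nuclear_to_integral.
End sup_kernel.

Section integral_finite.
Variable R : realType.
Local Notation C := R[i].
Variables (nu mu : radial_weight R) (alpha beta gamma : R) (p : nat) (g phi : C -> C).
Hypothesis a1 : -1 < alpha.
Hypothesis hnu : normal_exponent nu beta.
Hypothesis g0 : 0 < gamma.
Hypothesis hdecr : almost_decreasing (fun r => nu r%:C / (1 - r ^+ 2) `^ gamma).
Hypothesis ba : beta - 1 < alpha.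
Hypothesis bp : beta - 1 < p%:R.
Hypothesis hg : holomorphic g.
Hypothesis hphi : self_map phi.

Lemma H0_sum (P : pred nat) (a : nat -> C) (f : nat -> H0 nu) Q w :
  (\sum_(0 <= m < Q | P m) a m *: f m : H0 nu) w = \sum_(0 <= m < Q | P m) a m * f m w.
Proof. exact: (big_morph (fun f : H0 nu => f w)). Qed.

Lemma nuclear_integral_lty : nuclear_from_to (T_op g phi) (H_zero nu) (Bloch mu) ->
  (\int[area R]_(t in @diskp R)
    (ereal_sup [set (op_kernel mu g phi alpha (plane_pt t) w)%:E | w in @disk R] *
     (tw (plane_pt t) `^ alpha / nu (plane_pt t))%:E) < +oo)%E.
Proof.
move=> [L hL [x' [y [cx sxy cv]]]].
have Hk z : normc z < 1 -> kfun p.+2 z \in H0_pred nu by exact: kfun_H0 g0 hdecr.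
have [c c0 Hc] := cell_mass_sum hnu g0 hdecr bp.
have test Q (e : nat -> C) : (forall m, normc (e m) <= 1) ->
    real_norm (\sum_(0 <= m < Q | sel R m) ((cell_mass nu p m)%:C * e m) *: rep_kernel Hk m) <= c.
  move=> e1; rewrite (@real_norm_H0 R nu); apply: weighted_sup_le => w dw.
  rewrite H0_sum; apply: le_trans (Hc Q w dw).
  rewrite ler_wpM2l ?(ltW (weight_gt0 _ dw)) //.
  apply: (@le_trans _ _ (\sum_(0 <= m < Q | sel R m)
      normc ((cell_mass nu p m)%:C * e m * rep_kernel Hk m w))).
    elim/big_rec2: _ => [|m x z _ xz]; first by rewrite normc0.
    by apply: le_trans (normcD _ _) _; rewrite lerD2l.
  apply: ler_sum => m _; rewrite (normcM (_ * e m)) (normcM _%:C) normcC.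
  rewrite ger0_norm ?(ltW (cell_mass_gt0 nu p m)) // -mulrA.
  rewrite ler_pM2l ?cell_mass_gt0 // /= /kfun ifT //.
  by rewrite ler_piMl ?normc_ge0.
have [A A0 HA] := @nuclear_test_sum R (H_zero nu) (Bloch mu) L x' y cx cv (@sel R)
  (cell_mass nu p) (rep_kernel Hk) c sxy (fun m => ltW (cell_mass_gt0 nu p m)) (ltW c0) test.
have [K K0 HK] := fr_series_le hnu g0 hdecr ba.
pose c1 : R := 84 ^+ p.+2 * 2 `^ (alpha + 2).
have c10 : 0 <= c1 by rewrite mulr_ge0 ?powR_ge0 ?exprn_ge0.
(* The factor [nu (rep R m)] cancels the [1 / nu] that Forelli-Rudin produces, which leaves the test
   sums bounded by [A]. *)
pose t m : R := if sel R m
  then c1 * (cell_mass nu p m * real_norm (L (rep_kernel Hk m)) * nu (rep R m)) else 0.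
have t0 m : 0 <= t m.
  rewrite /t; case: ifP => // _; apply: mulr_ge0 => //; apply: mulr_ge0.
    by apply: mulr_ge0; [exact: ltW (cell_mass_gt0 nu p m)|exact: real_norm_ge0].
  by apply: ltW; apply: weight_gt0; exact: rep_disk.
have tA n : \sum_(0 <= m < n) t m / nu (rep R m) <= c1 * A.
  apply: le_trans (ler_wpM2l c10 (HA n)).
  rewrite mulr_sumr [leRHS]big_mkcond /=; apply: ler_sum => m _; rewrite /t.
  case: ifP => _; last by rewrite mul0r.
  by rewrite mulrA mulfK // gt_eqF // weight_gt0 //; exact: rep_disk.
apply: le_lt_trans (ltry (K * (c1 * A))).
apply: le_trans (HK t (@rep R) (c1 * A) t0 (@rep_disk R) tA).
apply: ge0_le_integral.
- exact: measurable_disk.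
- move=> s ds; apply: mule_ge0; last first.
    by rewrite lee_fin divr_ge0 ?powR_ge0 // ltW // weight_gt0.
  apply: (@le_trans _ _ (op_kernel mu g phi alpha (plane_pt s) 0)%:E).
    by rewrite lee_fin op_kernel_ge0 //; exact: disk0.
  by apply: ereal_sup_ubound; exists 0 => //; exact: disk0.
- exact: op_kernel_measurable.
- apply: ge0_emeasurable_sum => [m s ds _|m _].
    by rewrite lee_fin mulr_ge0 // fr_kernel_ge0.
  apply/measurable_EFinP; apply: measurable_funM => //.
  by apply: fr_kernel_measurable; exact: rep_disk.
move=> s ds; set z := plane_pt s; have dz : disk z := ds.
have k0 : 0 < tw z `^ alpha / nu z by rewrite divr_gt0 ?powR_gt0 ?tw_gt0 ?weight_gt0.
rewrite muleC -lee_pdivlMl //; apply: ge_ereal_sup => _ [w dw <-].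
rewrite lee_pdivlMl //.
(* Each [w] is served by a single term of a series of nonnegative terms, so the whole series
   dominates the supremum. *)
have [m sm hm] := op_kernel_le_rep a1 hg hphi Hk hL dz dw.
apply: (@le_trans _ _ (t m * fr_kernel nu alpha (rep R m) z)%:E).
  by rewrite -EFinM lee_fin mulrC /t sm; exact: hm.
apply: (@le_trans _ _ (\sum_(0 <= k < m.+1) (t k * fr_kernel nu alpha (rep R k) z)%:E)%E).
  rewrite big_nat_recr //= leeDr // sume_ge0 // => k _.
  by rewrite lee_fin mulr_ge0 // fr_kernel_ge0.
by apply: nneseries_lim_ge => k _ _; rewrite lee_fin mulr_ge0 // fr_kernel_ge0.
Qed.

End integral_finite.

(** * From the integral condition to nuclearity *)

Section cint_cells.
Context d (T : measurableType d) (R : realType) (mu : {measure set T -> \bar R}).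
Local Notation C := R[i].
Implicit Types (D E : set T) (F : T -> C).

Lemma cint_if D E F : E `<=` D ->
  cint mu D (fun t => if t \in E then F t else 0) = cint mu E F.
Proof.
move=> ED; have aux (h : T -> R) (G : T -> R) : (forall t, G t = if t \in E then h t else 0) ->
    \int[mu]_(t in D) G t = \int[mu]_(t in E) h t.
  move=> hG; rewrite /Rintegral; congr fine.
  rewrite -[in RHS](setIidr ED) integral_mkcondr; apply: eq_integral => t _.
  by rewrite hG patchE; case: ifP.
by rewrite /cint; congr (_ +i* _); apply: aux => t; case: ifP.
Qed.

Lemma cintegrable_if D E F : measurable D -> measurable E -> E `<=` D ->
  cintegrable mu D F -> cintegrable mu D (fun t => if t \in E then F t else 0).
Proof.
move=> mD mE ED iF; have aux (h : T -> R) (G : T -> R) :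
    (forall t, G t = if t \in E then h t else 0) ->
    mu.-integrable D (EFin \o h) -> mu.-integrable D (EFin \o G).
  move=> hG ih; have hE : EFin \o G = (EFin \o h) \_ E.
    by apply/funext => t /=; rewrite hG patchE; case: ifP.
  rewrite hE; apply: (integrableS measurableT mD) => //.
  by apply/(integrable_mkcond _ mE); exact: integrableS ih.
by split; [apply: aux iF.1|apply: aux iF.2] => t; case: ifP.
Qed.

Lemma cint_sum D (F : nat -> T -> C) Q : measurable D -> (mu D < +oo)%E ->
  (forall m, cintegrable mu D (F m)) ->
  cintegrable mu D (fun t => \sum_(0 <= m < Q) F m t) /\
  cint mu D (fun t => \sum_(0 <= m < Q) F m t) = \sum_(0 <= m < Q) cint mu D (F m).
Proof.
move=> mD fD iF; elim: Q => [|Q [IH1 IH2]].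
  rewrite big_geq //; have E : (fun t => \sum_(0 <= m < 0) F m t) = fun=> 0.
    by apply/funext => t; rewrite big_geq.
  by rewrite E; split; [exact: cintegrable_cst|rewrite cint_cst // mul0r].
have E : (fun t => \sum_(0 <= m < Q.+1) F m t) = fun t => \sum_(0 <= m < Q) F m t + F Q t.
  by apply/funext => t; rewrite big_nat_recr.
by rewrite E big_nat_recr //= -IH2; split; [exact: cintegrableD|exact: cintD].
Qed.

End cint_cells.

(** * Expanding a function along the dyadic squares *)

Section cell_expansion.
Variable R : realType.
Local Notation C := R[i].
Implicit Types (z w v : C) (f : C -> C) (nu : radial_weight R).

(** The value 0 on bad squares makes the telescoping sum start from 0 at generation 0. *)
Definition khat M m v : C := if good R m then kfun M (rep R m) v else 0.

(* Along the squares containing a point [z] these differences telescope to the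
   kernel at [z]. *)
Definition kdiff M m v : C := khat M m v - khat M (par R m) v.

Definition cell_coef n f m : C := ((tw_mass R n.+1)^-1)%:C *
  cint (area R) (cellp m) (fun p => f (plane_pt p) * (tw (plane_pt p))%:C ^+ n.+1).

Lemma kdiff_telescope M z v K : disk z ->
  \sum_(0 <= n < K.+1) kdiff M (code n z) v = khat M (code K z) v.
Proof.
have bad z' : disk z' -> khat M (code 0 z') v = 0.
  by move=> dz'; rewrite /khat (negbTE (code0_bad dz')).
move=> dz; elim: K => [|K IH].
  by rewrite big_nat1 /kdiff !bad ?subr0 ///par lev_code // bad ?subr0 //; exact: rep_disk.
by rewrite big_nat_recr //= IH /kdiff par_code // addrC subrK.
Qed.

Lemma khat_bounded M m v : normc v < 1 -> normc (khat M m v) <= (1 - normc v)^-1 ^+ M.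
Proof.
move=> v1; rewrite /khat; case: ifP => _; last first.
  by rewrite normc0 exprn_ge0 // invr_ge0 subr_ge0 ltW.
by rewrite /kfun ifT // normc_ker_le //; apply: ltW; exact: rep_disk.
Qed.

Lemma khat_cvg M z v : disk z -> normc v < 1 -> forall e : R, 0 < e ->
  exists K0, forall K, (K0 <= K)%N -> normc (khat M (code K z) v - ker M z v) <= e.
Proof.
move=> dz v1 e e0; have z1 : normc z < 1 := dz.
have sz : 0 < 1 - normc z by rewrite subr_gt0.
have M0 : 0 <= M%:R * 2 ^+ M * 4 :> R.
  by apply: mulr_ge0 => //; apply: mulr_ge0; rewrite ?ler0n ?exprn_ge0.
pose c : R := (M%:R * 2 ^+ M * 4) * normc (ker M z v) / (1 - normc z) * 4.
have c0 : 0 <= c.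
  apply: mulr_ge0 => //; apply: divr_ge0; last exact: ltW.
  by apply: mulr_ge0; [exact: M0|exact: normc_ge0].
have [n1 h1] : exists n, mesh R n < (1 - normc z) / 20 by apply: mesh_small; rewrite divr_gt0.
have [n2 h2] : exists n, mesh R n < e / (c + 1).
  by apply: mesh_small; rewrite divr_gt0 // ltr_wpDl.
exists (maxn n1 n2) => K; rewrite geq_max => /andP[k1 k2].
have m1 := mesh_mono R k1; have m2 := mesh_mono R k2.
have g : good R (code K z) by apply: good_code_mesh => //; lra.
have q1 : normc (rep R (code K z)) < 1 := rep_disk R _.
rewrite /khat g /kfun ifT //.
have cz := cell_code K dz; have [d _ _] := good_cell_compare g cz.
have [h _] := ker_denom_compare q1 (ltW v1) d.
apply: le_trans (ker_diff M z1 q1 z1 v1 h _) _; first by rewrite ler_peMl ?normc_ge0 // ler1n.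
have dd : normc (rep R (code K z) - z) <= 4 * mesh R K.
  by rewrite -normcN opprB; exact: code_rep_dist.
apply: (@le_trans _ _ (c * mesh R K)).
  rewrite /c; have -> : M%:R * 2 ^+ M * 4 * normc (ker M z v) / (1 - normc z) * 4 * mesh R K =
      M%:R * 2 ^+ M * 4 * (4 * mesh R K / (1 - normc z)) * normc (ker M z v).
    by ring.
  rewrite ler_wpM2r ?normc_ge0 // ler_wpM2l //.
  by rewrite ler_wpM2r // invr_ge0 ltW.
have m0 := mesh_gt0 R K.
apply: (@le_trans _ _ ((c + 1) * mesh R K)); first by rewrite ler_wpM2r ?(ltW m0) // lerDl.
by rewrite -ler_pdivlMl ?ltr_wpDl // mulrC; lra.
Qed.

Section expansion.
Variables (nu : radial_weight R) (f : C -> C) (B : R) (n : nat).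
Hypothesis twB : forall z, normc z < 1 -> tw z ^+ n.+1 <= B * nu z.
Hypothesis hf : holomorphic f.
Hypothesis bf : weighted_bounded nu f.

Lemma weighted_bound_pt z : normc z < 1 ->
  normc (f z) * tw z ^+ n.+1 <= tw z ^+ n.+1 / nu z * weighted_sup nu f.
Proof.
move=> z1; have nz : 0 < nu z by exact: weight_gt0.
rewrite mulrC -mulrA ler_wpM2l ?exprn_ge0 ?(ltW (tw_gt0 z1)) //.
by rewrite ler_pdivlMl //; exact: weighted_sup_ub.
Qed.

Lemma weighted_sup_ge0 : 0 <= weighted_sup nu f.
Proof.
apply: le_trans (weighted_sup_ub bf (@disk0 R)).
by rewrite mulr_ge0 ?normc_ge0 // ltW // weight_gt0 //; exact: disk0.
Qed.

Lemma weighted_bound_cst z : normc z < 1 ->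
  normc (f z * (tw z)%:C ^+ n.+1) <= B * weighted_sup nu f.
Proof.
move=> z1; rewrite (normcM (f z)) normc_twX //.
apply: (le_trans (weighted_bound_pt z1)); rewrite ler_wpM2r ?weighted_sup_ge0 //.
by rewrite ler_pdivrMr ?weight_gt0 // twB.
Qed.

Lemma weighted_integrable :
  cintegrable (area R) (@diskp R) (fun p => f (plane_pt p) * (tw (plane_pt p))%:C ^+ n.+1).
Proof.
apply: (disk_integrable (F := fun z => f z * (tw z)%:C ^+ n.+1)
  (M := B * weighted_sup nu f)) => z z1; last exact: weighted_bound_cst.
by apply: continuousCM; [exact: holomorphic_continuous|exact: continuous_twX].
Qed.

(** The codes below [4 ^ K.+1] exhaust the generations from 0 to [K]. Their differences telescope to
    the kernel frozen at the representative of the square of generation [K], so the partial sum is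
    an integral against a step function in [z]. *)
Lemma cell_partial_sum K v :
  let F p := (khat n.+3 (code K (plane_pt p)) v) *
      (f (plane_pt p) * (tw (plane_pt p))%:C ^+ n.+1) in
  cintegrable (area R) (@diskp R) F /\
  \sum_(0 <= m < 4 ^ K.+1) cell_coef n f m * kdiff n.+3 m v =
  ((tw_mass R n.+1)^-1)%:C * cint (area R) (@diskp R) F.
Proof.
move=> F; have mD : measurable (@diskp R) by exact: measurable_disk.
have iW := weighted_integrable.
pose G m p : C := kdiff n.+3 m v * (if p \in cellp m then
   f (plane_pt p) * (tw (plane_pt p))%:C ^+ n.+1 else 0).
have iI m : cintegrable (area R) (@diskp R) (fun p => if p \in cellp m then
   f (plane_pt p) * (tw (plane_pt p))%:C ^+ n.+1 else 0).
  by apply: cintegrable_if => //; [exact: measurable_cell|exact: cellp_diskp].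
have iG m : cintegrable (area R) (@diskp R) (G m) by exact: cintegrableZ.
have [iS ES] := cint_sum (4 ^ K.+1) mD (area_disk_lty R) iG.
have FG p : diskp p -> \sum_(0 <= m < 4 ^ K.+1) G m p = F p.
  move=> dp; rewrite /F -(kdiff_telescope _ v K dp) -(block_sum (fun m => kdiff n.+3 m v) _ dp).
  rewrite mulr_suml; apply: eq_bigr => m _; rewrite /G.
  have -> : (p \in cellp m) = (m == code (lev m) (plane_pt p)).
    by apply/idP/eqP => [/set_mem[_ h]|h]; [by rewrite h|apply/mem_set; split => //; exact: esym h].
  by case: ifP; rewrite ?mulr0 ?mul0r.
split; first by apply: eq_cintegrable iS.
have -> : cint (area R) (@diskp R) F =
    cint (area R) (@diskp R) (fun p => \sum_(0 <= m < 4 ^ K.+1) G m p).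
  by apply: eq_cint => p dp; rewrite FG.
rewrite ES mulr_sumr.
apply: eq_bigr => m _; rewrite /G cintZ // cint_if; last exact: cellp_diskp.
by rewrite /cell_coef mulrA mulrAC.
Qed.

Lemma cell_expansion v : normc v < 1 -> forall e : R, 0 < e -> exists K0, forall K, (K0 <= K)%N ->
  normc (\sum_(0 <= m < 4 ^ K.+1) cell_coef n f m * kdiff n.+3 m v - f v) <= e.
Proof.
move=> v1 e e0; have c0 := tw_mass_gt0 R n.+1.
have mD : measurable (@diskp R) by exact: measurable_disk.
pose F K p := khat n.+3 (code K (plane_pt p)) v *
      (f (plane_pt p) * (tw (plane_pt p))%:C ^+ n.+1).
pose F0 (p : plane R) := ker n.+3 (plane_pt p) v * (f (plane_pt p) * (tw (plane_pt p))%:C ^+ n.+1).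
pose A : R := (1 - normc v)^-1 ^+ n.+3.
pose W : R := B * weighted_sup nu f.
have A0 : 0 <= A by rewrite exprn_ge0 // invr_ge0 subr_ge0 ltW.
have hW z : normc z < 1 -> normc (f z * (tw z)%:C ^+ n.+1) <= W by exact: weighted_bound_cst.
have W0 : 0 <= W by apply: le_trans (hW 0 (@disk0 R)); exact: normc_ge0.
have iF K := (cell_partial_sum K v).1.
have cF0 z : normc z < 1 -> {for z, continuous (fun z => ker n.+3 z v * (f z * (tw z)%:C ^+ n.+1))}.
  move=> z1; apply: continuousCM; first exact: continuous_ker.
  by apply: continuousCM; [exact: holomorphic_continuous|exact: continuous_twX].
have [|||||||K0 HK] := @cint_dct R _ _ (area R) (@diskp R) F F0 (fun=> A * W) mD
  _ _ _ _ _ _ _ (tw_mass R n.+1 * e) (mulr_gt0 c0 e0).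
- by move=> K; apply/measurable_EFinP; case: (iF K) => /measurable_int.
- by move=> K; apply/measurable_EFinP; case: (iF K) => _ /measurable_int.
- exact: disk_measurable_Re cF0.
- exact: disk_measurable_Im cF0.
- move=> p dp e1 e10; have z1 : normc (plane_pt p) < 1 := dp.
  have eW : 0 < e1 / (W + 1) by rewrite divr_gt0 // ltr_wpDl.
  have [K0 HK] := khat_cvg n.+3 dp v1 eW; exists K0 => K kK.
  rewrite /F /F0 -mulrBl (normcM (khat _ _ _ - _)).
  apply: (@le_trans _ _ (e1 / (W + 1) * W)).
    by apply: ler_pM; rewrite ?normc_ge0 ?HK ?hW.
  by rewrite mulrAC ler_pdivrMr ?ltr_wpDl // ler_pM2l // lerDl.
- move=> K p dp; rewrite /F (normcM (khat _ _ _)); apply: ler_pM; rewrite ?normc_ge0 //.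
    exact: khat_bounded.
  exact: hW.
- by apply: integrable_cst_lty => //; exact: area_disk_lty.
exists K0 => K /HK hK; have [_ ->] := cell_partial_sum K v.
have E0 : cint (area R) (@diskp R) F0 = f v * (tw_mass R n.+1)%:C.
  rewrite -(reproducing twB hf bf v1); apply: eq_cint => p _; rewrite /F0.
  by rewrite mulrC -mulrA.
have cc : (tw_mass R n.+1)%:C * ((tw_mass R n.+1)^-1)%:C = 1 :> C.
  by rewrite -rmorphM divff ?rmorph1 // gt_eqF.
have -> : f v = ((tw_mass R n.+1)^-1)%:C * cint (area R) (@diskp R) F0.
  by rewrite E0 mulrC -mulrA cc mulr1.
rewrite -mulrBr (normcM _%:C) normcC ger0_norm ?invr_ge0 ?(ltW c0) //.
by rewrite ler_pdivrMl.
Qed.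

End expansion.
End cell_expansion.

(** * Size of the kernel differences *)

Section cell_weights.
Variable R : realType.
Local Notation C := R[i].
Implicit Types (z w v : C) (nu mu : radial_weight R) (g phi : C -> C).

Definition cell_ratio m z : R := if good R m then mesh R (lev m) / (1 - normc z) else 0.

Lemma cell_ratio_ge0 m z : normc z < 1 -> 0 <= cell_ratio m z.
Proof.
move=> z1; rewrite /cell_ratio; case: ifP => // _.
by rewrite divr_ge0 ?(ltW (mesh_gt0 _ _)) // subr_ge0 ltW.
Qed.

(** As [mesh n = 2 * mesh n - 2 * mesh n.+1], the terms telescope once the mesh is at most [t]; the
    maximum with 0 carries the induction through the earlier generations. *)
Lemma mesh_sum (t : R) K :
  \sum_(0 <= n < K) (if mesh R n <= t then mesh R n else 0) <= Num.max 0 (2 * t - 2 * mesh R K).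
Proof.
elim: K => [|K IH]; first by rewrite big_geq // le_max lexx.
rewrite big_nat_recr //=; have := mesh_gt0 R K; have := meshS R K.
move=> hS hK; have [h|h] := leP (mesh R K) t.
  have hm : Num.max 0 (2 * t - 2 * mesh R K) <= 2 * t - 2 * mesh R K.
    by rewrite ge_max lexx andbT; lra.
  by rewrite le_max; apply/orP; right; have := le_trans IH hm; lra.
rewrite addr0 le_max; apply/orP; left; apply: (le_trans IH).
by rewrite ge_max lexx; lra.
Qed.

(** A good square containing [z] has [12 * mesh <= 1 - |z|], so the meshes add up to at most a sixth
    of [1 - |z|]. *)
Lemma cell_ratio_sum z K : disk z -> \sum_(0 <= n < K) cell_ratio (code n z) z <= 1.
Proof.
move=> dz; have z1 : normc z < 1 := dz; have sz : 0 < 1 - normc z by rewrite subr_gt0.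
apply: (@le_trans _ _ ((\sum_(0 <= n < K)
    (if mesh R n <= (1 - normc z) / 12 then mesh R n else 0)) / (1 - normc z))).
  rewrite mulr_suml; apply: ler_sum => n _; rewrite /cell_ratio lev_code //.
  case: ifP => g; last by case: ifP => _; rewrite ?mul0r // divr_ge0 ?(ltW (mesh_gt0 _ _)) // ltW.
  have [_] := good_cell_dist g (cell_code n dz); rewrite lev_code // => h.
  by rewrite ifT //; lra.
rewrite ler_pdivrMr // mul1r; apply: (le_trans (mesh_sum _ _)).
rewrite ge_max (ltW sz) /=; have := mesh_gt0 R K; lra.
Qed.

(** On a bad square the parent is bad too and the difference is 0. If both are good, their
    representatives are at most [12 h] apart and [ker_diff] applies. On a maximal good square the
    difference is the kernel itself, with no cancellation, but there [1 - |z| <= 40 h]. *)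
Lemma kdiff_bound M : exists2 c : R, 0 <= c & forall m z v, cell m z -> normc v < 1 ->
  normc (kdiff M m v) <= c * cell_ratio m z * normc (ker M z v).
Proof.
have c10 : 0 <= M%:R * 2 ^+ M * 4 :> R.
  by apply: mulr_ge0 => //; apply: mulr_ge0; rewrite ?ler0n ?exprn_ge0.
have c20 : 0 <= 2 ^+ M * 40 :> R by apply: mulr_ge0; rewrite ?exprn_ge0.
exists (M%:R * 2 ^+ M * 4 * 12 + 2 ^+ M * 40) => [|m z v cz v1].
  by apply: addr_ge0 => //; apply: mulr_ge0.
have dz : disk z := cz.1; have z1 : normc z < 1 := dz.
have sz : 0 < 1 - normc z by rewrite subr_gt0.
have k0 : 0 <= normc (ker M z v) by exact: normc_ge0.
have mE : m = code (lev m) z by rewrite cz.2.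
have parE n : lev m = n.+1 -> par R m = code n z by move=> e; rewrite mE e par_code.
have par_good : good R (par R m) -> good R m.
  case E : (lev m) => [|n]; last by rewrite mE E par_code //; exact: good_codeS.
  by rewrite /par E (negbTE (code0_bad (rep_disk R m))).
rewrite /kdiff /khat /cell_ratio; case: ifP => g; last first.
  by rewrite ifF ?subr0 ?normc0 ?mulr0 ?mul0r //; apply: contraFF g; exact: par_good.
have m0 := mesh_gt0 R (lev m); set h := mesh R (lev m) in m0 *.
have q1 : normc (rep R m) < 1 := rep_disk R m.
have [d _ _] := good_cell_compare g cz; have [dq _] := good_cell_dist g cz.
have [hq hq'] := ker_denom_compare q1 (ltW v1) d.
have r0 : 0 <= h / (1 - normc z) by rewrite divr_ge0 // ltW.
rewrite /kfun v1; case: ifP => pg.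
  have [n lm] : exists n, lev m = n.+1.
    case E : (lev m) pg => [|n]; last by exists n.
    by rewrite /par E (negbTE (code0_bad (rep_disk R m))).
  have pE := parE n lm; have cz' : cell (par R m) z by rewrite pE; exact: cell_code.
  have [d' _ _] := good_cell_compare pg cz'; have [dq' _] := good_cell_dist pg cz'.
  have p1 : normc (rep R (par R m)) < 1 := rep_disk R _.
  have [hp _] := ker_denom_compare p1 (ltW v1) d'.
  apply: (le_trans (ker_diff M z1 q1 p1 v1 hq hp)); apply: ler_wpM2r => //.
  apply: (@le_trans _ _ (M%:R * 2 ^+ M * 4 * 12 * (h / (1 - normc z)))).
    rewrite -[leRHS]mulrA ler_wpM2l // mulrA ler_wpM2r ?invr_ge0 ?(ltW sz) //.
    have -> : rep R m - rep R (par R m) = (z - rep R (par R m)) - (z - rep R m) by ring.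
    apply: (le_trans (normcD _ _)); rewrite normcN.
    have lp : mesh R (lev (par R m)) = 2 * h by rewrite pE lev_code // meshS /h lm.
    by rewrite lp in dq'; rewrite -/h in dq; lra.
  by rewrite ler_wpM2r // lerDl.
have sm : sel R m by rewrite /sel g pg.
have hs := sel_mesh sm cz; rewrite -/h in hs.
rewrite subr0; apply: (@le_trans _ _ (2 ^+ M * normc (ker M z v))).
  rewrite !normc_ker -exprMn; apply: lerXn2r.
  - by rewrite nnegrE invr_ge0 normc_ge0.
  - by rewrite nnegrE mulr_ge0 // invr_ge0 normc_ge0.
  have dz0 := ker_denom_gt0 (ltW z1) v1; have dq0 := ker_denom_gt0 (ltW q1) v1.
  by rewrite -ler_pdivrMl // -invfM lef_pV2 ?posrE ?mulr_gt0.
apply: ler_wpM2r => //; rewrite mulrDl.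
apply: (@le_trans _ _ (2 ^+ M * 40 * (h / (1 - normc z)))).
  by rewrite -mulrA ler_peMr ?exprn_ge0 // mulrA ler_pdivlMr // mul1r.
by rewrite lerDr; apply: mulr_ge0 => //; apply: mulr_ge0.
Qed.

(** The quotient [tw z / |1 - conj z * v|] is at most 2, so its surplus power [p - alpha] is
    bounded. *)
Lemma ker_tw_power (alpha : R) p z v : -1 < alpha -> alpha <= p%:R -> normc z < 1 -> normc v < 1 ->
  normc (ker p.+2 z v) * tw z ^+ p <=
  2 `^ (p%:R - alpha) * (tw z `^ alpha / normc (1 - conjc z * v) `^ (alpha + 2)).
Proof.
move=> a1 ap z1 v1; have t0 := tw_gt0 z1; have d0 := ker_denom_gt0 (ltW z1) v1.
have [td _] := ker_denom_ge_tw z1 v1.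
have b0 : 0 <= p%:R - alpha by lra.
have -> : tw z ^+ p = tw z `^ alpha * tw z `^ (p%:R - alpha).
  by rewrite -powRDp // addrC subrK powR_mulrn // ltW.
have -> : normc (ker p.+2 z v) =
    (normc (1 - conjc z * v) `^ (alpha + 2))^-1 * (normc (1 - conjc z * v) `^ (p%:R - alpha))^-1.
  rewrite normc_ker exprVn -invfM -powRDp //.
  have -> : alpha + 2 + (p%:R - alpha) = p.+2%:R by rewrite -addn2 natrD; ring.
  by rewrite powR_mulrn // ltW.
set D := normc _ in td d0 *.
have h : tw z `^ (p%:R - alpha) / D `^ (p%:R - alpha) <= 2 `^ (p%:R - alpha).
  rewrite ler_pdivrMr ?powR_gt0 // -powRM ?(ltW d0) //.
  by apply: powR_ge0_le => //; [exact: ltW|lra].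
have -> : (D `^ (alpha + 2))^-1 * (D `^ (p%:R - alpha))^-1 * (tw z `^ alpha * tw z `^ (p%:R - alpha)) =
  tw z `^ (p%:R - alpha) / D `^ (p%:R - alpha) * (tw z `^ alpha / D `^ (alpha + 2)) by ring.
by apply: ler_wpM2r => //; apply: divr_ge0; exact: powR_ge0.
Qed.

End cell_weights.

Lemma nneseries_tail_small (R : realType) (u : nat -> R) : (forall k, 0 <= u k) ->
  (\sum_(0 <= k <oo) (u k)%:E < +oo)%E -> forall e : R, 0 < e ->
  exists Q0, forall Q Q', (Q0 <= Q)%N -> \sum_(Q <= k < Q') u k <= e.
Proof.
move=> u0 fin e e0.
have u0' k : true -> (0 <= (u k)%:E)%E by rewrite lee_fin.
have /fine_cvgP[_ /cvgrPdist_le/(_ e e0)[Q0 _ H]] := nneseries_tail_cvg fin u0'.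
exists Q0 => Q Q' QQ; have := H Q QQ; rewrite /= sub0r normrN.
have tfin : (\sum_(Q <= k <oo) (u k)%:E)%E \is a fin_num.
  rewrite ge0_fin_numE; last by apply: nneseries_ge0 => k _ _; exact: u0'.
  apply: le_lt_trans fin; rewrite (nneseries_split 0 Q) => [|k _]; last exact: u0'.
  by rewrite leeDr // sume_ge0.
move=> h; rewrite -lee_fin -sumEFin.
apply: (@le_trans _ _ (\sum_(Q <= k <oo) (u k)%:E)%E).
  by apply: nneseries_lim_ge => k _ _; exact: u0'.
by rewrite -(fineK tfin) lee_fin; apply: le_trans h; exact: ler_norm.
Qed.

(** * The nuclear representation of the operator *)

Section integral_to_nuclear.
Variable R : realType.
Local Notation C := R[i].
Variables (nu mu : radial_weight R) (alpha B : R) (n : nat) (g phi : C -> C).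
Hypothesis a1 : -1 < alpha.
Hypothesis ap : alpha <= n.+1%:R.
Hypothesis twB : forall z, normc z < 1 -> tw z ^+ n.+1 <= B * nu z.
Hypothesis hg : holomorphic g.
Hypothesis hphi : self_map phi.
Hypothesis Hk : forall z, normc z < 1 -> kfun n.+3 z \in H0_pred nu.
Variable L : {linear H_infty nu -> Bloch mu}.
Hypothesis hL : induced_by (T_op g phi) L.

Lemma op_norm_le (h : H_infty nu) (b : R) :
  (forall w, disk w -> mu w * (normc (eval h (phi w)) * normc (derive1 g w)) <= b) ->
  real_norm (L h) <= b.
Proof.
move=> H; rewrite (@real_norm_bloch R mu).
have E0 := @induced_at0 R mu _ g phi L hL h.
rewrite [X in normc X + _]E0 normc0 add0r; apply: weighted_sup_le => w dw.
have E := @induced_derive R mu _ g phi L hg hphi hL h w (HinfP h).1.1 dw.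
by rewrite [X in _ * normc X]E (normcM (eval _ _)); exact: H.
Qed.

Lemma op_norm_ge (h : H_infty nu) w : disk w ->
  mu w * (normc (eval h (phi w)) * normc (derive1 g w)) <= real_norm (L h).
Proof.
move=> dw; rewrite (@real_norm_bloch R mu); apply: ler_wpDl; first exact: normc_ge0.
apply: le_trans (weighted_sup_ub (blochP (L h)).2 dw).
have E := @induced_derive R mu _ g phi L hg hphi hL h w (HinfP h).1.1 dw.
by rewrite [X in _ <= _ * normc X]E (normcM (eval _ _)).
Qed.

Definition khat_elt m : H_infty nu :=
  if good R m then H0_incl (MkH0 (Hk (rep_disk R m))) else 0.

Definition kdiff_elt m : H_infty nu := khat_elt m - khat_elt (par R m).

Lemma kdiff_eltE m v : eval (kdiff_elt m) v = kdiff n.+3 m v.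
Proof.
have E k : eval (khat_elt k) v = khat n.+3 k v by rewrite /khat_elt /khat; case: ifP.
by rewrite /kdiff -!E.
Qed.

Lemma Hinf_sum (c : nat -> C) (f : nat -> Hinf nu) Q w :
  (\sum_(0 <= m < Q) c m *: f m : Hinf nu) w = \sum_(0 <= m < Q) c m * f m w.
Proof. exact: (big_morph (fun f : Hinf nu => f w)). Qed.

Let mD : measurable (@diskp R) := @measurable_disk R.
Let mC m : measurable (@cellp R m) := @measurable_cell R m.

Definition cell_fun m (f : Hinf nu) : C := cell_coef n f m.

Lemma cell_fun_linear m : linear (cell_fun m).
Proof.
move=> c f h.
have iW (k : Hinf nu) : cintegrable (area R) (cellp m)
    (fun p => k (plane_pt p) * (tw (plane_pt p))%:C ^+ n.+1).
  have [hk bk] := HinfP k.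
  exact: cintegrableS (mC m) mD (@cellp_diskp R m) (weighted_integrable twB hk.1 bk).
rewrite /cell_fun /cell_coef.
have -> : cint (area R) (cellp m) (fun p => (c *: f + h : Hinf nu) (plane_pt p) * (tw (plane_pt p))%:C ^+ n.+1) =
  cint (area R) (cellp m) (fun p => c * (f (plane_pt p) * (tw (plane_pt p))%:C ^+ n.+1) +
     h (plane_pt p) * (tw (plane_pt p))%:C ^+ n.+1).
  by apply: eq_cint => p _; rewrite mulrA -mulrDl.
rewrite cintD //; last exact: cintegrableZ.
by rewrite cintZ // -[_ *: _]/(_ * _); ring.
Qed.

Definition cell_functional m : {linear H_infty nu -> C} :=
  HB.pack_for {linear H_infty nu -> C} (cell_fun m)
    (GRing.isLinear.Build C (Hinf nu) C *:%R (cell_fun m) (cell_fun_linear m)).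

(** Up to the constant [c2], an upper bound for the dual norm of the coefficient functional. *)
Definition weight_mass m : R := \int[area R]_(p in cellp m) (tw (plane_pt p) ^+ n.+1 / nu (plane_pt p)).

Lemma weight_ratio_integrable :
  (area R).-integrable (@diskp R) (fun p => (tw (plane_pt p) ^+ n.+1 / nu (plane_pt p))%:E).
Proof.
apply: (@le_integrable _ _ _ _ _ mD _ (fun=> B%:E)).
- apply/measurable_EFinP.
  apply: (@continuous_disk_measurable _ (fun z => tw z ^+ n.+1 / nu z)) => z z1.
  have c1 : {for z, continuous (fun z => tw z ^+ n.+1)}.
    apply: (@continuous_comp C R R (@tw R) (fun t => t ^+ n.+1) z); first exact: continuous_tw.
    exact: exprn_continuous.
  have c2 : {for z, continuous (fun z => (nu z)^-1)}.
    apply: (@continuous_comp C R R nu (fun t => t^-1) z); first exact: continuous_weight.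
    by apply: inv_continuous; rewrite gt_eqF // weight_gt0.
  exact: (cvgM c1 c2).
- move=> p dp; have n0 : 0 < nu (plane_pt p) by exact: weight_gt0.
  have t0 := tw_gt0 dp.
  rewrite lee_fin ger0_norm; last by rewrite divr_ge0 ?exprn_ge0 // ltW.
  by apply: le_trans (ler_norm _); rewrite ler_pdivrMr // twB.
- by apply: integrable_cst_lty => //; exact: area_disk_lty.
Qed.

Lemma weight_massE m : (weight_mass m)%:E =
  (\int[area R]_(p in cellp m) (tw (plane_pt p) ^+ n.+1 / nu (plane_pt p))%:E)%E.
Proof.
rewrite /weight_mass /Rintegral fineK //; apply: integrable_fin_num => //.
exact: integrableS mD (mC m) (@cellp_diskp R m) weight_ratio_integrable.
Qed.

Lemma weight_mass_ge0 m : 0 <= weight_mass m.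
Proof.
rewrite -lee_fin weight_massE; apply: integral_ge0 => p [dp _].
by rewrite lee_fin divr_ge0 ?exprn_ge0 ?(ltW (tw_gt0 dp)) // ltW // weight_gt0.
Qed.

Let c2 : R := (tw_mass R n.+1)^-1 * 2.

Let c2_ge0 : 0 <= c2.
Proof. by rewrite mulr_ge0 // invr_ge0 ltW // tw_mass_gt0. Qed.

Lemma cell_functional_le m (f : H_infty nu) :
  normc (cell_functional m f) <= c2 * weight_mass m * real_norm f.
Proof.
rewrite (@real_norm_Hinf R nu) -[cell_functional m f]/(cell_coef n f m) /cell_coef (normcM _%:C) normcC.
rewrite ger0_norm ?invr_ge0 ?(ltW (tw_mass_gt0 _ _)) // /c2 -!mulrA ler_wpM2l //.
  by rewrite invr_ge0 ltW // tw_mass_gt0.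
have [hf bf] := HinfP f; have iW := weight_ratio_integrable.
have -> : weight_mass m * weighted_sup nu f =
   \int[area R]_(p in cellp m) (tw (plane_pt p) ^+ n.+1 / nu (plane_pt p) * weighted_sup nu f).
  rewrite RintegralZr //.
  exact: integrableS mD (mC m) (@cellp_diskp R m) iW.
apply: normc_cint_le => //.
- exact: cintegrableS (mC m) mD (@cellp_diskp R m) (weighted_integrable twB hf.1 bf).
- have := integrableZr (mC m) (weighted_sup nu f) (integrableS mD (mC m) (@cellp_diskp R m) iW).
  by apply: eq_integrable.
move=> p [dp _]; rewrite (normcM (f _)) normc_twX //.
exact: weighted_bound_pt.
Qed.

Lemma cell_functional_continuous m : continuous (cell_functional m).
Proof. exact: linear_bound_continuous (cell_functional_le m). Qed.

Definition sup_weight z : \bar R :=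
  (ereal_sup [set (op_kernel mu g phi alpha z w)%:E | w in @disk R] *
   (tw z `^ alpha / nu z)%:E)%E.

Lemma sup_weight_ge0 z : disk z -> (0 <= sup_weight z)%E.
Proof.
move=> dz; apply: mule_ge0; last by rewrite lee_fin divr_ge0 ?powR_ge0 // ltW // weight_gt0.
apply: (@le_trans _ _ (op_kernel mu g phi alpha z 0)%:E).
  by rewrite lee_fin op_kernel_ge0 //; exact: disk0.
by apply: ereal_sup_ubound; exists 0 => //; exact: disk0.
Qed.

(** Every point [z] of the cell is allowed, not only the representative, so that integration over
    the cell produces a piece of the integral in (c). *)
Lemma kdiff_norm_le : exists2 c : R, 0 < c & forall m z, cell m z ->
  ((tw z ^+ n.+1 / nu z * real_norm (L (kdiff_elt m)))%:E <=
   (c * cell_ratio m z)%:E * sup_weight z)%E.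
Proof.
have [c1 c10 H] := kdiff_bound R n.+3.
pose e : R := 2 `^ (n.+1%:R - alpha); have e0 : 0 < e by rewrite powR_gt0.
exists (c1 * e + 1) => [|m z cz]; first by rewrite ltr_wpDl // mulr_ge0 // ltW.
have dz : disk z := cz.1; have z1 : normc z < 1 := dz.
have nz : 0 < nu z by exact: weight_gt0.
have tp : 0 < tw z ^+ n.+1 / nu z by rewrite divr_gt0 // exprn_gt0 // tw_gt0.
have r0 := cell_ratio_ge0 m z1; set r := cell_ratio m z in r0 *.
have c0 : 0 < c1 * e + 1 by rewrite ltr_wpDl // mulr_ge0 // ltW.
have pt w : disk w ->
    mu w * (normc (eval (kdiff_elt m) (phi w)) * normc (derive1 g w)) * (tw z ^+ n.+1 / nu z) <=
    (c1 * e + 1) * r * (op_kernel mu g phi alpha z w * (tw z `^ alpha / nu z)).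
  move=> dw; have v1 : normc (phi w) < 1 := hphi.2 w dw; rewrite kdiff_eltE.
  have mw : 0 < mu w by exact: weight_gt0.
  have q0 : 0 <= mu w * normc (derive1 g w) / nu z.
    by apply: divr_ge0; [apply: mulr_ge0; rewrite ?normc_ge0 // ltW|exact: ltW].
  have h1 : normc (kdiff n.+3 m (phi w)) * tw z ^+ n.+1 <=
      (c1 * e + 1) * r * (tw z `^ alpha / normc (1 - conjc z * phi w) `^ (alpha + 2)).
    apply: (@le_trans _ _ (c1 * r * normc (ker n.+3 z (phi w)) * tw z ^+ n.+1)).
      by rewrite ler_wpM2r ?exprn_ge0 ?(ltW (tw_gt0 z1)) // H.
    rewrite -mulrA; apply: (@le_trans _ _ (c1 * r *
       (e * (tw z `^ alpha / normc (1 - conjc z * phi w) `^ (alpha + 2))))).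
      by rewrite ler_wpM2l ?mulr_ge0 //; exact: ker_tw_power.
    rewrite mulrA ler_wpM2r ?divr_ge0 ?powR_ge0 // mulrAC ler_wpM2r //; lra.
  have -> : mu w * (normc (kdiff n.+3 m (phi w)) * normc (derive1 g w)) * (tw z ^+ n.+1 / nu z) =
     (mu w * normc (derive1 g w) / nu z) * (normc (kdiff n.+3 m (phi w)) * tw z ^+ n.+1) by ring.
  have -> : (c1 * e + 1) * r * (op_kernel mu g phi alpha z w * (tw z `^ alpha / nu z)) =
     (mu w * normc (derive1 g w) / nu z) * ((c1 * e + 1) * r *
       (tw z `^ alpha / normc (1 - conjc z * phi w) `^ (alpha + 2))) by rewrite /op_kernel; ring.
  by rewrite ler_wpM2l.
(* The supremum may be infinite and [0 * +oo] is 0, so a vanishing ratio is treated apart: there the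
   image has norm 0. *)
have [rE|rN] := eqVneq r 0.
  rewrite rE mulr0 mul0e lee_fin; apply: mulr_ge0_le0; first exact: ltW.
  apply: op_norm_le => w dw; have := pt w dw; rewrite rE mulr0 mul0r.
  by rewrite pmulr_lle0.
have rp : 0 < (c1 * e + 1) * r by rewrite mulr_gt0 // lt_neqAle eq_sym rN.
have S0 := sup_weight_ge0 dz.
case E : (sup_weight z) S0 => [s| |] // S0; last by rewrite gt0_muley ?leey ?lte_fin.
rewrite -EFinM lee_fin mulrC -ler_pdivlMr //; apply: op_norm_le => w dw.
rewrite ler_pdivlMr //; apply: (le_trans (pt w dw)); rewrite ler_pM2l //.
rewrite -lee_fin -E /sup_weight EFinM; apply: lee_pmul => //.
- by rewrite lee_fin op_kernel_ge0.
- by rewrite lee_fin divr_ge0 ?powR_ge0 // ltW.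
- by apply: ereal_sup_ubound; exists w.
Qed.

Lemma cell_ratio_measurable m : measurable_fun (@diskp R) (fun p => cell_ratio m (plane_pt p)).
Proof.
apply: (@continuous_disk_measurable _ (cell_ratio m)) => z z1; rewrite /cell_ratio.
case: (good R m); last exact: (@cst_continuous C R 0 z).
have c3 : {for z, continuous (fun z : C => (1 - normc z)^-1)}.
  apply: (@continuous_comp C R R (@normc R) (fun t => (1 - t)^-1) z); first exact: normc_continuous.
  apply: (@continuous_comp R R R (fun t => 1 - t) (fun t => t^-1) (normc z)).
    by apply: cvgB; [exact: cvg_cst|exact: cvg_id].
  by apply: inv_continuous; rewrite gt_eqF // subr_gt0.
exact: (cvgM (cvg_cst (mesh R (lev m))) c3).
Qed.

(** Exchanging sum and integral leaves, at each [z], the ratios of the squares containing [z], and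
    [cell_ratio_sum] bounds their sum by 1. *)
Lemma nuclear_terms_summable :
  (\int[area R]_(p in @diskp R) sup_weight (plane_pt p) < +oo)%E ->
  (\sum_(0 <= m <oo) (dual_norm (cell_functional m) * real_norm (L (kdiff_elt m)))%:E < +oo)%E.
Proof.
move=> fin; have [c c0 H] := kdiff_norm_le.
have I0 : (0 <= \int[area R]_(p in @diskp R) sup_weight (plane_pt p))%E.
  by apply: integral_ge0 => p; exact: sup_weight_ge0.
have mW : measurable_fun (@diskp R) (fun p => sup_weight (plane_pt p)) by exact: op_kernel_measurable.
have N0 m : 0 <= real_norm (L (kdiff_elt m)) by exact: real_norm_ge0.
have d0 m : 0 <= dual_norm (cell_functional m) by apply: dual_norm_ge0; exact: cell_functional_continuous.
pose X m p := ((c * cell_ratio m (plane_pt p))%:E * sup_weight (plane_pt p))%E.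
have mX m : measurable_fun (@diskp R) (X m).
  apply: emeasurable_funM => //; apply/measurable_EFinP.
  by apply: measurable_funM => //; exact: cell_ratio_measurable.
have X0 m p : diskp p -> (0 <= X m p)%E.
  by move=> dp; rewrite mule_ge0 ?sup_weight_ge0 // lee_fin mulr_ge0 ?cell_ratio_ge0 // ltW.
have mV m : measurable_fun (cellp m) (fun p => (tw (plane_pt p) ^+ n.+1 / nu (plane_pt p))%:E).
  by have /integrableP[] := integrableS mD (mC m) (@cellp_diskp R m) weight_ratio_integrable.
have term m : ((dual_norm (cell_functional m) * real_norm (L (kdiff_elt m)))%:E <=
    c2%:E * \int[area R]_(p in @diskp R) (X m \_ (cellp m)) p)%E.
  apply: (@le_trans _ _ (c2 * (weight_mass m * real_norm (L (kdiff_elt m))))%:E).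
    rewrite lee_fin mulrA ler_wpM2r //; apply: dual_norm_le.
      by rewrite mulr_ge0 // weight_mass_ge0.
    exact: cell_functional_le.
  rewrite EFinM; apply: lee_pmul; rewrite ?lee_fin //.
    by apply: mulr_ge0 => //; exact: weight_mass_ge0.
  have -> : (\int[area R]_(p in @diskp R) (X m \_ (cellp m)) p = \int[area R]_(p in cellp m) X m p)%E.
    by rewrite -[in RHS](setIidr (@cellp_diskp R m)) integral_mkcondr.
  rewrite EFinM weight_massE.
  rewrite -ge0_integralZr //; last 2 first.
  - move=> p [dp _]; rewrite lee_fin divr_ge0 ?exprn_ge0 ?(ltW (tw_gt0 dp)) //.
    by rewrite ltW // weight_gt0.
  - by rewrite lee_fin.
  apply: ge0_le_integral => //.
  - move=> p [dp _]; rewrite -EFinM lee_fin mulr_ge0 // divr_ge0 ?exprn_ge0 ?(ltW (tw_gt0 dp)) //.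
    by rewrite ltW // weight_gt0.
  - by apply: emeasurable_funM; [exact: mV|exact: measurable_cst].
  - exact: measurable_funS mD (@cellp_diskp R m) (mX m).
  - by move=> p cp; rewrite -EFinM; exact: H cp.
have Y0 m p : diskp p -> (0 <= (X m \_ (cellp m)) p)%E.
  by move=> dp; rewrite patchE; case: ifP => // _; exact: X0.
have sumX K p : diskp p -> (\sum_(0 <= m < 4 ^ K) (X m \_ (cellp m)) p <= c%:E * sup_weight (plane_pt p))%E.
  move=> dp; have z1 : normc (plane_pt p) < 1 := dp.
  have -> : (\sum_(0 <= m < 4 ^ K) (X m \_ (cellp m)) p =
     \sum_(0 <= m < 4 ^ K) (if m == code (lev m) (plane_pt p)
        then c * cell_ratio m (plane_pt p) else 0)%:E * sup_weight (plane_pt p))%E.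
    apply: eq_bigr => m _; rewrite patchE.
    have -> : (p \in cellp m) = (m == code (lev m) (plane_pt p)).
      by apply/idP/eqP => [/set_mem[_ h]|h]; [by rewrite h|apply/mem_set; split => //; exact: esym h].
    by case: ifP => _ //; rewrite mul0e.
  rewrite -ge0_sume_distrl; last first.
    by move=> m _; rewrite lee_fin; case: ifP => // _; rewrite mulr_ge0 ?cell_ratio_ge0 // ltW.
  rewrite sumEFin (block_sum (fun m => c * cell_ratio m (plane_pt p)) _ dp).
  rewrite -mulr_sumr; apply: lee_wpmul2r; first exact: sup_weight_ge0.
  by rewrite lee_fin ler_piMr ?(ltW c0) // cell_ratio_sum.
apply: (@le_lt_trans _ _ (c2%:E * (c%:E * \int[area R]_(p in @diskp R) sup_weight (plane_pt p)))%E); last first.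
  rewrite -(fineK (x := \int[area R]_(p in _) _)%E); last by rewrite ge0_fin_numE.
  by rewrite -!EFinM ltry.
apply: nneseries_partial_le => [k|K]; first by rewrite lee_fin mulr_ge0.
(* A partial sum is enlarged to complete generations, the form in which [block_sum] applies. *)
apply: (@le_trans _ _ (\sum_(0 <= m < 4 ^ K)
    (dual_norm (cell_functional m) * real_norm (L (kdiff_elt m)))%:E)%E).
  rewrite [leRHS](big_cat_nat (n := K)) //=; last by apply: ltnW; exact: ltn_expl.
  rewrite leeDl //; apply: sume_ge0 => m _; rewrite lee_fin.
  exact: mulr_ge0 (d0 m) (N0 m).
apply: (@le_trans _ _ (\sum_(0 <= m < 4 ^ K)
    c2%:E * \int[area R]_(p in @diskp R) (X m \_ (cellp m)) p)%E); first by apply: lee_sum => m _; exact: term.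
rewrite -ge0_sume_distrr; last by move=> m _; apply: integral_ge0 => p; exact: Y0.
apply: lee_wpmul2l; first by rewrite lee_fin.
have mY m : measurable_fun (@diskp R) (X m \_ (cellp m)).
  apply: measurable_funS measurableT (@subsetT _ _) _.
  apply/(measurable_restrictT _ (mC m)).
  exact: measurable_funS mD (@cellp_diskp R m) (mX m).
rewrite -ge0_integral_sum // -ge0_integralZl //; last 2 first.
- by move=> p; exact: sup_weight_ge0.
- by rewrite lee_fin ltW.
apply: ge0_le_integral => //.
- by move=> p dp; apply: sume_ge0 => m _; exact: Y0.
- exact: emeasurable_sum.
- by apply: measurable_funeM.
- exact: sumX.
Qed.

(** The expansion is known to converge only pointwise and along complete generations. The remainder
    after an arbitrary [Q] is therefore estimated at each [w] separately, by a tail of the summable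
    series that is the same for all [w]. *)
Lemma integral_nuclear :
  (\int[area R]_(p in @diskp R) sup_weight (plane_pt p) < +oo)%E -> nuclear L.
Proof.
move=> fin; have su := nuclear_terms_summable fin.
have cc m := @cell_functional_continuous m.
have u0 m : 0 <= dual_norm (cell_functional m) * real_norm (L (kdiff_elt m)).
  by rewrite mulr_ge0 ?real_norm_ge0 // dual_norm_ge0.
exists cell_functional, (fun m => L (kdiff_elt m)); split => // f.
apply/cvgrPdist_le => -[e e'] he.
have [/eqP e'0 e0] : e' == 0 /\ 0 < e by move: he => /andP[].
rewrite {}e'0 {e' he}.
have f1 : 0 < real_norm f + 1 by rewrite ltr_wpDl // real_norm_ge0.
have [Q0 HQ] := nneseries_tail_small u0 su (divr_gt0 e0 f1).
exists Q0 => // Q /= QQ.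
pose h : H_infty nu := f - \sum_(0 <= k < Q) cell_functional k f *: kdiff_elt k.
have -> : L f - series (fun k => cell_functional k f *: L (kdiff_elt k)) Q = L h.
  have -> : series (fun k => cell_functional k f *: L (kdiff_elt k)) Q =
      L (\sum_(0 <= k < Q) cell_functional k f *: kdiff_elt k).
    by rewrite [RHS]linear_sum /series; apply: eq_bigr => k _; rewrite linearZ.
  by rewrite -[RHS]/(L (f - _)) [RHS]linearB.
rewrite real_normE lecR; apply: op_norm_le => w dw; set v := phi w.
have v1 : normc v < 1 := hphi.2 w dw; have mw : 0 < mu w by exact: weight_gt0.
have hv : eval h v = f v - \sum_(0 <= k < Q) cell_coef n f k * kdiff n.+3 k v.
  rewrite /h -[eval _ v]/(f v - (\sum_(0 <= k < Q) cell_functional k f *: kdiff_elt k : Hinf nu) v).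
  rewrite Hinf_sum; congr (_ - _); apply: eq_bigr => k _.
  by rewrite -[kdiff_elt k v]/(eval (kdiff_elt k) v) kdiff_eltE.
apply/ler_addgt0Pr => e2 e20.
pose G := mu w * normc (derive1 g w); have G0 : 0 <= G by rewrite mulr_ge0 ?normc_ge0 // ltW.
have G1 : 0 < G + 1 by rewrite ltr_wpDl.
have [hf bf] := HinfP f.
have [K0 HK] := cell_expansion twB hf.1 bf v1 (divr_gt0 e20 G1).
(* Late enough for the expansion at [v] and for [4 ^ K.+1] to pass [Q]. It depends on [w] and [e2],
   but the bound on the tail does not. *)
pose K := maxn K0 Q.
have QK : (Q <= 4 ^ K.+1)%N.
  by apply: leq_trans (leq_maxr K0 Q) _; apply: leq_trans (leqnSn _) (ltnW _); exact: ltn_expl.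
have := HK K (leq_maxl _ _); rewrite (big_cat_nat (n := Q)) //=.
set S1 := \sum_(0 <= k < Q) _; set S2 := \sum_(Q <= k < _) _ => hS.
(* The remainder [f v - S1] is the tail [S2] up to generation [K], corrected by the error of the
   expansion. *)
have -> : mu w * (normc (eval h v) * normc (derive1 g w)) = G * normc (S2 - (S1 + S2 - f v)).
  rewrite hv -/S1 (_ : S2 - (S1 + S2 - f v) = f v - S1); last by ring.
  by rewrite /G; ring.
apply: (@le_trans _ _ (G * normc S2 + G * normc (S1 + S2 - f v))).
  by rewrite -mulrDr ler_wpM2l //; apply: le_trans (normcD _ _) _; rewrite normcN.
apply: lerD; last first.
  apply: (@le_trans _ _ (G * (e2 / (G + 1)))); first by rewrite ler_wpM2l.
  by rewrite mulrA ler_pdivrMr // mulrC ler_pM2l // lerDl.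
apply: (@le_trans _ _ (real_norm f * \sum_(Q <= k < 4 ^ K.+1)
    dual_norm (cell_functional k) * real_norm (L (kdiff_elt k)))); last first.
  apply: (@le_trans _ _ (real_norm f * (e / (real_norm f + 1)))).
    by rewrite ler_wpM2l ?real_norm_ge0 // HQ.
  by rewrite mulrA ler_pdivrMr // mulrC ler_pM2l // lerDl.
apply: (@le_trans _ _ (G * \sum_(Q <= k < 4 ^ K.+1) normc (cell_coef n f k * kdiff n.+3 k v))).
  rewrite ler_wpM2l // /S2; elim/big_rec2: _ => [|k x y _ xy]; first by rewrite normc0.
  by apply: le_trans (normcD _ _) _; rewrite lerD2l.
rewrite !mulr_sumr; apply: ler_sum => k _.
have b := op_norm_ge (kdiff_elt k) dw; rewrite kdiff_eltE -/v in b.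
have d : normc (cell_coef n f k) <= dual_norm (cell_functional k) * real_norm f.
  exact: (dual_normP f (cc k)).
rewrite (normcM (cell_coef _ _ _)).
have -> : G * (normc (cell_coef n f k) * normc (kdiff n.+3 k v)) =
   normc (cell_coef n f k) * (mu w * (normc (kdiff n.+3 k v) * normc (derive1 g w))) by rewrite /G; ring.
have -> : real_norm f * (dual_norm (cell_functional k) * real_norm (L (kdiff_elt k))) =
   dual_norm (cell_functional k) * real_norm f * real_norm (L (kdiff_elt k)) by ring.
apply: ler_pM => //; first exact: normc_ge0.
by apply: mulr_ge0; [exact: ltW|apply: mulr_ge0; exact: normc_ge0].
Qed.

End integral_to_nuclear.

(** This identifies the given [alpha] with the exponent inside [normal_pair], which is the one known
    to exceed [beta - 1]. *)
Lemma powR_inj_exponent (R : realType) (x a b : R) : 0 < x < 1 -> x `^ a = x `^ b -> a = b.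
Proof.
move=> x01 /(congr1 (@ln R)); rewrite !ln_powR => /mulIf; apply.
by rewrite lt_eqF // ln_lt0.
Qed.

Lemma mule_lty (R : realType) (k : R) (x : \bar R) : 0 < k -> (0 <= x)%E ->
  ((k%:E * x < +oo) <-> (x < +oo))%E.
Proof.
move=> k0; case: x => [x| |] // _; first by rewrite -EFinM !ltry.
by rewrite gt0_muley ?lte_fin.
Qed.

Theorem corollary1 (R : realType) (nu mu : radial_weight R)
    (omega : R[i] -> R) (alpha : R) (g phi : R[i] -> R[i]) :
  normal nu -> normal mu -> -1 < alpha ->
  normal_pair nu omega ->
  (forall r : R, 0 <= r < 1 ->
    nu r%:C * omega r%:C = (1 - r ^+ 2) `^ alpha) ->
  holomorphic g -> self_map phi ->
  bounded_from_to (T_op g phi) (H_infty nu) (Bloch mu) ->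
  (nuclear_from_to (T_op g phi) (H_zero nu) (Bloch mu) <->
   nuclear_from_to (T_op g phi) (H_infty nu) (Bloch mu)) /\
  (nuclear_from_to (T_op g phi) (H_infty nu) (Bloch mu) <->
   (area_integral (fun zeta : R[i] =>
      ereal_sup [set (mu z * normc (derive1 g z) /
                      normc (1 - conjc zeta * phi z) `^ (alpha + 2))%:E |
                 z in @disk R] *
      ((1 - normc zeta ^+ 2) `^ alpha / nu zeta)%:E) < +oo)%E).
Proof.
move=> [_ [gamma g0 hdecr]] _ a1 [_ _ _ [a' [beta [hnu ba' pairE']]]] pairE hg hphi [L hL _].
have half : 0 <= (2^-1 : R) < 1 by lra.
have aE : alpha = a'.
  apply: (@powR_inj_exponent R (1 - 2^-1 ^+ 2)); last by rewrite -pairE // -pairE'.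
  by apply/andP; split; rewrite expr2; lra.
have ba : beta - 1 < alpha by rewrite aE.
(* The integer [p] is [n.+1]: positive, and at least both [alpha] and [beta]. *)
pose x : R := `|alpha| + `|beta|.
have x0 : 0 <= x by rewrite addr_ge0.
pose n := Num.bound x.
have xn : x < n%:R by exact: archi_boundP.
have n1 : n%:R <= n.+1%:R :> R by rewrite ler_nat.
have aN := ler_norm alpha; have bN := ler_norm beta.
have aN0 := normr_ge0 alpha; have bN0 := normr_ge0 beta.
have an : alpha <= n.+1%:R by move: xn; rewrite /x; lra.
have bn : beta <= n.+1%:R by move: xn; rewrite /x; lra.
have [B B0 twB] := tw_weight_bounded hnu bn.
pose I := (\int[area R]_(t in @diskp R) sup_weight nu mu alpha g phi (plane_pt t))%E.
have I0 : (0 <= I)%E by apply: integral_ge0 => p; exact: sup_weight_ge0.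
(* The two integrals agree by conversion, and the normalizing factor [pi^-1] does not affect
   finiteness. *)
have areaE : (area_integral (fun zeta : R[i] =>
      ereal_sup [set (mu z * normc (derive1 g z) /
                      normc (1 - conjc zeta * phi z) `^ (alpha + 2))%:E |
                 z in @disk R] *
      ((1 - normc zeta ^+ 2) `^ alpha / nu zeta)%:E) = (pi^-1)%:E * I)%E by [].
have pi0 : 0 < (pi^-1 : R) by rewrite invr_gt0 pi_gt0.
have ac : nuclear_from_to (T_op g phi) (H_zero nu) (Bloch mu) -> (I < +oo)%E.
  apply: (nuclear_integral_lty (p := n.+1) a1 hnu g0 hdecr ba) => //.
  by have := bn; lra.
have cb : (I < +oo)%E -> nuclear_from_to (T_op g phi) (H_infty nu) (Bloch mu).
  move=> fin; exists L => //.
  have Hk z : normc z < 1 -> kfun n.+3 z \in H0_pred nu by exact: kfun_H0 g0 hdecr.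
  exact: (integral_nuclear a1 an twB hg hphi Hk hL fin).
split; split; try exact: nuclear_H0_of_Hinf; first by move=> /ac /cb.
- by move=> /nuclear_H0_of_Hinf /ac; rewrite areaE mule_lty.
- by rewrite areaE mule_lty.
Qed.
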